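(* Let $G$ be a simply connected (in particular connected) Lie group with a bi-invariant pseudo-Riemannian metric, and let $B$ be the corresponding $\mathrm{Ad}$-invariant non-degenerate symmetric bilinear form on the Lie algebra $\mathfrak{g}$. Then there is a well-defined smooth, $\mathrm{Ad}$-invariant differential form $\psi\in\Omega(G)$ such that $$\psi_g={\det}^{1/2}\Big(\tfrac{\mathrm{Ad}_g+1}{2}\Big)\,\exp\Big(\tfrac14 B\big(\tfrac{1-\mathrm{Ad}_g}{1+\mathrm{Ad}_g}\theta^L,\theta^L\big)\Big)$$ at all elements $g\in G$ such that $\mathrm{Ad}_g+1$ is invertible, for a suitable choice at each such $g$ of the sign of the (real) square root of $\det\big(\tfrac{\mathrm{Ad}_g+1}{2}\big)$, normalized to equal $+1$ at $g=e$.
   Context: $\theta^L\in\Omega^1(G)\otimes\mathfrak{g}$ is the left-invariant Maurer–Cartan form ($\theta^L=g^{-1}dg$ in matrix representations). For $g$ with $\mathrm{Ad}_g+1$ invertible, $D=\frac{1-\mathrm{Ad}_g}{1+\mathrm{Ad}_g}$ is a $B$-skew-adjoint endomorphism of $\mathfrak g$, and $B(D\theta^L,\theta^L)$ is the 2-form at $g$ obtained by combining $B$ with the wedge product: $B(D\theta^L,\theta^L)(X,Y)=B(D\theta^L(X),\theta^L(Y))-B(D\theta^L(Y),\theta^L(X))$. The exponential is taken in the exterior algebra $\wedge T_g^*G$. $\mathrm{Ad}$-invariant means invariant under pull-back by all maps $a\mapsto hah^{-1}$, $h\in G$. *)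

(* Defs.v *)
From HB Require Import structures.
From mathcomp Require Import all_boot all_order all_algebra.
From mathcomp Require Import all_classical all_reals all_analysis.

Set Implicit Arguments.
Unset Strict Implicit.
Unset Printing Implicit Defensive.

Import Order.TTheory GRing.Theory Num.Theory.
Import numFieldNormedType.Exports.

Local Open Scope classical_set_scope.
Local Open Scope ring_scope.

(* C^k and C^oo maps; only meaningful for U open. *)
Fixpoint Ck_on (R : realType) (V W : normedModType R) (k : nat) (U : set V)
    (f : V -> W) : Prop :=
  match k with
  | 0%N => forall x, U x -> {for x, continuous f}
  | k'.+1 => (forall x, U x -> differentiable f x) /\
             (forall v, Ck_on k' U ('D_v f))
  end.

Definition smooth_on (R : realType) (V W : normedModType R) (U : set V)
    (f : V -> W) : Prop :=
  forall k, Ck_on k U f.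

(* chart_inv is only constrained on chart_cod. *)
Record chart (R : realType) (n : nat) (M : topologicalType) := Chart {
  chart_dom : set M;
  chart_fun :> M -> 'rV[R]_n;
  chart_inv : 'rV[R]_n -> M }.

Definition chart_cod (R : realType) n (M : topologicalType)
    (c : chart R n M) : set 'rV[R]_n :=
  c @` chart_dom c.

Definition is_chart (R : realType) n (M : topologicalType)
    (c : chart R n M) : Prop :=
  [/\ open (chart_dom c), open (chart_cod c),
      (forall p, chart_dom c p -> chart_inv c (c p) = p),
      (forall p, chart_dom c p -> {for p, continuous c}) &
      (forall x, chart_cod c x -> {for x, continuous (chart_inv c)})].

(* The atlas comes with a preferred chart around each point, which is used
   below to identify every tangent space with 'rV[R]_n. *)
HB.mixin Record isSmoothManifold (R : realType) (n : nat) M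
    of Topological M := {
  chart_at : M -> chart R n M;
  chart_atP : forall p, is_chart (chart_at p);
  mem_chart_at : forall p, chart_dom (chart_at p) p;
  chart_at_compat : forall p q,
    smooth_on
      (chart_cod (chart_at p) `&`
         chart_inv (chart_at p) @^-1` chart_dom (chart_at q))
      (chart_at q \o chart_inv (chart_at p));
  manifold_hausdorff : hausdorff_space M;
  manifold_second_countable : @second_countable M }.

#[short(type="smoothManifoldType")]
HB.structure Definition SmoothManifold (R : realType) (n : nat) :=
  {M of isSmoothManifold R n M & Topological M}.

Definition smooth_map (R : realType) m n (M : smoothManifoldType R m)
    (N : smoothManifoldType R n) (f : M -> N) : Prop :=
  continuous f /\
  forall p q,
    smooth_on
      (chart_cod (chart_at p) `&`
         (f \o chart_inv (chart_at p)) @^-1` chart_dom (chart_at q))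
      (chart_at q \o f \o chart_inv (chart_at p)).

(* The second axiom is the smoothness of (a, b) |-> a * b in the product
   charts of G * G. *)
HB.mixin Record SmoothManifold_isLieGroup (R : realType) (n : nat) G
    of SmoothManifold R n G & Group G := {
  mulg_continuous : continuous (fun x : G * G => (x.1 * x.2)%g);
  mulg_smooth : forall a b c : G,
    smooth_on
      [set x : 'rV[R]_n * 'rV[R]_n |
         [/\ chart_cod (chart_at a) x.1, chart_cod (chart_at b) x.2 &
             chart_dom (chart_at c)
               (chart_inv (chart_at a) x.1 * chart_inv (chart_at b) x.2)%g]]
      (fun x => chart_at c
               (chart_inv (chart_at a) x.1 * chart_inv (chart_at b) x.2)%g);
  invg_smooth : smooth_map (fun a : G => (a^-1)%g) }.

#[short(type="lieGroupType")]
HB.structure Definition LieGroup (R : realType) (n : nat) :=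
  {G of SmoothManifold_isLieGroup R n G & SmoothManifold R n G & Group G}.

Definition path_connected (R : realType) (T : topologicalType) : Prop :=
  forall x y : T, exists gamma : R -> T,
    [/\ {within `[0, 1], continuous gamma}, gamma 0 = x & gamma 1 = y].

Definition simply_connected (R : realType) (T : topologicalType) : Prop :=
  path_connected R T /\
  forall (x : T) (gamma : R -> T),
    {within `[0, 1], continuous gamma} -> gamma 0 = x -> gamma 1 = x ->
    exists H : R * R -> T,
      [/\ {within `[0, 1] `*` `[0, 1], continuous H},
          {in `[0, 1], forall t, H (0, t) = gamma t},
          {in `[0, 1], forall t, H (1, t) = x} &
          {in `[0, 1], forall s, H (s, 0) = x /\ H (s, 1) = x}].

(* Tangent vectors at p are the row vectors of their coordinates in chart_at p;
   linear maps act on them by multiplication on the right, so products of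
   matrices are in the order opposite to the composition of maps. *)
Definition tangent_mx (R : realType) m n (M : smoothManifoldType R m)
    (N : smoothManifoldType R n) (f : M -> N) (p : M) : 'M[R]_(m, n) :=
  'J (chart_at (f p) \o f \o chart_inv (chart_at p)) (chart_at p p).

(* Its i-th row is the i-th coordinate vector field of the chart c at the point
   of coordinates x. *)
Definition chart_frame (R : realType) n (M : smoothManifoldType R n)
    (c : chart R n M) (x : 'rV[R]_n) : 'M[R]_n :=
  'J (chart_at (chart_inv c x) \o chart_inv c) x.

Section Metric.
Context (R : realType) (n : nat).

Definition pseudo_riemannian_metric (M : smoothManifoldType R n)
    (b : M -> 'rV[R]_n -> 'rV[R]_n -> R) : Prop :=
  [/\ forall p, (forall u, scalar (b p u)) /\ (forall v, scalar (b p ^~ v)),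
      forall p u v, b p u v = b p v u,
      forall p u, (forall v, b p u v = 0) -> u = 0 &
      forall p u v,
        smooth_on (chart_cod (chart_at p))
          (fun x => b (chart_inv (chart_at p) x)
                      (u *m chart_frame (chart_at p) x)
                      (v *m chart_frame (chart_at p) x))].

Definition bi_invariant (G : lieGroupType R n)
    (b : G -> 'rV[R]_n -> 'rV[R]_n -> R) : Prop :=
  forall h g u v,
    b (h * g)%g (u *m tangent_mx (fun a : G => h * a)%g g)
                (v *m tangent_mx (fun a : G => h * a)%g g) = b g u v /\
    b (g * h)%g (u *m tangent_mx (fun a : G => a * h)%g g)
                (v *m tangent_mx (fun a : G => a * h)%g g) = b g u v.

End Metric.

Section ExteriorAlgebra.
Context (R : realType) (n : nat).

(* Elements of the exterior algebra of the dual of 'rV[R]_n, as families, indexed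
   by the degree k, of alternating k-linear forms; the k arguments of a form are
   the rows of a matrix. *)
Definition mixed_form := forall k : nat, 'M[R]_(k, n) -> R.

(* The two clauses are modelled on determinant_multilinear and
   determinant_alternate. *)
Definition is_alternating_form (w : mixed_form) : Prop :=
  forall k,
    (forall (A B C : 'M[R]_(k, n)) (i : 'I_k) (b c : R),
       row i A = b *: row i B + c *: row i C ->
       row' i B = row' i A -> row' i C = row' i A ->
       w k A = b * w k B + c * w k C) /\
    (forall (A : 'M[R]_(k, n)) (i j : 'I_k),
       i != j -> row i A = row j A -> w k A = 0).

(* The shuffles of 'I_k are indexed by the set S of the positions given to the
   left factor. *)
Definition form_wedge (w1 w2 : mixed_form) : mixed_form := fun k A =>
  \sum_(S : {set 'I_k})
    (-1) ^+ #|[pred ij : 'I_k * 'I_k |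
                [&& ij.1 \in S, ij.2 \notin S & (ij.2 < ij.1)%N]]| *
    w1 #|S| (rowsub enum_val A) * w2 #|~: S| (rowsub enum_val A).

Definition form_one : mixed_form := fun k _ => (k == 0%N)%:R.

Definition form_scale (a : R) (w : mixed_form) : mixed_form :=
  fun k A => a * w k A.

Definition form_power (w : mixed_form) (i : nat) : mixed_form :=
  iter i (form_wedge w) form_one.

(* The exponential series of a form w without component of degree 0: the powers
   w^i with i > n vanish. *)
Definition form_exp (w : mixed_form) : mixed_form := fun k A =>
  \sum_(i < n.+1) (i`!%:R)^-1 * form_power w i A.

Definition two_form (b : 'rV[R]_n -> 'rV[R]_n -> R) : mixed_form := fun k =>
  match k return 'M[R]_(k, n) -> R with
  | 2 => fun A => b (row 0 A) (row 1 A)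
  | _ => fun _ => 0
  end.

End ExteriorAlgebra.

(* Elements of Omega(M), of mixed degree. *)
Definition smooth_form (R : realType) n (M : smoothManifoldType R n)
    (w : M -> mixed_form R n) : Prop :=
  (forall p, is_alternating_form (w p)) /\
  forall p k (A : 'M[R]_(k, n)),
    smooth_on (chart_cod (chart_at p))
      (fun x => w (chart_inv (chart_at p) x) k
                  (A *m chart_frame (chart_at p) x)).

Section AdjointAction.
Context (R : realType) (n : nat) (G : lieGroupType R n).

Definition conj_by (h a : G) : G := (h * a * h^-1)%g.

(* The Lie algebra is the tangent space at 1. *)
Definition Ad (g : G) : 'M[R]_n := tangent_mx (conj_by g) (1%g : G).

Definition thetaL (g : G) : 'M[R]_n := tangent_mx (fun a : G => g^-1 * a)%g g.

Definition Ad_cayley (g : G) : 'M[R]_n :=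
  (1%:M - Ad g) *m invmx (1%:M + Ad g).

(* The 2-form B(D thetaL, thetaL) at g, with D = (1 - Ad g) / (1 + Ad g). *)
Definition cayley_form (B : 'rV[R]_n -> 'rV[R]_n -> R) (g : G) :
    mixed_form R n :=
  two_form (fun X Y =>
    B (X *m thetaL g *m Ad_cayley g) (Y *m thetaL g) -
    B (Y *m thetaL g *m Ad_cayley g) (X *m thetaL g)).

Definition Ad_invariant (w : G -> mixed_form R n) : Prop :=
  forall h g k (A : 'M[R]_(k, n)),
    w (conj_by h g) k (A *m tangent_mx (conj_by h) g) = w g k A.

End AdjointAction.

(* Main.v *)
Require Import Defs.
From HB Require Import structures.
From mathcomp Require Import all_boot all_order all_algebra.
From mathcomp Require Import all_classical all_reals all_analysis.
From mathcomp Require Import perm lra.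

(* The exterior algebra of the dual of the Lie algebra carries two anticommuting
   families of Clifford generators, for B and - B. An orthogonal transformation A
   acting on the first family only is implemented by an operator T that is unique up
   to sign once it is required to preserve the Mukai pairing; the pairs (A, T) form
   a double cover of a subgroup of the orthogonal group. Since G is simply connected, Ad lifts to a
   homomorphism S into this double cover, and psi_g is the pure spinor S(g) vac,
   transported to g by left translations. Where 1 + A is invertible, T is a scalar
   multiple of an explicit normally ordered Gaussian; the scalar is the vacuum
   coefficient of T and squares to det ((1 + A) / 2), which gives the formula.
   For uniqueness, a matrix coefficient of the representation S that is nonzero at e
   vanishes on no open set, so 1 + Ad_g is invertible on a dense set, on which the
   formula determines psi up to sign; by continuity the sign is constant along paths
   starting at e. *)

Set Implicit Arguments.
Unset Strict Implicit.
Unset Printing Implicit Defensive.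

Import Order.TTheory GRing.Theory Num.Theory.
Import numFieldNormedType.Exports.

Local Open Scope ring_scope.

(** * Fock space *)

Fixpoint fock_dim (n : nat) : nat :=
  if n is m.+1 then (fock_dim m + (fock_dim m).+1)%N else 0%N.

Section FockSpace.
Context (R : numFieldType).

Notation fock_mx n := 'M[R]_((fock_dim n).+1).

Definition fock_block n (a b c d : fock_mx n) : fock_mx n.+1 :=
  block_mx a b c d : 'M[R]_((fock_dim n).+1 + (fock_dim n).+1).

Definition fock_col n (u v : 'cV[R]_((fock_dim n).+1)) :
    'cV[R]_((fock_dim n.+1).+1) :=
  col_mx u v : 'cV[R]_((fock_dim n).+1 + (fock_dim n).+1).

Lemma fock_blockM n (a b c d a' b' c' d' : fock_mx n) :
  fock_block a b c d *m fock_block a' b' c' d' =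
  fock_block (a *m a' + b *m c') (a *m b' + b *m d')
             (c *m a' + d *m c') (c *m b' + d *m d').
Proof.
exact: (@mulmx_block _ (fock_dim n).+1 (fock_dim n).+1 (fock_dim n).+1 _ (fock_dim n).+1).
Qed.

Lemma fock_blockD n (a b c d a' b' c' d' : fock_mx n) :
  fock_block a b c d + fock_block a' b' c' d' =
  fock_block (a + a') (b + b') (c + c') (d + d').
Proof. exact: (@add_block_mx _ (fock_dim n).+1 _ (fock_dim n).+1). Qed.

Lemma fock_blockN n (a b c d : fock_mx n) :
  - fock_block a b c d = fock_block (- a) (- b) (- c) (- d).
Proof. exact: (@opp_block_mx _ (fock_dim n).+1 _ (fock_dim n).+1). Qed.

Lemma fock_blockZ n x (a b c d : fock_mx n) :
  x *: fock_block a b c d = fock_block (x *: a) (x *: b) (x *: c) (x *: d).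
Proof. exact: (@scale_block_mx _ (fock_dim n).+1 _ (fock_dim n).+1). Qed.

Lemma fock_block_scalar n x : x%:M = fock_block x%:M 0 0 x%:M :> fock_mx n.+1.
Proof. exact: (@scalar_mx_block _ (fock_dim n).+1). Qed.

Lemma tr_fock_block n (a b c d : fock_mx n) :
  (fock_block a b c d)^T = fock_block a^T c^T b^T d^T.
Proof. exact: (@tr_block_mx _ (fock_dim n).+1 _ (fock_dim n).+1). Qed.

Lemma fock_blockMcol n (a b c d : fock_mx n) u v :
  fock_block a b c d *m fock_col u v = fock_col (a *m u + b *m v) (c *m u + d *m v).
Proof. exact: (@mul_block_col _ (fock_dim n).+1 _ (fock_dim n).+1). Qed.

Lemma fock_colZ n x (u v : 'cV[R]_((fock_dim n).+1)) :
  x *: fock_col u v = fock_col (x *: u) (x *: v).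
Proof. exact: (@scale_col_mx _ (fock_dim n).+1). Qed.

Lemma fock_col0 n : fock_col 0 0 = 0 :> 'cV[R]_((fock_dim n.+1).+1).
Proof. exact: (@col_mx0 _ (fock_dim n).+1). Qed.

Lemma fock_colP n (y : 'cV[R]_((fock_dim n.+1).+1)) : exists u v, y = fock_col u v.
Proof.
exists (usubmx (y : 'cV[R]_((fock_dim n).+1 + (fock_dim n).+1))).
exists (dsubmx (y : 'cV[R]_((fock_dim n).+1 + (fock_dim n).+1))).
exact: esym (@vsubmxK _ (fock_dim n).+1 _ _ _).
Qed.

Lemma fock_col_eq0 n (u v : 'cV[R]_((fock_dim n).+1)) :
  fock_col u v = 0 -> u = 0 /\ v = 0.
Proof. by rewrite -fock_col0 => /(@eq_col_mx _ (fock_dim n).+1). Qed.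

Lemma tr_fock_colM n (u v u' v' : 'cV[R]_((fock_dim n).+1)) :
  (fock_col u v)^T *m fock_col u' v' = u^T *m u' + v^T *m v'.
Proof. by have := mul_row_col u^T v^T u' v'; rewrite -tr_col_mx. Qed.

(* Jordan-Wigner matrices of the contractions with the basis vectors, acting on
   the exterior algebra of the dual of 'rV[R]_n; the second block of coordinates
   consists of the multiples of the first basis covector. *)
Fixpoint ann (n : nat) : 'I_n -> fock_mx n :=
  match n return 'I_n -> fock_mx n with
  | 0 => fun=> 0
  | m.+1 => fun i =>
      if unlift ord0 i is Some j then fock_block (ann j) 0 0 (- ann j)
      else fock_block 0 1%:M 0 0
  end.

Lemma ann_ord0 m : ann (ord0 : 'I_m.+1) = fock_block 0 1%:M 0 0.
Proof. by rewrite /= unlift_none. Qed.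

Lemma ann_lift m (j : 'I_m) :
  ann (lift ord0 j) = fock_block (ann j) 0 0 (- ann j).
Proof. by rewrite /= liftK. Qed.

Definition cre (n : nat) (i : 'I_n) : fock_mx n := (ann i)^T.

Lemma tr_cre n (i : 'I_n) : (cre i)^T = ann i.
Proof. exact: trmxK. Qed.

Lemma cre_ord0 m : cre (ord0 : 'I_m.+1) = fock_block 0 0 1%:M 0.
Proof. by rewrite /cre ann_ord0 tr_fock_block trmx1 !trmx0. Qed.

Lemma cre_lift m (j : 'I_m) :
  cre (lift ord0 j) = fock_block (cre j) 0 0 (- cre j).
Proof. by rewrite /cre ann_lift tr_fock_block !trmx0 linearN. Qed.

Fixpoint vac (n : nat) : 'cV[R]_((fock_dim n).+1) :=
  if n is m.+1 then fock_col (vac m) 0 else 1%:M.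

Fixpoint top (n : nat) : 'cV[R]_((fock_dim n).+1) :=
  if n is m.+1 then fock_col 0 (top m) else 1%:M.

Definition swap_sign (n : nat) : R := (-1) ^+ n.

(* Exchanges creation and annihilation operators up to sign; it plays the role
   of the Mukai pairing. *)
Fixpoint hodge (n : nat) : fock_mx n :=
  if n is m.+1 then fock_block 0 (hodge m) (swap_sign m.+1 *: hodge m) 0
  else 1%:M.

Let mx0E := (@mul0mx, @mulmx0, @mulNmx, @mulmxN, @mul1mx, @mulmx1, @oppr0, @opprK,
  @add0r, @addr0, @scaler0, @trmx0).

Lemma annC n (i j : 'I_n) : ann i * ann j = - (ann j * ann i).
Proof.
rewrite -!mulmxE; elim: n i j => [|m IHm] i j; first by case: i.
case: (unliftP ord0 i) => [i' ->|->]; case: (unliftP ord0 j) => [j' ->|->];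
  rewrite ?ann_ord0 ?ann_lift !fock_blockM fock_blockN ?mx0E //.
by rewrite IHm.
Qed.

Lemma ann_cre n (i j : 'I_n) : ann i * cre j = (i == j)%:R - cre j * ann i.
Proof.
apply/eqP; rewrite eq_sym subr_eq eq_sym; apply/eqP.
have natE k (b : bool) : b%:R = b%:R%:M :> fock_mx k by rewrite -scalemx1 scaler_nat.
rewrite natE -!mulmxE; elim: n i j => [|m IHm] i j; first by case: i.
case: (unliftP ord0 i) => [i' ->|->]; case: (unliftP ord0 j) => [j' ->|->];
  rewrite ?ann_ord0 ?ann_lift ?cre_ord0 ?cre_lift !fock_blockM fock_blockD
    fock_block_scalar ?mx0E ?subrr ?addNr //.
- by rewrite IHm (inj_eq lift_inj).
- by rewrite -[lift _ _ == _]/false raddf0.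
- by rewrite -[ord0 == _]/false raddf0.
Qed.

Lemma creC n (i j : 'I_n) : cre i * cre j = - (cre j * cre i).
Proof. by rewrite /cre -!mulmxE -!trmx_mul mulmxE annC raddfN. Qed.

Lemma vacK n : (vac n)^T *m vac n = 1%:M.
Proof.
elim: n => [|m IHm]; first by rewrite /= trmx1 mulmx1.
by rewrite tr_fock_colM IHm !mx0E.
Qed.

Lemma ann_vac n (i : 'I_n) : ann i *m vac n = 0.
Proof.
elim: n i => [|m IHm] i; first by case: i.
case: (unliftP ord0 i) => [i' ->|->];
  rewrite ?ann_ord0 ?ann_lift fock_blockMcol ?IHm !mx0E; exact: fock_col0.
Qed.

Lemma cre_top n (i : 'I_n) : cre i *m top n = 0.
Proof.
elim: n i => [|m IHm] i; first by case: i.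
case: (unliftP ord0 i) => [i' ->|->];
  rewrite ?cre_ord0 ?cre_lift fock_blockMcol ?mx0E ?IHm ?mx0E; exact: fock_col0.
Qed.

Lemma ker_ann n (y : 'cV[R]_((fock_dim n).+1)) :
  (forall i, ann i *m y = 0) -> exists a, y = a *: vac n.
Proof.
elim: n y => [|m IHm] y ky.
  by exists (y 0 0); apply/matrixP=> i j; rewrite !ord1 !mxE /= mulr1.
have [u [v yE]] := fock_colP y; rewrite {}yE in ky *.
have := ky ord0; rewrite ann_ord0 fock_blockMcol !mx0E => /fock_col_eq0[v0 _].
rewrite {}v0 in ky *; have [a ->] : exists a, u = a *: vac m.
  apply: IHm => j; have := ky (lift ord0 j); rewrite ann_lift fock_blockMcol.
  by rewrite !mx0E => /fock_col_eq0[].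
by exists a; rewrite [vac _]/= fock_colZ scaler0.
Qed.

Lemma ker_cre n (y : 'cV[R]_((fock_dim n).+1)) :
  (forall i, cre i *m y = 0) -> exists a, y = a *: top n.
Proof.
elim: n y => [|m IHm] y ky.
  by exists (y 0 0); apply/matrixP=> i j; rewrite !ord1 !mxE /= mulr1.
have [u [v yE]] := fock_colP y; rewrite {}yE in ky *.
have := ky ord0; rewrite cre_ord0 fock_blockMcol !mx0E => /fock_col_eq0[_ u0].
rewrite {}u0 in ky *; have [a ->] : exists a, v = a *: top m.
  apply: IHm => j; have := ky (lift ord0 j); rewrite cre_lift fock_blockMcol.
  by rewrite !mx0E => /fock_col_eq0[_ /eqP]; rewrite oppr_eq0 => /eqP.
by exists a; rewrite [top _]/= fock_colZ scaler0.
Qed.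

Lemma swap_signK n : swap_sign n * swap_sign n = 1.
Proof. by rewrite -expr2 sqrr_sign. Qed.

Lemma swap_signS n : swap_sign n.+1 = - swap_sign n.
Proof. by rewrite /swap_sign exprS mulN1r. Qed.

Lemma hodge_cre n (i : 'I_n) :
  hodge n * cre i = swap_sign n *: (ann i * hodge n).
Proof.
rewrite -!mulmxE; elim: n i => [|m IHm] i; first by case: i.
case: (unliftP ord0 i) => [j ->|->]; rewrite ?cre_ord0 ?cre_lift ?ann_ord0 ?ann_lift
  [hodge _]/= !fock_blockM fock_blockZ ?mx0E ?scalerA ?swap_signK ?scale1r //.
by rewrite -scalemxAl -scalemxAr scalerN scalerA swap_signK IHm swap_signS
  scalerA mulNr swap_signK !(scaleNr, scale1r).
Qed.

Lemma hodge_ann n (i : 'I_n) :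
  hodge n * ann i = swap_sign n *: (cre i * hodge n).
Proof.
rewrite -!mulmxE; elim: n i => [|m IHm] i; first by case: i.
case: (unliftP ord0 i) => [j ->|->]; rewrite ?cre_ord0 ?cre_lift ?ann_ord0 ?ann_lift
  [hodge _]/= !fock_blockM fock_blockZ ?mx0E ?scalerA ?swap_signK ?scale1r //.
by rewrite -scalemxAl -scalemxAr scalerN scalerA swap_signK IHm swap_signS
  scalerA mulNr swap_signK !(scaleNr, scale1r).
Qed.

Lemma hodge_unit n : hodge n \is a GRing.unit.
Proof.
have [a a0 h2] : exists2 a : R, a != 0 & hodge n *m hodge n = a%:M.
  elim: n => [|m [a a0 h2]]; first by exists 1; rewrite ?oner_eq0 //= mulmx1.
  exists (swap_sign m.+1 * a); first by rewrite mulf_neq0 // signr_eq0.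
  rewrite [hodge _]/= fock_blockM !mx0E -scalemxAl -scalemxAr h2.
  by rewrite scale_scalar_mx -fock_block_scalar.
apply/unitrP; exists (a^-1 *: hodge n); rewrite -scalerAl -scalerAr -mulmxE h2.
by rewrite scale_scalar_mx mulVf.
Qed.

Lemma topK n : (top n)^T *m top n = 1%:M.
Proof.
elim: n => [|m IHm]; first by rewrite /= trmx1 mulmx1.
by rewrite tr_fock_colM IHm !mx0E.
Qed.

Lemma prod_cre_vac n : (\prod_(i < n) cre i) *m vac n = top n.
Proof.
elim: n => [|m IHm]; first by rewrite big_ord0 mul1mx.
have liftE (l : seq 'I_m) (u : 'cV[R]_((fock_dim m).+1)) :
    (\prod_(i <- l) cre (lift ord0 i)) *m fock_col u 0 =
    fock_col ((\prod_(i <- l) cre i) *m u) 0.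
  elim: l => [|i l IHl]; first by rewrite !big_nil !mul1mx.
  by rewrite !big_cons -!mulmxE -!mulmxA IHl cre_lift fock_blockMcol !mx0E.
rewrite big_ord_recl -mulmxE -mulmxA [vac _]/= liftE IHm cre_ord0.
by rewrite fock_blockMcol !mx0E.
Qed.

Lemma vac_hodge_top n : ((vac n)^T *m (hodge n *m top n)) 0 0 != 0.
Proof.
elim: n => [|m IHm]; first by rewrite /= trmx1 !mul1mx mxE oner_eq0.
by rewrite [top _]/= [hodge _]/= fock_blockMcol [vac _]/= tr_fock_colM !mx0E.
Qed.

End FockSpace.

Section TruncatedExponential.
Context (R : numFieldType) (A : algType R).
Implicit Types a b x : A.

Definition texp K x : A := \sum_(k < K.+1) (k`!%:R)^-1 *: x ^+ k.

Lemma comm_texp K a x : a * x = x * a -> a * texp K x = texp K x * a.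
Proof.
move=> ax; rewrite /texp mulr_sumr mulr_suml; apply: eq_bigr => k _.
by rewrite -scalerAr -scalerAl; congr (_ *: _); exact: commrX.
Qed.

Lemma texp_shift K a b x : a * x = x * a + b -> b * x = x * b ->
  x ^+ K * b = 0 -> a * texp K x = texp K x * (a + b).
Proof.
move=> ax bx xKb.
have aX k : a * x ^+ k.+1 = x ^+ k.+1 * a + k.+1%:R *: (x ^+ k * b).
  elim: k => [|k IHk]; first by rewrite !expr1 expr0 mul1r scale1r.
  rewrite exprSr mulrA IHk mulrDl -mulrA ax mulrDr mulrA -addrA; congr (_ + _).
  rewrite -scalerAl -mulrA bx mulrA -exprSr [k.+2%:R]mulrS scalerDl scale1r.
  by rewrite addrC.
have -> : texp K x * (a + b) = texp K x * a +
    \sum_(k < K) (k`!%:R)^-1 *: (x ^+ k * b).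
  rewrite mulrDr; congr (_ + _); rewrite /texp mulr_suml big_ord_recr /=.
  rewrite -scalerAl xKb scaler0 addr0.
  by apply: eq_bigr => k _; rewrite -scalerAl.
rewrite /texp mulr_sumr mulr_suml !big_ord_recl /= -addrA; congr (_ + _).
  by rewrite expr0 -scalerAr mulr1 -scalerAl mul1r.
rewrite -big_split /=; apply: eq_bigr => k _.
rewrite /bump leq0n add1n -scalerAr aX scalerDr -scalerAl scalerA; congr (_ + _ *: _).
by rewrite factS natrM invfM mulrAC mulVf ?mul1r // pnatr_eq0.
Qed.

End TruncatedExponential.

HB.lock Definition iota (R : numFieldType) (n : nat) (u : 'rV[R]_n) :
  'M[R]_((fock_dim n).+1) := \sum_i u 0 i *: ann R i.

HB.lock Definition eps (R : numFieldType) (n : nat) (u : 'rV[R]_n) :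
  'M[R]_((fock_dim n).+1) := \sum_i u 0 i *: cre R i.

Section FockOperators.
Context (R : numFieldType) (n : nat).
Notation fock_mx := 'M[R]_((fock_dim n).+1).
Notation vac := (vac R n).
Notation ann := (@ann R n).
Notation cre := (@cre R n).
Notation hodge := (hodge R n).

Notation iota := (@iota R n).
Notation eps := (@eps R n).

Lemma iotaE u : iota u = \sum_i u 0 i *: ann i.
Proof. by rewrite iota.unlock. Qed.

Lemma epsE u : eps u = \sum_i u 0 i *: cre i.
Proof. by rewrite eps.unlock. Qed.

Lemma iota_is_linear : linear iota.
Proof.
move=> a u v; rewrite !iotaE scaler_sumr -big_split; apply: eq_bigr => i _.
by rewrite !mxE scalerDl scalerA.
Qed.
HB.instance Definition _ := GRing.isLinear.Build R 'rV[R]_n fock_mx _ iota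
  iota_is_linear.

Lemma eps_is_linear : linear eps.
Proof.
move=> a u v; rewrite !epsE scaler_sumr -big_split; apply: eq_bigr => i _.
by rewrite !mxE scalerDl scalerA.
Qed.
HB.instance Definition _ := GRing.isLinear.Build R 'rV[R]_n fock_mx _ eps
  eps_is_linear.

Lemma tr_iota u : (iota u)^T = eps u.
Proof. by rewrite !(iotaE, epsE) linear_sum; apply: eq_bigr => i _; rewrite linearZ. Qed.

Lemma tr_eps u : (eps u)^T = iota u.
Proof. by rewrite -tr_iota trmxK. Qed.

Lemma trM (x y : fock_mx) : (x * y)^T = y^T * x^T.
Proof. exact: trmx_mul. Qed.

Lemma iota_delta i : iota (delta_mx 0 i) = ann i.
Proof.
rewrite !iotaE (bigD1 i) //= mxE !eqxx scale1r big1 ?addr0 // => j ji.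
by rewrite mxE (negPf ji) andbF scale0r.
Qed.

Lemma eps_delta i : eps (delta_mx 0 i) = cre i.
Proof. by rewrite -tr_iota iota_delta. Qed.

Lemma iotaC u v : iota u * iota v = - (iota v * iota u).
Proof.
rewrite !iotaE !big_distrlr exchange_big -sumrN; apply: eq_bigr => i _.
rewrite -sumrN; apply: eq_bigr => j _ /=.
by rewrite -!scalerAl -!scalerAr annC !scalerN !scalerA mulrC.
Qed.

Lemma iota_eps u a :
  iota u * eps a = ((u *m a^T) 0 0)%:A - eps a * iota u.
Proof.
rewrite iotaE epsE mxE scaler_suml !mulr_suml -sumrB.
transitivity (\sum_i \sum_j (u 0 i * a 0 j) *: (ann i * cre j)).
  apply: eq_bigr => i _; rewrite mulr_sumr; apply: eq_bigr => j _.
  by rewrite -scalerAl -scalerAr scalerA.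
transitivity (\sum_i ((u 0 i * a 0 i)%:A -
    \sum_j (u 0 i * a 0 j) *: (cre j * ann i)) : fock_mx).
  apply: eq_bigr => i _; under eq_bigr do rewrite ann_cre scalerBr.
  rewrite sumrB; congr (_ - _); rewrite (bigD1 i) //= eqxx big1 ?addr0 // => j.
  by rewrite eq_sym => /negPf->; rewrite scaler0.
rewrite !sumrB; congr (_ - _); first by apply: eq_bigr => i _; rewrite mxE.
rewrite exchange_big; apply: eq_bigr => i _; rewrite mulr_sumr.
by apply: eq_bigr => j _; rewrite -scalerAl -scalerAr scalerA mulrC.
Qed.

Lemma eps_iota a u :
  eps a * iota u = ((u *m a^T) 0 0)%:A - iota u * eps a.
Proof. by rewrite iota_eps opprB addrC subrK. Qed.

Lemma iota_vac u : iota u *m vac = 0.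
Proof.
rewrite !iotaE mulmx_suml big1 // => i _.
by rewrite -scalemxAl ann_vac scaler0.
Qed.

Lemma vac_eps u : vac^T *m eps u = 0.
Proof. by rewrite -tr_iota -trmx_mul iota_vac trmx0. Qed.

Lemma hodge_eps u : hodge * eps u = swap_sign R n *: (iota u * hodge).
Proof.
rewrite !(iotaE, epsE) mulr_sumr mulr_suml scaler_sumr; apply: eq_bigr => i _.
by rewrite -scalerAr hodge_cre -scalerAl !scalerA mulrC.
Qed.

Lemma hodge_iota u : hodge * iota u = swap_sign R n *: (eps u * hodge).
Proof.
rewrite !(iotaE, epsE) mulr_sumr mulr_suml scaler_sumr; apply: eq_bigr => i _.
by rewrite -scalerAr hodge_ann -scalerAl !scalerA mulrC.
Qed.

Definition word (l : seq 'I_n) : fock_mx := \prod_(i <- l) ann i.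

Lemma word1 i : word [:: i] = ann i.
Proof. exact: big_seq1. Qed.

Lemma word_cons i l : word (i :: l) = ann i * word l.
Proof. exact: big_cons. Qed.

Lemma ann_word i l : ann i * word l = (-1) ^+ size l *: (word l * ann i).
Proof.
elim: l => [|j l IHl] /=; first by rewrite /word big_nil mulr1 mul1r scale1r.
rewrite word_cons mulrA annC mulNr -(mulrA (ann j) (ann i)) IHl exprS -scalerAr -scalerA.
by rewrite scaleN1r mulrA.
Qed.

Lemma ann_sqr0 i : ann i * ann i = 0.
Proof.
apply/eqP; have/eqP := annC R i i; rewrite -subr_eq0 opprK -mulr2n.
by rewrite -scaler_nat scaler_eq0 pnatr_eq0.
Qed.

Lemma word0 l : (n < size l)%N -> word l = 0.
Proof.
move=> nl; have : ~~ uniq l.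
  apply: contraL nl => /card_uniqP <-; rewrite -leqNgt -[X in (_ <= X)%N]card_ord.
  exact: max_card.
elim: l {nl} => //= i l IHl; rewrite negb_and negbK => /orP[il|/IHl l0].
  case/splitPr: il => p q; rewrite word_cons /word big_cat big_cons /=.
  rewrite -/(word _) mulrA mulrA ann_word -!scalerAl -(mulrA (word p)) ann_sqr0.
  by rewrite mulr0 mul0r scaler0.
by rewrite word_cons l0 mulr0.
Qed.

Lemma fock_eq0 p (Y : 'M[R]_(_, p)) :
  (forall l, vac^T *m (word l *m Y) = 0) -> Y = 0.
Proof.
move=> vacY; suff wordY k l : (n < size l + k)%N -> word l *m Y = 0.
  by rewrite -(wordY n.+1 [::]) // /word big_nil mul1mx.
elim: k l => [|k IHk] l lk; first by rewrite word0 ?mul0mx // -[size l]addn0.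
apply/matrixP => i j; rewrite [RHS]mxE.
have [a aE] : exists a, word l *m col j Y = a *: vac.
  apply: ker_ann => h; rewrite mulmxA -[_ *m word l]word_cons colE mulmxA IHk ?mul0mx //.
  by rewrite addSnnS.
have a0 : a = 0.
  have /(congr1 (col j)) := vacY l; rewrite colE -!mulmxA -colE aE -scalemxAr vacK.
  by rewrite col0 => /matrixP/(_ 0 0); rewrite !mxE mulr1.
transitivity ((word l *m col j Y) i 0); last by rewrite aE a0 scale0r mxE.
rewrite colE mulmxA -colE [RHS]mxE; congr (_ _ _).
Qed.

Lemma fock_schur X : (forall i, X * ann i = ann i * X) ->
  (forall i, X * cre i = cre i * X) -> exists a, X = a%:M.
Proof.
move=> Xann Xcre; have [a aE] : exists a, X *m vac = a *: vac.
  by apply: ker_ann => i; rewrite mulmxA mulmxE -Xann -mulmxE -mulmxA ann_vac mulmx0.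
exists a; apply/eqP; rewrite -subr_eq0; apply/eqP/trmx_inj; rewrite trmx0.
apply: fock_eq0 => l; set Y := (_ - _)^T.
have annY i : ann i * Y = Y * ann i.
  rewrite -[ann i]trmxK -/(cre i) -!trM mulrBr mulrBl Xcre; congr (_ - _)^T.
  by rewrite -!mulmxE scalar_mxC.
have -> : word l *m Y = Y *m word l.
  rewrite !mulmxE; elim: l => [|i l IHl]; first by rewrite /word big_nil mulr1 mul1r.
  by rewrite word_cons -mulrA IHl mulrA annY mulrA.
rewrite mulmxA -trmx_mul mulmxBl aE mul_scalar_mx subrr trmx0 mul0mx //.
Qed.

End FockOperators.

(** * Gaussian operators *)

Section GaussianOperators.
Context (R : numFieldType) (n : nat).
Notation fock_mx := 'M[R]_((fock_dim n).+1).
Notation vac := (vac R n).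
Notation top := (top R n).
Notation ann := (@ann R n).
Notation cre := (@cre R n).
Notation hodge := (hodge R n).
Notation iota := (@iota R n).
Notation eps := (@eps R n).
Notation word := (@word R n).

Lemma eps_ann a i : eps a * ann i = (a 0 i)%:A - ann i * eps a.
Proof.
rewrite -iota_delta eps_iota; congr (_%:A - _).
by rewrite -rowE !mxE.
Qed.

Lemma iota_cre u i : iota u * cre i = (u 0 i)%:A - cre i * iota u.
Proof.
rewrite -eps_delta iota_eps; congr (_%:A - _).
by rewrite -[u *m _]trmxK trmx_mul trmxK -rowE !mxE.
Qed.

Lemma iota_ann u i : iota u * ann i = - (ann i * iota u).
Proof. by rewrite -iota_delta iotaC. Qed.

Lemma iota_mulmx u (M : 'M[R]_n) :
  iota (u *m M) = \sum_i \sum_j (u 0 i * M i j) *: ann j.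
Proof.
rewrite iotaE exchange_big; apply: eq_bigr => j _.
by rewrite mxE scaler_suml.
Qed.

Definition qann (P : 'M[R]_n) : fock_mx :=
  \sum_i \sum_j P i j *: (ann i * ann j).

Lemma iota_qann u P : iota u * qann P = qann P * iota u.
Proof.
rewrite /qann mulr_sumr mulr_suml; apply: eq_bigr => i _.
rewrite mulr_sumr mulr_suml; apply: eq_bigr => j _.
rewrite -scalerAr -scalerAl; congr (_ *: _).
by rewrite mulrA iota_ann mulNr -mulrA iota_ann mulrN opprK mulrA.
Qed.

Lemma eps_qann a P :
  eps a * qann P = qann P * eps a + iota (a *m (P - P^T)).
Proof.
rewrite mulmxBr raddfB /= !iota_mulmx.
rewrite [X in _ - X]exchange_big /=.
rewrite -sumrB /qann mulr_sumr mulr_suml -big_split; apply: eq_bigr => i _ /=.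
rewrite -sumrB mulr_sumr mulr_suml -big_split; apply: eq_bigr => j _ /=.
rewrite -scalerAr -scalerAl mulrA eps_ann mulrBl -mulrA eps_ann mulrBr mulrA.
rewrite mulr_algl mulr_algr opprB addrCA scalerDr scalerBr !scalerA mxE.
by rewrite ![a 0 _ * _]mulrC.
Qed.

Lemma qannX_word P k l : (n < k + size l)%N -> qann P ^+ k * word l = 0.
Proof.
elim: k l => [|k IHk] l kl; first by rewrite word0 ?mulr0.
rewrite exprSr -mulrA /qann mulr_suml mulr_sumr big1 // => i _.
rewrite mulr_suml mulr_sumr big1 // => j _.
rewrite -scalerAl -scalerAr -mulrA -!word_cons IHk ?scaler0 //=.
by rewrite !addnS ltnW // ltnS -addSn.
Qed.

Lemma qannX_iota P u : qann P ^+ n * iota u = 0.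
Proof.
rewrite iotaE mulr_sumr big1 // => i _.
have := @qannX_word P n [:: i]; rewrite addn1 word1 -scalerAr => -> //.
by rewrite scaler0.
Qed.

Definition eann (P : 'M[R]_n) : fock_mx := texp n (qann P).

Lemma iota_eann u P : iota u * eann P = eann P * iota u.
Proof. by apply: comm_texp; exact: iota_qann. Qed.

Lemma eps_eann a P :
  eps a * eann P = eann P * (eps a + iota (a *m (P - P^T))).
Proof.
apply: texp_shift; [exact: eps_qann | exact: iota_qann | exact: qannX_iota].
Qed.

Lemma eann_eps a P :
  eann P * eps a = (eps a - iota (a *m (P - P^T))) * eann P.
Proof. by rewrite mulrBl eps_eann iota_eann mulrDr addrK. Qed.

Lemma qann_vac P : qann P *m vac = 0.
Proof.
rewrite mulmx_suml big1 // => i _; rewrite mulmx_suml big1 // => j _.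
by rewrite -scalemxAl -mulmxE -mulmxA ann_vac mulmx0 scaler0.
Qed.

Lemma eann_vac P : eann P *m vac = vac.
Proof.
rewrite /eann /texp big_ord_recl expr0 fact0 invr1 scale1r mulmxDl.
rewrite mulmx_suml big1 ?addr0 ?mul1mx // => i _.
by rewrite -scalemxAl exprSr -mulmxE -mulmxA qann_vac mulmx0 scaler0.
Qed.

Definition ecre (W : 'M[R]_n) : fock_mx := (eann W^T)^T.

Lemma eps_ecre a W : eps a * ecre W = ecre W * eps a.
Proof. by rewrite -tr_iota -!trM iota_eann. Qed.

Lemma iota_ecre u W :
  iota u * ecre W = ecre W * (iota u + eps (u *m (W - W^T))).
Proof.
rewrite -tr_eps -trM eann_eps trM !linearB /= tr_iota trmxK.
by rewrite opprK addrC [- _ + _]addrC addrC tr_iota.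
Qed.

Lemma ecre_iota u W :
  ecre W * iota u = (iota u - eps (u *m (W - W^T))) * ecre W.
Proof. by rewrite mulrBl iota_ecre eps_ecre mulrDr addrK. Qed.

Lemma vac_ecre W : vac^T *m ecre W = vac^T.
Proof. by rewrite -trmx_mul eann_vac. Qed.

Fixpoint normal_power (W : 'M[R]_n) (k : nat) : fock_mx :=
  if k is k'.+1 then
    \sum_i \sum_j W i j *: (cre i * normal_power W k' * ann j)
  else 1.

Lemma iota_normal_power u W k : iota u * normal_power W k =
  k%:R *: (normal_power W k.-1 * iota (u *m W)) + normal_power W k * iota u.
Proof.
elim: k => [|k IHk]; first by rewrite scale0r add0r mulr1 mul1r.
have -> : k.+1%:R *: (normal_power W k * iota (u *m W)) =
    normal_power W k * iota (u *m W) + k%:R *: ((\sum_i \sum_j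
      W i j *: (cre i * normal_power W k.-1 * ann j)) * iota (u *m W)).
  rewrite mulrS scalerDl scale1r; congr (_ + _).
  by case: k {IHk} => [|k] //=; rewrite !scale0r.
rewrite -addrA [X in _ * X + _]iota_mulmx.
move: (iota u) (iota_cre u) (iota_ann u) (iota (u *m W)) (iota_ann (u *m W)) IHk.
move=> x xcre xann y yann IHk; rewrite /= !mulr_sumr !mulr_suml scaler_sumr.
rewrite -!big_split; apply: eq_bigr => i _ /=.
rewrite !mulr_sumr !mulr_suml scaler_sumr -!big_split; apply: eq_bigr => j _ /=.
rewrite -!scalerAr -!scalerAl mulrA mulrA xcre mulrBl mulrBl scalerBr.
rewrite mulr_algl -scalerAl scalerA mulrC; congr (_ + _).
rewrite -(mulrA (cre i) x) IHk mulrDr mulrDl -scalerAr -scalerAl !mulrA.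
rewrite -(mulrA _ y) yann -(mulrA _ x) xann !mulrN !mulrA.
by rewrite scalerN -opprD scalerN opprK scalerDr !scalerA mulrC.
Qed.

Lemma tr_normal_power W k : (normal_power W k)^T = normal_power W^T k.
Proof.
elim: k => [|k IHk] /=; first exact: trmx1.
rewrite exchange_big linear_sum; apply: eq_bigr => i _ /=.
rewrite linear_sum; apply: eq_bigr => j _ /=.
by rewrite linearZ /= !trM IHk tr_cre mulrA mxE.
Qed.

Lemma normal_power_word W k l :
  (n < k + size l)%N -> normal_power W k * word l = 0.
Proof.
elim: k l => [|k IHk] l kl; first by rewrite word0 ?mulr0.
rewrite /= mulr_suml big1 // => i _.
rewrite mulr_suml big1 // => j _.
by rewrite -scalerAl -(mulrA _ (ann j)) -word_cons -mulrA IHk ?mulr0 ?scaler0 //= addnS.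
Qed.

(* The normally ordered exponential of [\sum_ij (M - 1)_ij cre_i ann_j]; on forms
   it acts as the pullback by M. *)
Definition pull (M : 'M[R]_n) : fock_mx :=
  \sum_(k < n.+1) (k`!%:R)^-1 *: normal_power (M - 1%:M) k.

Lemma iota_pull u M : iota u * pull M = pull M * iota (u *m M).
Proof.
set W := M - 1%:M; have uM : u *m M = u *m W + u by rewrite mulmxBr mulmx1 subrK.
have top0 : normal_power W n * iota (u *m W) = 0.
  rewrite iotaE mulr_sumr big1 // => i _.
  have := @normal_power_word W n [:: i]; rewrite addn1 word1 -scalerAr => -> //.
  by rewrite scaler0.
rewrite uM raddfD mulrDr /= /pull -/W mulr_sumr.
rewrite [in RHS]mulr_suml [in X in X + _]big_ord_recr /= -scalerAl top0 scaler0 addr0.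
rewrite [in X in _ + X]mulr_suml.
under eq_bigr do rewrite -scalerAr iota_normal_power scalerDr.
rewrite big_split /=; congr (_ + _).
  rewrite big_ord_recl /= scale0r scaler0 add0r; apply: eq_bigr => k _.
  rewrite /bump leq0n add1n /= scalerA -scalerAl; congr (_ *: _).
  by rewrite factS natrM invfM mulrAC mulVf ?mul1r // pnatr_eq0.
by apply: eq_bigr => k _; rewrite scalerAl.
Qed.

Lemma tr_pull M : (pull M)^T = pull M^T.
Proof.
rewrite /pull linear_sum; apply: eq_bigr => k _.
by rewrite linearZ /= tr_normal_power linearB /= trmx1.
Qed.

Lemma pull_eps M u : pull M * eps u = eps (u *m M^T) * pull M.
Proof.
by rewrite -[LHS]trmxK trM tr_pull tr_eps iota_pull trM tr_pull trmxK tr_iota.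
Qed.

Lemma pull_vac M : pull M *m vac = vac.
Proof.
rewrite /pull big_ord_recl fact0 invr1 scale1r mulmxDl mul1mx.
rewrite mulmx_suml big1 ?addr0 // => k _; rewrite -scalemxAl /=.
rewrite mulmx_suml big1 ?scaler0 // => i _; rewrite mulmx_suml big1 // => j _.
by rewrite -scalemxAl -mulmxE -mulmxA ann_vac mulmx0 scaler0.
Qed.

Lemma tr_qann P : (qann P)^T * hodge = - (hodge * qann P).
Proof.
rewrite /qann linear_sum mulr_suml mulr_sumr -sumrN; apply: eq_bigr => i _ /=.
rewrite linear_sum mulr_suml mulr_sumr -sumrN; apply: eq_bigr => j _ /=.
rewrite linearZ /= trM -/(cre _) -/(cre _) -scalerAl -scalerAr -scalerN.
congr (_ *: _); rewrite annC mulrN opprK mulrA hodge_ann -scalerAl -(mulrA (cre j) hodge) hodge_ann.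
by rewrite -scalerAr scalerA swap_signK scale1r mulrA.
Qed.

Lemma qannN P : qann (- P) = - qann P.
Proof.
rewrite /qann -sumrN; apply: eq_bigr => i _; rewrite -sumrN; apply: eq_bigr => j _.
by rewrite mxE scaleNr.
Qed.

Lemma iota_eps_schur X : (forall u, X * iota u = iota u * X) ->
  (forall u, X * eps u = eps u * X) -> exists a, X = a%:M.
Proof.
move=> Xiota Xeps; apply: fock_schur => i; first by rewrite -iota_delta.
by rewrite -eps_delta.
Qed.

Lemma vac_neq0 : vac != 0.
Proof.
apply/eqP => v0; have := vacK R n; rewrite v0 mulmx0 => /matrixP/(_ 0 0).
by rewrite !mxE => /eqP; rewrite eq_sym oner_eq0.
Qed.

Lemma eannK P : eann (- P) * eann P = 1.
Proof.
have [a aE] : exists a, eann (- P) * eann P = a%:M.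
  apply: iota_eps_schur => u; first by rewrite -mulrA -iota_eann mulrA -iota_eann mulrA.
  have bN : u *m (- P - (- P)^T) = - (u *m (P - P^T)).
    by rewrite linearN -mulmxN opprB addrC opprK.
  rewrite -mulrA eann_eps mulrA mulrBr eann_eps bN raddfN opprK -iota_eann.
  by rewrite -mulrBl addrK mulrA.
have : (eann (- P) * eann P) *m vac = vac by rewrite -mulmxE -mulmxA !eann_vac.
rewrite aE mul_scalar_mx => /eqP; rewrite -subr_eq0 -[X in _ - X]scale1r -scalerBl.
by rewrite scaler_eq0 (negPf vac_neq0) orbF subr_eq0 => /eqP->.
Qed.

Lemma tr_eann_hodge P : (eann P)^T * hodge * eann P = hodge.
Proof.
suff -> : (eann P)^T * hodge = hodge * eann (- P) by rewrite -mulrA eannK mulr1.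
rewrite /eann /texp linear_sum mulr_suml mulr_sumr; apply: eq_bigr => k _ /=.
rewrite linearZ /= -scalerAl -scalerAr; congr (_ *: _); rewrite qannN.
elim: (nat_of_ord k) => [|m IHm]; first by rewrite !expr0 trmx1 mulr1 mul1r.
rewrite exprS trM -mulrA tr_qann -mulrN mulrA IHm -mulrA -exprSr //.
Qed.

Lemma qann_hodge P : qann P * hodge = - (hodge * (qann P)^T).
Proof.
rewrite /qann linear_sum mulr_suml mulr_sumr -sumrN; apply: eq_bigr => i _ /=.
rewrite linear_sum mulr_suml mulr_sumr -sumrN; apply: eq_bigr => j _ /=.
rewrite linearZ /= trM -/(cre _) -/(cre _) -scalerAl -scalerAr -scalerN.
congr (_ *: _); rewrite creC mulrN opprK mulrA hodge_cre -scalerAl.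
by rewrite -(mulrA (ann i) hodge) hodge_cre -scalerAr scalerA swap_signK scale1r mulrA.
Qed.

Lemma tr_ecre_hodge W : (ecre W)^T * hodge * ecre W = hodge.
Proof.
suff -> : (ecre W)^T * hodge = hodge * ecre (- W).
  rewrite /ecre -mulrA -trM !linearN /= -[X in eann X * _]opprK eannK.
  by rewrite trmx1 mulr1.
rewrite /ecre trmxK linearN /= /eann /texp linear_sum mulr_suml mulr_sumr.
apply: eq_bigr => k _ /=; rewrite linearZ /= -scalerAl -scalerAr; congr (_ *: _).
rewrite qannN; elim: (nat_of_ord k) => [|m IHm].
  by rewrite !expr0 trmx1 mulr1 mul1r.
rewrite exprSr -mulrA qann_hodge -mulrN mulrA IHm -mulrA exprS trM.
by rewrite [in RHS]linearN.
Qed.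

Lemma pull_top M : M \in unitmx -> exists d, pull M *m top = d *: top.
Proof.
move=> Mu; apply: ker_cre => i; rewrite -eps_delta.
rewrite -[delta_mx 0 i](mulmxKV (_ : M^T \in unitmx)) ?unitmx_tr //.
rewrite mulmxA mulmxE -pull_eps -mulmxE -mulmxA.
suff -> : eps (delta_mx 0 i *m invmx M^T) *m top = 0 by rewrite mulmx0.
by rewrite epsE mulmx_suml big1 // => j _; rewrite -scalemxAl cre_top scaler0.
Qed.

Lemma tr_pull_hodge M d : M \in unitmx -> pull M *m top = d *: top ->
  (pull M)^T * hodge * pull M = d *: hodge.
Proof.
move=> Mu topE; have hu := hodge_unit R n.
pose s := swap_sign R n; have s2 : s * s = 1 := swap_signK R n.
have hVi u : hodge^-1 * iota u = s *: (eps u * hodge^-1).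
  apply: (mulrI hu); apply: (mulIr hu); rewrite (mulVKr hu) -scalerAr -scalerAl.
  by rewrite mulrA (mulrVK hu) hodge_eps scalerA s2 scale1r.
have hVe u : hodge^-1 * eps u = s *: (iota u * hodge^-1).
  apply: (mulrI hu); apply: (mulIr hu); rewrite (mulVKr hu) -scalerAr -scalerAl.
  by rewrite mulrA (mulrVK hu) hodge_iota scalerA s2 scale1r.
set X := _ * pull M; have [a aE] : exists a, hodge^-1 * X = a%:M.
  apply: iota_eps_schur => u.
    rewrite -[u](mulmxKV Mu) /X !mulrA -(mulrA _ (pull M) (iota _)) -iota_pull !mulrA.
    rewrite -(mulrA _ hodge (iota _)) hodge_iota -scalerAr !mulrA -scalerAl.
    rewrite -(mulrA _ (pull M)^T (eps _)) tr_pull pull_eps trmxK !mulrA hVe.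
    by rewrite -!scalerAl scalerA s2 scale1r.
  rewrite /X !mulrA -(mulrA _ (pull M) (eps _)) pull_eps !mulrA.
  rewrite -(mulrA _ hodge (eps _)) hodge_eps -scalerAr !mulrA -scalerAl.
  rewrite -(mulrA _ (pull M)^T (iota _)) tr_pull -iota_pull !mulrA hVi.
  by rewrite -!scalerAl scalerA s2 scale1r.
have {aE}XE : X = a *: hodge.
  by rewrite -[X](mulVKr hu) aE -mulmxE mul_mx_scalar.
rewrite XE; congr (_ *: _).
have : (vac^T *m (X *m top)) 0 0 = d * (vac^T *m (hodge *m top)) 0 0.
  rewrite /X -mulmxE -!mulmxA topE !mulmxA -trmx_mul pull_vac -!scalemxAr.
  by rewrite mxE.
rewrite XE -scalemxAl -scalemxAr mxE => /mulIf -> //.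
exact: vac_hodge_top.
Qed.

End GaussianOperators.

(** * Alternating forms as vectors of the Fock space *)

Lemma row'_eqP (R : Type) m n (i : 'I_m) (A B : 'M[R]_(m, n)) :
  row' i A = row' i B <-> forall h, h != i -> row h A = row h B.
Proof.
split=> [AB h|AB].
  case: (unliftP i h) => [h' -> _|->]; last by rewrite eqxx.
  apply/rowP => j; have /matrixP/(_ h' j) := AB; rewrite !mxE //.
apply/matrixP => h j; have /rowP/(_ j) : row (lift i h) A = row (lift i h) B.
  by apply: AB; rewrite eq_sym neq_lift.
by rewrite !mxE.
Qed.

Lemma row0_col_mx (R : Type) k n (u : 'rV[R]_n) (A : 'M[R]_(k, n)) :
  row ord0 (col_mx u A : 'M[R]_(k.+1, n)) = u.
Proof.
apply/rowP => j; rewrite !mxE; case: splitP => [i _|i]; first by rewrite ord1.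
by [].
Qed.

Lemma row'0_col_mx (R : Type) k n (u : 'rV[R]_n) (A : 'M[R]_(k, n)) :
  row' ord0 (col_mx u A : 'M[R]_(k.+1, n)) = A.
Proof.
apply/matrixP => h j; rewrite !mxE; case: splitP => [i|i]; rewrite lift0.
  by rewrite ord1.
by rewrite add1n => -[/val_inj->].
Qed.

Section AlternatingForms.
Context (R : realType) (n : nat).
Implicit Type w : mixed_form R n.

Definition set_rows k (A : 'M[R]_(k, n)) (i j : 'I_k) (u v : 'rV[R]_n) :=
  \matrix_h (if h == i then u else if h == j then v else row h A).

Lemma alternating_swap w k (A : 'M[R]_(k, n)) (i j : 'I_k) :
  is_alternating_form w -> i != j -> w k (xrow i j A) = - w k A.
Proof.
move=> /(_ k)[wlin walt] ij; pose S := set_rows A i j.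
have ji : (j == i) = false by rewrite eq_sym (negPf ij).
have rS h u v : row h (S u v) = if h == i then u else if h == j then v else row h A.
  by rewrite rowK.
have linl u u' v : w k (S (u + u') v) = w k (S u v) + w k (S u' v).
  rewrite -[w k (S u v)]mul1r -[w k (S u' v)]mul1r; apply: (wlin _ _ _ i).
  - by rewrite !rS eqxx !scale1r.
  - by apply/row'_eqP => h /negPf hi; rewrite !rS hi.
  - by apply/row'_eqP => h /negPf hi; rewrite !rS hi.
have linr u v v' : w k (S u (v + v')) = w k (S u v) + w k (S u v').
  rewrite -[w k (S u v)]mul1r -[w k (S u v')]mul1r; apply: (wlin _ _ _ j).
  - by rewrite !rS eqxx ji !scale1r.
  - by apply/row'_eqP => h /negPf hj; rewrite !rS hj.
  - by apply/row'_eqP => h /negPf hj; rewrite !rS hj.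
have S0 u : w k (S u u) = 0.
  by apply: (walt _ i j) => //; rewrite !rS !eqxx ji.
have AE : A = S (row i A) (row j A).
  by apply/row_matrixP => h; rewrite rS; case: eqP => [->|_] //; case: eqP => [->|].
have xAE : xrow i j A = S (row j A) (row i A).
  apply/row_matrixP => h; rewrite rS; apply/rowP => l; rewrite !mxE.
  case: tpermP => [->|->|/eqP/negPf-> /eqP/negPf->].
  - by rewrite eqxx mxE.
  - by rewrite ji eqxx mxE.
  - by rewrite mxE.
have := S0 (row i A + row j A).
rewrite linl !linr !S0 add0r addr0 -xAE -AE addrC => /eqP.
by rewrite addr_eq0 => /eqP.
Qed.

Lemma alternating_perm w (s : 'S_n) :
  is_alternating_form w -> w n (perm_mx s) = (-1) ^+ s * w n 1%:M.
Proof.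
move=> walt; have [ts -> dts] := prod_tpermP s.
elim: ts dts => [_|t ts IHts] /=; first by rewrite big_nil perm_mx1 odd_perm1 mul1r.
case/andP => dt /IHts {}IHts; rewrite big_cons perm_mxM odd_permM odd_tperm dt.
by rewrite -xrowE alternating_swap // IHts signr_addb mulN1r mulNr.
Qed.

End AlternatingForms.

Section FockForms.
Context (R : realType) (n : nat).
Notation fock_vec := 'cV[R]_((fock_dim n).+1).
Notation vac := (vac R n).
Notation top := (top R n).
Notation iota := (@iota R n).
Notation eps := (@eps R n).

Fixpoint fock_eval (k : nat) (x : fock_vec) : 'M[R]_(k, n) -> R :=
  match k return 'M[R]_(k, n) -> R with
  | 0 => fun=> (vac^T *m x) 0 0
  | k'.+1 => fun A => fock_eval (iota (row ord0 A) *m x) (row' ord0 A)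
  end.

Definition fock_form (x : fock_vec) : mixed_form R n := fun k => fock_eval x.

Lemma fock_form0 x (A : 'M[R]_(0, n)) : fock_form x A = (vac^T *m x) 0 0.
Proof. by []. Qed.

Lemma fock_formS x k (A : 'M[R]_(k.+1, n)) :
  fock_form x A = fock_form (iota (row ord0 A) *m x) (row' ord0 A).
Proof. by []. Qed.

Lemma fock_form_lin a b x y k (A : 'M[R]_(k, n)) :
  fock_form (a *: x + b *: y) A = a * fock_form x A + b * fock_form y A.
Proof.
elim: k x y A => [|k IHk] x y A.
  by rewrite !fock_form0 linearD !linearZ !mxE.
by rewrite !fock_formS linearD !linearZ IHk.
Qed.

Lemma fock_formZ a x k (A : 'M[R]_(k, n)) : fock_form (a *: x) A = a * fock_form x A.
Proof. by have := fock_form_lin a 0 x 0 A; rewrite scale0r addr0 mul0r addr0. Qed.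

Lemma fock_form_eq0 k (A : 'M[R]_(k, n)) : fock_form 0 A = 0.
Proof. by have := fock_formZ 0 0 A; rewrite scale0r mul0r. Qed.

Lemma fock_formN x k (A : 'M[R]_(k, n)) : fock_form (- x) A = - fock_form x A.
Proof. by rewrite -scaleN1r fock_formZ mulN1r. Qed.

Lemma fock_form_iota_row x k (A : 'M[R]_(k, n)) j :
  fock_form (iota (row j A) *m x) A = 0.
Proof.
elim: k x A j => [|k IHk] x A j; first by case: j.
rewrite fock_formS mulmxA mulmxE; case: (unliftP ord0 j) => [j' ->|->].
  rewrite iotaC -mulmxE mulNmx fock_formN -mulmxA.
  suff -> : row (lift ord0 j') A = row j' (row' ord0 A) by rewrite IHk oppr0.
  by apply/rowP => l; rewrite !mxE.
suff -> : iota (row ord0 A) * iota (row ord0 A) = 0 by rewrite mul0mx fock_form_eq0.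
apply/eqP; have/eqP := iotaC (row ord0 A) (row ord0 A); rewrite -subr_eq0 opprK.
by rewrite -mulr2n -scaler_nat scaler_eq0 pnatr_eq0.
Qed.

Lemma fock_form_alternating x : is_alternating_form (fock_form x).
Proof.
move=> k; split.
  elim: k x => [|k IHk] x A B C i b c; first by case: i.
  case: (unliftP ord0 i) => [i' ->|->] rA BA CA.
    have r0 D : row' (lift ord0 i') D = row' (lift ord0 i') A -> row ord0 D = row ord0 A.
      by move=> /row'_eqP->.
    rewrite !fock_formS (r0 B) ?(r0 C) //; apply: (IHk _ _ _ _ i').
    - have rr D : row i' (row' ord0 D) = row (lift ord0 i') D :> 'rV[R]_n.
        by apply/rowP => l; rewrite !mxE.
      by rewrite !rr.
    - apply/row'_eqP => h hi; apply/rowP => l; move/row'_eqP: BA => /(_ (lift ord0 h)).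
      by rewrite (inj_eq lift_inj) => /(_ hi)/rowP/(_ l); rewrite !mxE.
    - apply/row'_eqP => h hi; apply/rowP => l; move/row'_eqP: CA => /(_ (lift ord0 h)).
      by rewrite (inj_eq lift_inj) => /(_ hi)/rowP/(_ l); rewrite !mxE.
  by rewrite !fock_formS rA BA CA linearD !linearZ mulmxDl -!scalemxAl fock_form_lin.
elim: k x => [|k IHk] x A i j; first by case: i.
have rr D h : row h (row' ord0 D) = row (lift ord0 h) D :> 'rV[R]_n.
  by apply/rowP => l; rewrite !mxE.
rewrite fock_formS.
case: (unliftP ord0 i) => [i' ->|->]; case: (unliftP ord0 j) => [j' ->|->].
- rewrite (inj_eq lift_inj) => ij rij; apply: (IHk _ _ i' j') => //.
  by rewrite !rr.
- by move=> _ <-; rewrite -rr fock_form_iota_row.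
- by move=> _ ->; rewrite -rr fock_form_iota_row.
- by rewrite eqxx.
Qed.

Lemma fock_form_pull M x k (A : 'M[R]_(k, n)) :
  fock_form (pull M *m x) A = fock_form x (A *m M).
Proof.
elim: k x A => [|k IHk] x A.
  rewrite !fock_form0 mulmxA -[pull M]trmxK -trmx_mul tr_pull pull_vac.
  by [].
rewrite !fock_formS mulmxA mulmxE iota_pull -mulmxE -mulmxA IHk row_mul.
by congr fock_form; apply/matrixP => i j; rewrite !mxE; apply: eq_bigr => h _; rewrite mxE.
Qed.

Lemma fock_form_inj x : (forall k (A : 'M[R]_(k, n)), fock_form x A = 0) -> x = 0.
Proof.
move=> x0; apply: fock_eq0 => l; elim/last_ind: l x x0 => [|l i IHl] x x0.
  rewrite /word big_nil mul1mx; apply/matrixP => a b; rewrite !ord1 [RHS]mxE.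
  exact: (x0 0 0).
rewrite /word big_rcons -/(word _ _) /= -mulmxE -mulmxA IHl // => k A.
have := x0 k.+1 (col_mx (delta_mx 0 i) A : 'M[R]_(1 + k, n)).
by rewrite fock_formS row0_col_mx row'0_col_mx iota_delta.
Qed.

Lemma fock_form_prod x k (A : 'M[R]_(k, n)) :
  fock_form x A = (x^T *m ((\prod_(i < k) eps (row i A)) *m vac)) 0 0.
Proof.
elim: k x A => [|k IHk] x A.
  by rewrite fock_form0 big_ord0 mul1mx -[x]trmxK -trmx_mul trmxK mxE.
rewrite fock_formS IHk big_ord_recl -mulmxE -!mulmxA trmx_mul tr_iota -mulmxA.
congr ((_ *m (_ *m (_ *m _))) 0 0); apply: eq_bigr => i _; congr eps.
by apply/rowP => l; rewrite !mxE.
Qed.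

Lemma fock_form_det x (A : 'M[R]_n) : fock_form x A = \det A * fock_form x 1%:M.
Proof.
have -> : fock_form x A = \sum_(f : {ffun 'I_n -> 'I_n})
    (\prod_i A i (f i)) * fock_form x (\matrix_i delta_mx 0 (f i)).
  rewrite fock_form_prod; under eq_bigr do rewrite epsE.
  rewrite bigA_distr_bigA mulmx_suml mulmx_sumr summxE; apply: eq_bigr => f _ /=.
  rewrite fock_form_prod.
  have -> : \prod_(i < n) eps (row i (\matrix_i delta_mx 0 (f i))) = \prod_i cre R (f i).
    by apply: eq_bigr => i _; rewrite rowK eps_delta.
  have -> : \prod_i (row i A 0 (f i) *: cre R (f i)) =
     (\prod_i A i (f i)) *: \prod_i cre R (f i).
    by rewrite scaler_prod; congr (_ *: _); apply: eq_bigr => i _; rewrite mxE.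
  by rewrite -scalemxAl -scalemxAr mxE.
rewrite (bigID (fun f : {ffun 'I_n -> 'I_n} => injectiveb f)) /= addrC big1 ?add0r; last first.
  move=> f /injectivePn[i [j ij fij]].
  by rewrite ((fock_form_alternating x n).2 _ i j) ?mulr0 // !rowK fij.
rewrite /determinant mulr_suml (reindex (fun s : 'S_n => pval s)) /=; last first.
  pose in_Sn := insubd (1%g : 'S_n).
  by exists in_Sn => /= f Uf; first apply: val_inj; apply: insubdK.
apply: eq_big => s; first by rewrite (valP s).
move=> _; have -> : \matrix_i delta_mx 0 (pval s i) = perm_mx s :> 'M[R]_n.
  by apply/matrixP => i j; rewrite !mxE -pvalE eq_sym.
rewrite alternating_perm; last exact: fock_form_alternating.
by rewrite mulrA [_ * (-1) ^+ _]mulrC; under eq_bigr do rewrite pvalE.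
Qed.

Lemma pull_top_det M : M \in unitmx -> pull M *m top = \det M *: top.
Proof.
move=> Mu; have [d dE] := pull_top Mu; rewrite dE; congr (_ *: _).
have top0 : fock_form top (1%:M : 'M[R]_n) != 0.
  rewrite fock_form_prod; under eq_bigr do rewrite row1 eps_delta.
  by rewrite prod_cre_vac topK mxE oner_eq0.
have := fock_form_det top M; rewrite -[M in LHS]mul1mx -fock_form_pull dE fock_formZ.
by move=> /mulIf->.
Qed.

End FockForms.

Section Shuffles.
Variable k : nat.
Implicit Types (b : bool) (S : {set 'I_k}).

Definition cons_set b S : {set 'I_k.+1} :=
  [set i | if unlift ord0 i is Some j then j \in S else b].

Lemma ord0_cons_set b S : (ord0 \in cons_set b S) = b.
Proof. by rewrite inE unlift_none. Qed.

Lemma lift_cons_set b S j : (lift ord0 j \in cons_set b S) = (j \in S).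
Proof. by rewrite inE liftK. Qed.

Lemma setC_cons_set b S : ~: cons_set b S = cons_set (~~ b) (~: S).
Proof. by apply/setP => i; rewrite !inE; case: unlift => // j; rewrite inE. Qed.

Lemma enum_cons_set b S : enum (cons_set b S) =
  (if b then [:: ord0] else [::]) ++ [seq lift ord0 i | i <- enum S].
Proof.
have enumE m (T : {set 'I_m}) : enum T = [seq i <- enum 'I_m | i \in T].
  by rewrite enumT.
rewrite !enumE enum_ordSl /= ord0_cons_set filter_map.
under [in LHS]eq_filter do rewrite /= lift_cons_set.
by case: b.
Qed.

Lemma card_cons_set b S : #|cons_set b S| = (b + #|S|)%N.
Proof. by rewrite !cardE enum_cons_set size_cat size_map; case: b. Qed.

Lemma big_cons_set (V : nmodType) (F : {set 'I_k.+1} -> V) :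
  \sum_(S : {set 'I_k.+1}) F S =
  \sum_(S : {set 'I_k}) F (cons_set true S) +
  \sum_(S : {set 'I_k}) F (cons_set false S).
Proof.
rewrite (reindex (fun p : bool * {set 'I_k} => cons_set p.1 p.2)) /=; last first.
  exists (fun T : {set 'I_k.+1} => (ord0 \in T, [set j | lift ord0 j \in T])).
    move=> [b S] _ /=; rewrite ord0_cons_set; congr pair.
    by apply/setP => j; rewrite inE lift_cons_set.
  move=> T _; apply/setP => i; case: (unliftP ord0 i) => [j ->|->] /=.
    by rewrite lift_cons_set inE.
  by rewrite ord0_cons_set.
by rewrite -(pair_bigA _ (fun b S => F (cons_set b S))) /= big_bool.
Qed.

Definition inversions m (S : {set 'I_m}) :=
  #|[pred ij : 'I_m * 'I_m | [&& ij.1 \in S, ij.2 \notin S & (ij.2 < ij.1)%N]]|.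

Lemma inversions_cons_set b S :
  inversions (cons_set b S) = (inversions S + ~~ b * #|S|)%N.
Proof.
have invE m (T : {set 'I_m}) :
    inversions T = (\sum_i \sum_j [&& i \in T, j \notin T & (j < i)%N])%N.
  rewrite /inversions pair_bigA /= -sum1_card big_mkcond /=; apply: eq_bigr => -[i j] _ /=.
  by rewrite unfold_in /=; case: ifP.
rewrite !invE big_ord_recl big1 ?add0n => [|j _]; last by rewrite ltn0 !andbF.
rewrite -sum1_card big_distrr [X in _ = (_ + X)%N]big_mkcond -big_split /=.
apply: eq_bigr => i _; rewrite /bump leq0n add1n.
rewrite big_ord_recl ord0_cons_set !lift_cons_set ltn0Sn andbT addnC.
congr addn; last by case: (i \in S) b => -[].
by apply: eq_bigr => j _; rewrite lift_cons_set lift0 ltnS.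
Qed.

End Shuffles.

Section WedgeProducts.
Context (R : realType) (n : nat).
Implicit Types (w : mixed_form R n) (u : 'rV[R]_n).

Definition contract u w : mixed_form R n := fun k A => w k.+1 (col_mx u A).

Definition form_grade w : mixed_form R n := fun k A => (-1) ^+ k * w k A.

Lemma col_mx_row0 k (A : 'M[R]_(k.+1, n)) :
  col_mx (row ord0 A) (row' ord0 A) = A :> 'M[R]_(k.+1, n).
Proof.
apply/matrixP => i j; rewrite !mxE; case: splitP => h hi; rewrite !mxE;
  congr (A _ _); apply/val_inj; rewrite /= ?hi ?ord1 //.
Qed.

Lemma form_cast w k1 k2 (X : 'M[R]_(k1, n)) (Y : 'M[R]_(k2, n)) (e : k1 = k2) :
  (forall i, row i X = row (cast_ord e i) Y) -> w k1 X = w k2 Y.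
Proof.
case: k2 / e Y => Y XY; congr (w _ _); apply/row_matrixP => i.
by rewrite XY cast_ord_id.
Qed.

Lemma form_wedgeE w1 w2 k (A : 'M[R]_(k, n)) : form_wedge w1 w2 A =
  \sum_(S : {set 'I_k}) (-1) ^+ inversions S *
    w1 #|S| (rowsub enum_val A) * w2 #|~: S| (rowsub enum_val A).
Proof. by []. Qed.

Lemma form_cons_false w k (A : 'M[R]_(k.+1, n)) S :
  w #|cons_set false S| (rowsub enum_val A) =
  w #|S| (rowsub enum_val (row' ord0 A)).
Proof.
apply: (@form_cast _ _ _ _ _ (card_cons_set false S)) => i; apply/rowP => l.
rewrite !mxE; congr (A _ _); have iS : (i < size (enum S))%N.
  by rewrite -cardE -[#|S|](card_cons_set false S).
have x0 : 'I_k by case: (enum S) iS => // x.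
by rewrite !(enum_val_nth x0, enum_val_nth ord0) enum_cons_set /= (nth_map x0).
Qed.

Lemma form_cons_true w k (A : 'M[R]_(k.+1, n)) S :
  w #|cons_set true S| (rowsub enum_val A) =
  contract (row ord0 A) w (rowsub enum_val (row' ord0 A) : 'M[R]_(#|S|, n)).
Proof.
apply: (@form_cast _ _ _ _ _ (card_cons_set true S)) => i; apply/rowP => l.
rewrite !mxE (enum_val_nth ord0) enum_cons_set /=.
case: splitP => [j ij|j ij]; rewrite !mxE.
  by move: ij; rewrite /= ord1 => ->.
have x0 : 'I_k := enum_val j.
by move: ij => /= ->; rewrite add1n /= (enum_val_nth x0) (nth_map x0) // -cardE.
Qed.

Lemma form_wedgeS w1 w2 k (A : 'M[R]_(k.+1, n)) : form_wedge w1 w2 A =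
  form_wedge (contract (row ord0 A) w1) w2 (row' ord0 A) +
  form_wedge (form_grade w1) (contract (row ord0 A) w2) (row' ord0 A).
Proof.
rewrite !form_wedgeE big_cons_set; congr (_ + _); apply: eq_bigr => S _.
  rewrite inversions_cons_set mul0n addn0 form_cons_true; congr (_ * _).
  by rewrite setC_cons_set form_cons_false.
rewrite inversions_cons_set mul1n exprD form_cons_false -!mulrA; congr (_ * _).
congr (_ * (_ * _)).
by rewrite setC_cons_set form_cons_true.
Qed.

Lemma form_wedge0 w1 w2 (A : 'M[R]_(0, n)) : form_wedge w1 w2 A = w1 0%N 0 * w2 0%N 0.
Proof.
rewrite form_wedgeE (big_pred1 finset.set0) => [|S]; last first.
  by apply/esym/eqP/setP => -[].
have inv0 : inversions (finset.set0 : {set 'I_0}) = 0%N.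
  by apply: eq_card0 => -[[]].
have c0 (S : {set 'I_0}) : #|S| = 0%N by apply: eq_card0 => -[].
rewrite inv0 mul1r; congr (_ * _);
  by apply: (@form_cast _ _ _ _ _ (c0 _)) => i; case: (cast_ord (c0 _) i).
Qed.

End WedgeProducts.

Section FockWedge.
Context (R : realType) (n : nat).
Implicit Types (w : mixed_form R n) (u a : 'rV[R]_n).
Notation vac := (vac R n).
Notation fock_vec := 'cV[R]_((fock_dim n).+1).

Definition one_form a : mixed_form R n := fun k =>
  match k return 'M[R]_(k, n) -> R with
  | 1 => fun A => (a *m (row 0 A)^T) 0 0
  | _ => fun=> 0
  end.

Lemma form_wedge0l w1 w2 k (A : 'M[R]_(k, n)) :
  (forall k' A', w1 k' A' = 0) -> form_wedge w1 w2 A = 0.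
Proof.
by move=> w10; rewrite form_wedgeE big1 // => S _; rewrite w10 mulr0 mul0r.
Qed.

Lemma eq_form_wedgel w1 w1' w2 k (A : 'M[R]_(k, n)) :
  (forall k' A', w1 k' A' = w1' k' A') -> form_wedge w1 w2 A = form_wedge w1' w2 A.
Proof. by move=> w11; rewrite !form_wedgeE; apply: eq_bigr => S _; rewrite w11. Qed.

Lemma eq_form_wedger w1 w2 w2' k (A : 'M[R]_(k, n)) :
  (forall k' A', w2 k' A' = w2' k' A') -> form_wedge w1 w2 A = form_wedge w1 w2' A.
Proof. by move=> w22; rewrite !form_wedgeE; apply: eq_bigr => S _; rewrite w22. Qed.

Lemma form_wedge_scale c w1 w2 k (A : 'M[R]_(k, n)) :
  form_wedge (form_scale c w1) w2 A = c * form_wedge w1 w2 A.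
Proof.
rewrite !form_wedgeE mulr_sumr; apply: eq_bigr => S _.
by rewrite /form_scale !mulrA [_ * c]mulrC.
Qed.

Lemma contract_fock_form u x k (A : 'M[R]_(k, n)) :
  contract u (fock_form x) A = fock_form (iota u *m x) A.
Proof. by rewrite /contract fock_formS row0_col_mx row'0_col_mx. Qed.

Lemma form_wedge_one w k (A : 'M[R]_(k, n)) : form_wedge (@form_one R n) w A = w k A.
Proof.
elim: k w A => [|k IHk] w A.
  by rewrite form_wedge0 /form_one eqxx mul1r (flatmx0 A).
rewrite form_wedgeS form_wedge0l // add0r.
rewrite (@eq_form_wedgel _ (@form_one R n)).
  by rewrite IHk /contract col_mx_row0.
by move=> [|k'] A'; rewrite /form_grade /form_one ?mul1r ?mulr0.
Qed.

Lemma form_wedge_eps a x k (A : 'M[R]_(k, n)) :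
  form_wedge (one_form a) (fock_form x) A = fock_form (eps a *m x) A.
Proof.
elim: k x A => [|k IHk] x A.
  by rewrite form_wedge0 mul0r fock_form0 mulmxA vac_eps mul0mx mxE.
rewrite form_wedgeS fock_formS mulmxA mulmxE iota_eps mulmxBl.
set r := row ord0 A; set c := (r *m a^T) 0 0.
have -> : c%:A *m x - eps a * iota r *m x = c *: x + -1 *: (eps a *m (iota r *m x)).
  by rewrite -scalemxAl mul1mx scaleN1r mulmxA.
rewrite fock_form_lin -IHk mulN1r; congr (_ + _).
  rewrite (@eq_form_wedgel _ (form_scale c (@form_one R n))); last first.
    move=> [|k'] A'; rewrite /contract /form_scale /form_one ?mulr0 //= mulr1.
    by rewrite (row0_col_mx r A') /c -[a in LHS]trmxK -trmx_mul mxE.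
  by rewrite form_wedge_scale form_wedge_one.
rewrite -mulN1r -form_wedge_scale.
rewrite (@eq_form_wedgel _ (form_scale (-1) (one_form a))); last first.
  by move=> [|[|k']] A'; rewrite /form_grade /form_scale ?mulr0 // expr1.
by apply: eq_form_wedger => k' A'; rewrite contract_fock_form.
Qed.

Definition qcre (W : 'M[R]_n) := (qann W^T)^T.

Lemma iota_qcre u W : iota u * qcre W = qcre W * iota u + eps (u *m (W - W^T)).
Proof.
apply/trmx_inj; rewrite raddfD /= !trM /qcre trmxK tr_iota tr_eps eps_qann trmxK.
by rewrite -opprB mulmxN raddfN /= addrNK.
Qed.

Lemma vac_qcre W : vac^T *m qcre W = 0.
Proof. by rewrite /qcre -trmx_mul qann_vac trmx0. Qed.

Lemma ecreE W : ecre W = texp n (qcre W).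
Proof.
rewrite /ecre /eann /texp linear_sum; apply: eq_bigr => k _; rewrite linearZ /=.
congr (_ *: _); elim: (nat_of_ord k) => [|m IHm]; first by rewrite !expr0 trmx1.
by rewrite exprS trM IHm -exprSr.
Qed.

Definition bilin (Om : 'M[R]_n) (u v : 'rV[R]_n) : R := (u *m Om *m v^T) 0 0.

Lemma form_wedge_qcre W x k (A : 'M[R]_(k, n)) :
  form_wedge (two_form (bilin (W - W^T))) (fock_form x) A =
  fock_form (qcre W *m x) A.
Proof.
elim: k x A => [|k IHk] x A.
  by rewrite form_wedge0 mul0r fock_form0 mulmxA vac_qcre mul0mx mxE.
rewrite form_wedgeS fock_formS mulmxA mulmxE iota_qcre mulmxDl.
set r := row ord0 A.
have -> : qcre W * iota r *m x + eps (r *m (W - W^T)) *m x =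
    1 *: (eps (r *m (W - W^T)) *m x) + 1 *: (qcre W *m (iota r *m x)).
  by rewrite !scale1r mulmxA addrC.
rewrite fock_form_lin -IHk !mul1r; congr (_ + _).
  rewrite -form_wedge_eps; apply: eq_form_wedgel => -[|[|k']] A' //.
  rewrite /contract /= /bilin -[in RHS](row'0_col_mx r A') (row0_col_mx r A').
  congr ((_ *m _^T) 0 0); have -> : 1 = lift ord0 ord0 :> 'I_2 by apply/val_inj.
  by apply/rowP => l; rewrite [LHS]mxE [RHS]mxE [RHS]mxE.
rewrite (@eq_form_wedgel _ (two_form (bilin (W - W^T)))); last first.
  by move=> [|[|[|k']]] A'; rewrite /form_grade ?mulr0 // -signr_odd mul1r.
by apply: eq_form_wedger => k' A'; rewrite contract_fock_form.
Qed.

Lemma form_power_qcre W i k (A : 'M[R]_(k, n)) :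
  form_power (two_form (bilin (W - W^T))) i A = fock_form (qcre W ^+ i *m vac) A.
Proof.
elim: i k A => [|i IHi] k A.
  rewrite expr0 mul1mx /form_power /= /form_one; case: k A => [|k] A.
    by rewrite fock_form0 vacK mxE.
  by rewrite fock_formS iota_vac fock_form_eq0.
rewrite /form_power iterS -/(form_power _ _) (eq_form_wedger _ _ IHi).
by rewrite form_wedge_qcre exprS -mulmxE mulmxA.
Qed.

Lemma fock_form_sum (I : Type) (r : seq I) (x : I -> fock_vec) k (A : 'M[R]_(k, n)) :
  fock_form (\sum_(i <- r) x i) A = \sum_(i <- r) fock_form (x i) A.
Proof.
elim: r => [|i r IHr]; first by rewrite !big_nil fock_form_eq0.
rewrite !big_cons -IHr.
by have := fock_form_lin 1 1 (x i) (\sum_(j <- r) x j) A; rewrite !scale1r !mul1r.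
Qed.

Lemma form_exp_ecre W k (A : 'M[R]_(k, n)) :
  form_exp (two_form (bilin (W - W^T))) A = fock_form (ecre W *m vac) A.
Proof.
rewrite ecreE /texp mulmx_suml fock_form_sum; apply: eq_bigr => i _.
by rewrite form_power_qcre -scalemxAl fock_formZ.
Qed.

Lemma form_exp_mulmx (w w' : mixed_form R n) (Th : 'M[R]_n) :
  (forall k (A : 'M[R]_(k, n)), w k A = w' k (A *m Th)) ->
  forall k (A : 'M[R]_(k, n)), form_exp w A = form_exp w' (A *m Th).
Proof.
move=> ww' k A; apply: eq_bigr => i _; congr (_ * _).
elim: (nat_of_ord i) k A => [|m IHm] k A //.
rewrite /form_power !iterS -!/(form_power _ _) !form_wedgeE; apply: eq_bigr => S _.
have rE (T : {set 'I_k}) : rowsub (@enum_val _ (mem T)) (A *m Th) = rowsub enum_val A *m Th.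
  by apply/matrixP => a b; rewrite !mxE; apply: eq_bigr => c _; rewrite mxE.
by rewrite !rE ww' IHm.
Qed.

End FockWedge.

(** * Spin lifts of orthogonal transformations *)

Section SpinLifts.
Context (R : realType) (n : nat) (b : 'M[R]_n).
Hypothesis b_unit : b \in unitmx.
Notation fock_mx := 'M[R]_((fock_dim n).+1).
Notation vac := (vac R n).
Notation hodge := (hodge R n).
Notation iota := (@iota R n).
Notation eps := (@eps R n).
Implicit Types (A : 'M[R]_n) (T : fock_mx).

(* Two anticommuting families of Clifford generators, for B and - B, which agree on
   the vacuum. *)
Definition clp (v : 'rV[R]_n) : fock_mx := eps (2^-1 *: (v *m b)) + iota v.
Definition clm (v : 'rV[R]_n) : fock_mx := eps (2^-1 *: (v *m b)) - iota v.

Lemma clpBm v : clp v - clm v = 2 *: iota v.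
Proof. by rewrite /clp /clm opprB addrC addrA subrK scaler_nat mulr2n. Qed.

Lemma clpDm v : clp v + clm v = eps (v *m b).
Proof.
rewrite /clp /clm addrACA subrr addr0 -raddfD -scalerDl /=.
by rewrite (_ : 2^-1 + 2^-1 = 1) ?scale1r //; lra.
Qed.

Lemma cl_vac v : clp v *m vac = clm v *m vac.
Proof. by rewrite mulmxDl mulmxBl iota_vac addr0 subr0. Qed.

(* T implements A on the first family and the identity on the second; the last
   clause normalizes T up to sign. *)
Definition spin_lift A T : Prop :=
  [/\ forall v, T * clm v = clm v * T,
      forall v, T * clp v = clp (v *m A) * T &
      T^T * hodge * T = hodge].

Lemma spin_lift1 : spin_lift 1%:M 1.
Proof.
split=> [v|v|]; first by rewrite mul1r mulr1.
  by rewrite mul1r mulr1 mulmx1.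
by rewrite trmx1 mulr1 mul1r.
Qed.

Lemma spin_liftM A A' T T' :
  spin_lift A T -> spin_lift A' T' -> spin_lift (A' *m A) (T * T').
Proof.
move=> [Tm Tp Th] [Tm' Tp' Th']; split=> [v|v|].
- by rewrite -mulrA Tm' mulrA Tm -mulrA.
- by rewrite -mulrA Tp' mulrA Tp -mulrA mulmxA.
- by rewrite trM -!mulrA (mulrA hodge) (mulrA T^T) (mulrA T^T) Th mulrA.
Qed.

Lemma spin_liftN A T : spin_lift A T -> spin_lift A (- T).
Proof.
move=> [Tm Tp Th]; split=> [v|v|]; rewrite ?linearN /= ?mulNr ?mulrN ?Tm ?Tp //.
by rewrite opprK.
Qed.

Lemma spin_lift_unit A T : spin_lift A T -> T \is a GRing.unit.
Proof.
move=> [_ _ Th]; have hu := hodge_unit R n.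
have /mulmx1_unit[] : (hodge^-1 * (T^T * hodge)) *m T = 1%:M.
  by rewrite mulmxE -mulrA Th mulVr.
by [].
Qed.

Lemma cl_schur T : (forall v, T * clm v = clm v * T) ->
  (forall v, T * clp v = clp v * T) -> exists a, T = a%:M.
Proof.
move=> Tm Tp; apply: iota_eps_schur => u.
  have u2 : iota u = 2^-1 *: (clp u - clm u).
    by rewrite clpBm scalerA mulVf ?scale1r // pnatr_eq0.
  by rewrite u2 -scalerAr -scalerAl mulrBr mulrBl Tm Tp.
by rewrite -[u](mulmxKV b_unit) -clpDm mulrDr mulrDl Tm Tp.
Qed.

Lemma hodge_scale_inj (a c : R) : a *: hodge = c *: hodge -> a = c.
Proof.
move=> /eqP; rewrite -subr_eq0 -scalerBl scaler_eq0 subr_eq0 => /orP[/eqP//|/eqP h0].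
by have := hodge_unit R n; rewrite h0 unitr0.
Qed.

(* An element implementing A is unique up to a scalar, whose square is then
   given by the pairing. *)
Lemma spin_lift_scale A T T' d : T' \is a GRing.unit -> spin_lift A T ->
  (forall v, T' * clm v = clm v * T') ->
  (forall v, T' * clp v = clp (v *m A) * T') ->
  T'^T * hodge * T' = d *: hodge -> exists2 a, T = a *: T' & a ^+ 2 * d = 1.
Proof.
move=> Tu' [Tm Tp Th] Tm' Tp' Th'; have [a aE] : exists a, T'^-1 * T = a%:M.
  have TmV v : T'^-1 * clm v = clm v * T'^-1.
    apply: (mulrI Tu'); apply: (mulIr Tu').
    by rewrite (mulVKr Tu') mulrA Tm' -!mulrA mulVr // mulr1.
  have TpV v : T'^-1 * clp (v *m A) = clp v * T'^-1.
    apply: (mulrI Tu'); apply: (mulIr Tu').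
    by rewrite (mulVKr Tu') mulrA Tp' -!mulrA mulVr // mulr1.
  apply: cl_schur => v; first by rewrite -mulrA Tm mulrA TmV mulrA.
  by rewrite -mulrA Tp mulrA TpV mulrA.
have TE : T = a *: T' by rewrite -(mulVKr Tu' T) aE -mulmxE mul_mx_scalar.
exists a => //; apply: hodge_scale_inj.
rewrite scale1r -[RHS]Th TE.
transitivity (a *: (a *: (T'^T * hodge * T'))); first by rewrite Th' !scalerA expr2.
by rewrite [(a *: T')^T]linearZ /= -scalerAr -!scalerAl.
Qed.

Lemma spin_lift_uniq A T T' : spin_lift A T -> spin_lift A T' -> T = T' \/ T = - T'.
Proof.
move=> lT lT'; have Tu' := spin_lift_unit lT'; have [Tm' Tp' Th'] := lT'.
have Th1 : T'^T * hodge * T' = 1 *: hodge by rewrite scale1r.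
have [a -> /eqP] := spin_lift_scale Tu' lT Tm' Tp' Th1.
rewrite mulr1 sqrf_eq1 => /orP[]/eqP->; first by left; rewrite scale1r.
by right; rewrite scaleN1r.
Qed.

Lemma spin_lift_neqN A T : spin_lift A T -> T *m vac <> - (T *m vac).
Proof.
move=> /spin_lift_unit Tu /eqP; rewrite -subr_eq0 opprK -mulr2n -scaler_nat.
rewrite scaler_eq0 pnatr_eq0 /= => /eqP /(congr1 (mulmx T^-1)).
rewrite mulmx0 mulmxA mulmxE mulVr // mul1mx => v0.
by have := vac_neq0 R n; rewrite v0 eqxx.
Qed.

Definition vac_coef T : R := (vac^T *m T *m vac) 0 0.

(* The pure spinor equation: T vac is annihilated by the isotropic subspace of
   all clp (v A) - clm v. *)
Lemma spin_lift_vac A T v : spin_lift A T -> clp (v *m A) *m (T *m vac) = clm v *m (T *m vac).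
Proof.
move=> [Tm Tp _].
by rewrite mulmxA mulmxE -Tp -mulmxE -mulmxA cl_vac mulmxA mulmxE Tm -mulmxE -mulmxA.
Qed.

Lemma spin_lift_unitmx A T :
  spin_lift A T -> vac_coef T != 0 -> 1%:M + A \in unitmx.
Proof.
move=> lT c0; rewrite -row_free_unit -kermx_eq0; apply/eqP/row_matrixP => i.
rewrite row0; set v := row i _.
have vA : v *m A = - v.
  apply/eqP; rewrite -subr_eq0 opprK -[X in _ + X]mulmx1 -mulmxDr addrC.
  by rewrite /v -row_mul mulmx_ker row0.
have := spin_lift_vac v lT; rewrite vA => /eqP; rewrite -subr_eq0 -mulmxBl.
have -> : clp (- v) - clm v = - eps (v *m b).
  have -> : clp (- v) = - clp v by rewrite /clp mulNmx scalerN !raddfN /= -opprD.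
  by rewrite -opprD clpDm.
rewrite mulNmx oppr_eq0 => /eqP e0; set s := T *m vac in e0.
have vb0 : v *m b = 0.
  apply/rowP => j; rewrite [RHS]mxE; apply/eqP.
  have := iota_eps (delta_mx 0 j) (v *m b) => /(congr1 (fun X => (vac^T *m (X *m s)) 0 0)).
  rewrite -!mulmxE -mulmxA e0 !mulmx0 mxE mulmxBl mulmxBr -mulmxA.
  rewrite [X in _ - X]mulmxA vac_eps mul0mx subr0 -scalemxAl mul1mx -scalemxAr mxE.
  move=> /esym/eqP; rewrite mulf_eq0 /s [vac^T *m _]mulmxA [_ == 0 in X in _ || X](negPf c0) orbF.
  by rewrite -rowE !mxE.
by rewrite -[v](mulmxK b_unit) vb0 mul0mx.
Qed.

Lemma pull_unit (M : 'M[R]_n) : M \in unitmx -> pull M \is a GRing.unit.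
Proof.
move=> Mu; have dM : \det M != 0 by rewrite -unitfE -unitmxE.
have ph := tr_pull_hodge Mu (pull_top_det Mu); have hu := hodge_unit R n.
have /mulmx1_unit[] : ((\det M)^-1 *: (hodge^-1 * ((pull M)^T * hodge))) *m pull M = 1%:M.
  by rewrite mulmxE -scalerAl -mulrA ph -scalerAr scalerA mulVf // scale1r mulVr.
by [].
Qed.

Lemma spin_lift_pull M A T : M \in unitmx -> M *m b *m M^T = b ->
  spin_lift A T ->
  spin_lift (M *m A *m invmx M) (pull M * T * (pull M)^-1).
Proof.
move=> Mu Mo [Tm Tp Th]; have dM : \det M != 0 by rewrite -unitfE -unitmxE.
have ph := tr_pull_hodge Mu (pull_top_det Mu); have pu := pull_unit Mu.
have peps v : pull M * eps (2^-1 *: (v *m M *m b)) = eps (2^-1 *: (v *m b)) * pull M.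
  by rewrite pull_eps -scalemxAl -!mulmxA (mulmxA M) Mo.
have pp v : pull M * clp (v *m M) = clp v * pull M.
  by rewrite /clp mulrDr mulrDl peps iota_pull.
have pm v : pull M * clm (v *m M) = clm v * pull M.
  by rewrite /clm mulrBr mulrBl peps iota_pull.
have conj x y : pull M * x = y * pull M -> (pull M)^-1 * y = x * (pull M)^-1.
  move=> xy; apply: (mulrI pu); apply: (mulIr pu).
  by rewrite (mulVKr pu) mulrA xy -!mulrA mulVr // mulr1.
split=> [v|v|].
- by rewrite -!mulrA (conj _ _ (pm v)) (mulrA T) Tm !mulrA pm.
- rewrite -!mulrA (conj _ _ (pp v)) (mulrA T) Tp !mulrA; congr (_ * _ * _).
  by rewrite -[v *m M *m A](mulmxKV Mu) pp !mulmxA.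
rewrite !trM trmxV; set pt := (pull M)^T in ph *.
transitivity (pt^-1 * (T^T * (pt * hodge * pull M) * T) * (pull M)^-1).
  by rewrite !mulrA.
rewrite ph -scalerAr -scalerAl Th -ph !mulrA mulVr ?unitr_trmx // mul1r.
by rewrite mulrK.
Qed.

Definition gauss_vec A : 'cV[R]_((fock_dim n).+1) :=
  ecre (4^-1 *: ((1%:M - A) *m invmx (1%:M + A) *m b)) *m vac.

(* The normally ordered Gaussian solving the intertwining relations of spin_lift;
   it exists only where 1 + A is invertible. *)
Definition gauss A : fock_mx :=
  ecre (4^-1 *: ((1%:M - A) *m invmx (1%:M + A) *m b)) *
  pull (2 *: invmx (1%:M + A)) *
  eann (invmx b *m ((1%:M - A) *m invmx (1%:M + A))).

Hypothesis b_sym : b^T = b.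

Section Cayley.
Variable A : 'M[R]_n.
Hypothesis A_orth : A *m b *m A^T = b.
Hypothesis A1_unit : 1%:M + A \in unitmx.
Let V := invmx (1%:M + A).
Let D := (1%:M - A) *m V.

Let AV : A *m V = 1%:M - V.
Proof. by apply: (canRL (addrK _)); rewrite -[X in _ + X]mul1mx -mulmxDl addrC mulmxV. Qed.

Let VA : V *m A = 1%:M - V.
Proof. by apply: (canRL (addrK _)); rewrite -[X in _ + X]mulmx1 -mulmxDr addrC mulVmx. Qed.

Let DE : D = 2 *: V - 1%:M.
Proof. by rewrite /D mulmxBl mul1mx AV opprB addrA scaler_nat mulr2n. Qed.

Let bV : b *m V^T = (1%:M - V) *m b.
Proof.
have U : (1%:M + A)^T \in unitmx by rewrite unitmx_tr.
apply: (can_inj (mulmxK U)); rewrite -mulmxA -trmx_mul mulmxV // trmx1 mulmx1.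
rewrite linearD /= trmx1 -VA mulmxDr mulmx1 -!mulmxA (mulmxA A) A_orth.
by rewrite -mulmxDr -[X in _ + X]mul1mx -mulmxDl mulmxA [A + _]addrC mulVmx // mul1mx.
Qed.

Lemma cayley_skew : (D *m b)^T = - (D *m b).
Proof.
rewrite (trmx_mul D b) b_sym DE linearB linearZ /= trmx1 mulmxBr -scalemxAr bV mulmx1.
rewrite mulmxBl mul1mx mulmxBl -scalemxAl mul1mx scalerBr opprB scaler_nat mulr2n.
by rewrite addrAC addrK.
Qed.

Let W_skew : 4^-1 *: (D *m b) - (4^-1 *: (D *m b))^T = 2^-1 *: (D *m b).
Proof.
rewrite linearZ /= cayley_skew scalerN opprK -scalerDl; congr (_ *: _); lra.
Qed.

Let P_skew : invmx b *m D - (invmx b *m D)^T = 2 *: (invmx b *m D).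
Proof.
have -> : (invmx b *m D)^T = - (invmx b *m D).
  have sk : b *m D^T = - (D *m b) by rewrite -cayley_skew (trmx_mul D b) b_sym.
  apply: (can_inj (mulKmx b_unit)); apply: (can_inj (mulmxK b_unit)).
  rewrite (trmx_mul _ D).
  by rewrite trmx_inv b_sym mulmxA sk mulmxN mulKVmx // -mulNmx mulmxKV // mulNmx.
by rewrite opprK scaler_nat mulr2n.
Qed.

Let M := 2 *: V.

Let M_unit : M \in unitmx.
Proof.
apply: (@mulmx1_unit _ _ M (2^-1 *: (1%:M + A)) _).1.
by rewrite /M -scalemxAl -scalemxAr scalerA mulVmx // divff ?scale1r // pnatr_eq0.
Qed.

Let MU : (2^-1 *: (1%:M + A)) *m M = 1%:M.
Proof. by rewrite /M -scalemxAl -scalemxAr scalerA mulmxV // mulVf ?scale1r // pnatr_eq0. Qed.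

Let pull_iota u : pull M * iota u = iota (2^-1 *: (u *m (1%:M + A))) * pull M.
Proof. by rewrite iota_pull scalemxAr -mulmxA MU mulmx1. Qed.

Let gauss_iota v : gauss A * iota v =
  (iota (2^-1 *: (v *m (1%:M + A))) - eps (4^-1 *: (v *m (1%:M - A) *m b))) * gauss A.
Proof.
rewrite /gauss -/V -/D -/M -(mulrA _ (eann _)) -iota_eann mulrA -(mulrA _ (pull M)).
rewrite pull_iota mulrA ecre_iota W_skew !mulrA; congr ((_ - eps _) * _ * _ * _).
have UD : (1%:M + A) *m D = 1%:M - A.
  rewrite DE mulmxBr mulmx1 -scalemxAr mulmxV // scaler_nat mulr2n.
  by rewrite opprD addrA addrK.
rewrite -scalemxAr -scalemxAl scalerA mulmxA -(mulmxA v (1%:M + A)) UD.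
by congr (_ *: _); lra.
Qed.

Let gauss_eps v : gauss A * eps (v *m b) =
  (eps (2^-1 *: (v *m (1%:M + A) *m b)) - iota (v *m (1%:M - A))) * gauss A.
Proof.
have yE : v *m b *m (invmx b *m D - (invmx b *m D)^T) = 2 *: (v *m D).
  by rewrite P_skew -scalemxAr mulmxA mulmxK.
have DU : D *m (1%:M + A) = 1%:M - A by rewrite /D mulmxKV.
rewrite /gauss -/V -/D -/M -(mulrA _ (eann _)) eann_eps yE mulrA -(mulrA _ (pull M)).
rewrite mulrBr pull_eps pull_iota mulrBr !mulrA -eps_ecre ecre_iota W_skew.
rewrite -mulrBl -mulrBl -!mulrA; congr (_ * _).
have -> : 2^-1 *: (2 *: (v *m D) *m (1%:M + A)) = v *m (1%:M - A).
  by rewrite -scalemxAl scalerA mulVf ?pnatr_eq0 // scale1r -(mulmxA v D) DU.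
rewrite opprB addrA -raddfD /=; congr (eps _ - _).
have -> : v *m b *m M^T = 2 *: (v *m ((1%:M - V) *m b)).
  by rewrite /M linearZ /= -scalemxAr -(mulmxA v b) bV.
have -> : v *m (1%:M - A) *m (2^-1 *: (D *m b)) =
    2^-1 *: (v *m ((4 *: V - 3%:M + A) *m b)).
  rewrite -scalemxAr -(mulmxA v (1%:M - A)) (mulmxA (1%:M - A) D).
  congr (_ *: (v *m (_ *m b))); rewrite DE mulmxBl mul1mx mulmxBr mulmx1 -scalemxAr AV.
  by apply/matrixP => i j; rewrite !mxE; lra.
have sE c X : c *: (v *m (X *m b)) = v *m ((c *: X) *m b).
  by rewrite -scalemxAl -scalemxAr.
rewrite -(mulmxA v (1%:M + A)) !sE -mulmxDr -mulmxDl.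
by congr (_ *m (_ *m _)); apply/matrixP => h l; rewrite !mxE; lra.
Qed.

Lemma gauss_clm_clp v : gauss A * clm v = clm v * gauss A /\
  gauss A * clp v = clp (v *m A) * gauss A.
Proof.
have epsZ a u : a *: eps u = eps (a *: u) by rewrite linearZ.
have iotaZ a u : a *: iota u = iota (a *: u) by rewrite linearZ.
have clmE u : clm u = 2^-1 *: eps (u *m b) - iota u by rewrite /clm linearZ.
have clpE u : clp u = 2^-1 *: eps (u *m b) + iota u by rewrite /clp linearZ.
have [ge gi] := (gauss_eps v, gauss_iota v).
rewrite [v *m (_ + _)]mulmxDr [v *m (_ - _)]mulmxBr mulmx1 mulmxDl in ge.
rewrite [v *m (_ + _)]mulmxDr [v *m (_ - _)]mulmxBr mulmx1 mulmxBl in gi.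
rewrite !clmE !clpE mulrBr mulrDr -scalerAr ge gi scalerAl -mulrBl -mulrDl.
move: (v *m A) => vA; move: (v *m b) (vA *m b) => vb vAb; split; congr (_ * _).
  rewrite scalerBr !(epsZ, iotaZ) opprB addrACA -opprD -!raddfD /=.
  by congr (eps _ - iota _); apply/rowP => i; rewrite !mxE; lra.
rewrite scalerBr !(epsZ, iotaZ) [iota _ - eps _]addrC addrACA -raddfB.
rewrite [- iota _ + _]addrC -raddfB /=.
by congr (eps _ + iota _); apply/rowP => i; rewrite !mxE; lra.
Qed.

Let gauss_clm v := (gauss_clm_clp v).1.
Let gauss_clp v := (gauss_clm_clp v).2.

Lemma gauss_hodge : (gauss A)^T * hodge * gauss A = \det M *: hodge.
Proof.
rewrite /gauss -/V -/D -/M !trM !mulrA -(mulrA _ (ecre _)^T) -(mulrA _ _ (ecre _)).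
rewrite tr_ecre_hodge -(mulrA _ (pull M)^T) -(mulrA _ _ (pull M)).
rewrite (tr_pull_hodge M_unit (pull_top_det M_unit)) -scalerAr -scalerAl.
by rewrite tr_eann_hodge.
Qed.

Lemma gauss_unit : gauss A \is a GRing.unit.
Proof.
have hu := hodge_unit R n; have dM : \det M != 0 by rewrite -unitfE -unitmxE.
have /mulmx1_unit[] : ((\det M)^-1 *: (hodge^-1 * ((gauss A)^T * hodge))) *m gauss A = 1%:M.
  by rewrite mulmxE -scalerAl -mulrA gauss_hodge -scalerAr scalerA mulVf // scale1r mulVr.
by [].
Qed.

Lemma gauss_vac : gauss A *m vac = gauss_vec A.
Proof. by rewrite /gauss /gauss_vec -!mulmxE -[LHS]mulmxA -[LHS]mulmxA eann_vac pull_vac. Qed.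

Lemma vac_coef_gauss : (vac^T *m gauss_vec A) 0 0 = 1.
Proof. by rewrite /gauss_vec mulmxA vac_ecre vacK mxE. Qed.

Lemma det_cayley_pull : \det M * \det (2^-1 *: (A + 1%:M)) = 1.
Proof. by rewrite mulrC -det_mulmx [A + _]addrC MU det1. Qed.

Lemma spin_lift_gauss T : spin_lift A T ->
  T *m vac = vac_coef T *: gauss_vec A /\
  vac_coef T ^+ 2 = \det (2^-1 *: (A + 1%:M)).
Proof.
move=> lT; have [a aE a2] := spin_lift_scale gauss_unit lT gauss_clm gauss_clp gauss_hodge.
have aT : vac_coef T = a.
  by rewrite /vac_coef -mulmxA aE -scalemxAl gauss_vac -scalemxAr mxE vac_coef_gauss mulr1.
split; first by rewrite aT aE -scalemxAl gauss_vac.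
have dM : \det M != 0 by rewrite -unitfE -unitmxE.
by rewrite aT; apply: (mulIf dM); rewrite a2 mulrC det_cayley_pull.
Qed.

Lemma gauss_spin_lift : 0 < \det (2^-1 *: (A + 1%:M)) ->
  spin_lift A (Num.sqrt (\det (2^-1 *: (A + 1%:M))) *: gauss A).
Proof.
move=> d0; split=> [v|v|].
- by rewrite -scalerAl -scalerAr gauss_clm.
- by rewrite -scalerAl -scalerAr gauss_clp.
rewrite linearZ /= -scalerAl -scalerAl -scalerAr gauss_hodge !scalerA.
rewrite -expr2 sqr_sqrtr ?ltW // mulrC det_cayley_pull scale1r //.
Qed.

End Cayley.
End SpinLifts.

Local Open Scope classical_set_scope.
Local Open Scope ring_scope.

(** * Lifting homomorphisms of simply connected groups *)

Section IntervalInduction.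
Context (R : realType).

Lemma interval_ind (lo hi : R) (Q : R -> R -> Prop) : lo <= hi ->
  (forall a b c, lo <= a -> a <= b -> b <= c -> c <= hi ->
     Q a b -> Q b c -> Q a c) ->
  (forall t, lo <= t <= hi -> exists2 e, 0 < e & forall a b,
     lo <= a -> t - e < a -> a <= t -> t <= b -> b < t + e -> b <= hi -> Q a b) ->
  Q lo hi.
Proof.
move=> lohi Qtrans Qloc; pose E := [set x | lo <= x <= hi /\ Q lo x].
have Elo : E lo.
  split; first by rewrite lexx.
  by have [|e e0] := Qloc lo; [rewrite lexx | apply; lra].
have Eub : ubound E hi by move=> x [/andP[]].
have supE : has_sup E by split; [exists lo | exists hi].
pose s := sup E.
have slo : lo <= s by apply: ub_le_sup => //; exists hi.
have shi : s <= hi by apply: ge_sup => //; exists lo.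
have [|e e0 Qe] := Qloc s; first by rewrite slo.
have [x [/andP[lox xhi] Qx] sx] := sup_adherent e0 supE.
have xs : x <= s by apply: ub_le_sup => //; [exists hi | split=> //; rewrite lox].
have Qs : Q lo s by apply: (Qtrans _ x) => //; apply: Qe => //; lra.
have [hs|sh] := leP hi s; first by rewrite (@le_anti _ _ hi s) ?hs.
pose b := Num.min hi (s + e / 2).
have sb : s < b by rewrite lt_min sh; lra.
have bhi : b <= hi by rewrite ge_min lexx.
have bs : b <= s + e / 2 by rewrite ge_min lexx orbT.
have : b <= s.
  apply: ub_le_sup; first by exists hi.
  split; first by apply/andP; split => //; lra.
  by apply: (Qtrans _ s) => //; [lra | apply: Qe => //; lra].
by lra.
Qed.

Lemma near_interval (t : R) (P : R -> Prop) : (\forall x \near t, P x) ->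
  exists2 e, 0 < e & forall x, t - e < x -> x < t + e -> P x.
Proof.
move=> /nbhs_ballP[e /= e0 eP]; exists e => // x tx xt; apply: eP.
by rewrite /ball /= ltr_norml; lra.
Qed.

Lemma locally_constant_segment (lo hi : R) (P : R -> Prop) :
  (forall t, lo <= t <= hi -> \forall x \near t, lo <= x <= hi -> (P x <-> P t)) ->
  forall x, lo <= x <= hi -> (P x <-> P lo).
Proof.
move=> Ploc x xlh; have lohi : lo <= hi by move: xlh => /andP[]; exact: le_trans.
suff : forall y, lo <= y <= hi -> (P y <-> P lo) by apply.
apply: (@interval_ind lo hi (fun a b => forall y, a <= y <= b -> (P y <-> P a))) => //.
  move=> a b c _ ab bc _ Qab Qbc y /andP[ay yc].
  have [yb|by_] := leP y b; first by apply: Qab; rewrite ay.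
  rewrite Qbc ?(ltW by_) //; apply: Qab; rewrite ab /=; exact: lexx.
move=> t tlh; have [e e0 eP] := near_interval (Ploc t tlh).
exists e => // a b loa ta at_ tb bt bhi y /andP[ay yb].
by rewrite eP ?(eP a) //; lra.
Qed.

End IntervalInduction.

Section MatrixContinuity.
Context (R : realType) (T : topologicalType).

Definition mx_cts_at m k (E : set T) (F : T -> 'M[R]_(m, k)) (p : T) : Prop :=
  forall i j, (fun x => F x i j) @ within E (nbhs p) --> F p i j.

Lemma mx_cts_cst m k (E : set T) (A : 'M[R]_(m, k)) p : mx_cts_at E (fun=> A) p.
Proof. by move=> i j; exact: cvg_cst. Qed.

Lemma cvg_sum_in (I : Type) (r : seq I) (F : set_system T) (f : I -> T -> R) (l : I -> R) :
  Filter F -> (forall i, f i x @[x --> F] --> l i) ->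
  (\sum_(i <- r) f i x) @[x --> F] --> \sum_(i <- r) l i.
Proof.
move=> FF fl; elim: r => [|i r IHr].
  by rewrite big_nil; under eq_fun do rewrite big_nil; exact: cvg_cst.
by rewrite big_cons; under eq_fun do rewrite big_cons; exact: cvgD.
Qed.

Lemma mx_cts_mul m k l (E : set T) (F : T -> 'M[R]_(m, k)) (H : T -> 'M[R]_(k, l)) p :
  mx_cts_at E F p -> mx_cts_at E H p -> mx_cts_at E (fun x => F x *m H x) p.
Proof.
move=> cF cH i j; rewrite mxE (_ : (fun x => _) = fun x => \sum_h F x i h * H x h j).
  by apply: cvg_sum_in => h; apply: cvgM; [exact: cF | exact: cH].
by apply/funext => x; rewrite mxE.
Qed.

Lemma mx_cts_opp m k (E : set T) (F : T -> 'M[R]_(m, k)) p :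
  mx_cts_at E F p -> mx_cts_at E (fun x => - F x) p.
Proof.
move=> cF i j; rewrite mxE (_ : (fun x => _) = fun x => - F x i j).
  by apply: cvgN; exact: cF.
by apply/funext => x; rewrite mxE.
Qed.

Lemma mx_cts_sub m k (E E' : set T) (F : T -> 'M[R]_(m, k)) p :
  E' `<=` E -> mx_cts_at E F p -> mx_cts_at E' F p.
Proof.
move=> E'E cF i j; apply: cvg_trans (cF i j); apply: cvg_app.
exact: within_subset.
Qed.

Lemma mx_cts_near m k (E E' : set T) (F F' : T -> 'M[R]_(m, k)) p :
  E p -> (\forall q \near p, E' q -> E q /\ F' q = F q) -> F' p = F p ->
  mx_cts_at E F p -> mx_cts_at E' F' p.
Proof.
move=> Ep FF' Fp cF i j; rewrite Fp => P /(cF i j) EP; rewrite /within /= in EP *.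
rewrite /nbhs /= /within /=; near=> q => E'q.
have [Eq ->] : E q /\ F' q = F q by move: E'q; near: q.
by move: Eq; near: q.
Unshelve. all: by end_near. Qed.

End MatrixContinuity.

Section DoubleCover.
Context (R : realType) (n : nat) (G : lieGroupType R n) (N : nat).
Notation mx := 'M[R]_(N.+1).
Variable Fib : G -> mx -> Prop.
Hypothesis Fib_uniq : forall g T T', Fib g T -> Fib g T' -> T = T' \/ T = - T'.
Hypothesis Fib_unit : forall g T, Fib g T -> T \is a GRing.unit.
Hypothesis FibN : forall g T, Fib g T -> Fib g (- T).
Hypothesis Fib1 : Fib 1%g 1.
Hypothesis FibM : forall g h T U, Fib g T -> Fib h U -> Fib (g * h)%g (T * U).
Variables (W : set G) (sigma : G -> mx).
Hypothesis W_open : open W.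
Hypothesis W1 : W 1%g.
Hypothesis sigma1 : sigma 1%g = 1.
Hypothesis sigmaP : forall w, W w -> Fib w (sigma w).
Hypothesis sigma_cts : forall w, W w -> forall i j, {for w, continuous (fun g => sigma g i j)}.

Definition is_lift (X : topologicalType) (E : set X) (f : X -> G) (F : X -> mx) :=
  forall p, E p -> Fib (f p) (F p) /\ mx_cts_at E F p.

Lemma is_liftN (X : topologicalType) (E : set X) (f : X -> G) F :
  is_lift E f F -> is_lift E f (fun x => - F x).
Proof. by move=> lF p /lF[/FibN ? cF]; split=> //; exact: mx_cts_opp. Qed.

Lemma is_lift_sub (X : topologicalType) (E E' : set X) f F :
  E' `<=` E -> is_lift E f F -> is_lift E' f F.
Proof. by move=> E'E lF p /E'E /lF[? ?]; split=> //; exact: mx_cts_sub E'E _. Qed.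

Lemma Fib_neqN g T : Fib g T -> T <> - T.
Proof.
move=> /Fib_unit Tu /eqP; rewrite -subr_eq0 opprK -mulr2n -scaler_nat scaler_eq0.
by rewrite pnatr_eq0 /= => /eqP T0; move: Tu; rewrite T0 unitr0.
Qed.

Lemma is_lift_eq_near (X : topologicalType) (E : set X) f F1 F2 p :
  is_lift E f F1 -> is_lift E f F2 -> E p ->
  \forall q \near p, E q -> (F1 q = F2 q <-> F1 p = F2 p).
Proof.
move=> l1 l2 Ep; have [[fib1 c1] [fib2 c2]] := (l1 p Ep, l2 p Ep).
have [i [j Fij]] : exists i j, F1 p i j != 0.
  apply: contrapT => nex; have : F1 p = 0.
    apply/matrixP => i j; rewrite mxE; apply/eqP; apply: contrapT => /negP Fij.
    by apply: nex; exists i, j.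
  by move=> F0; have := Fib_unit fib1; rewrite F0 unitr0.
have cP : (fun q => F1 q i j * F2 q i j) @ within E (nbhs p) --> F1 p i j * F2 p i j.
  by apply: cvgM; [exact: c1 | exact: c2].
have [e|eN] := Fib_uniq fib1 fib2.
  have pos : 0 < F1 p i j * F2 p i j by rewrite -e -expr2 exprn_even_gt0.
  have : \forall q \near within E (nbhs p), 0 < F1 q i j * F2 q i j by exact: (cvgr_gt _ cP).
  rewrite near_withinE; apply: filterS => q qpos Eq; split=> // _.
  have [//|qN] := Fib_uniq (l1 q Eq).1 (l2 q Eq).1.
  by move: (qpos Eq); rewrite qN mxE mulNr oppr_gt0 -expr2 ltNge sqr_ge0.
have neg : F1 p i j * F2 p i j < 0.
  rewrite eN mxE mulNr oppr_lt0 -expr2 exprn_even_gt0 //=.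
  by move: Fij; rewrite eN mxE oppr_eq0.
have : \forall q \near within E (nbhs p), F1 q i j * F2 q i j < 0 by exact: (cvgr_lt _ cP).
rewrite near_withinE; apply: filterS => q qneg Eq; split=> [qe|pe].
  by move: (qneg Eq); rewrite qe -expr2 ltNge sqr_ge0.
by case: (Fib_neqN fib2); rewrite -eN.
Qed.

Lemma is_lift_segment_eq (lo hi : R) (f : R -> G) F1 F2 (t : R) :
  is_lift `[lo, hi] f F1 -> is_lift `[lo, hi] f F2 -> lo <= t <= hi ->
  (F1 t = F2 t <-> F1 lo = F2 lo).
Proof.
move=> l1 l2; apply: (@locally_constant_segment _ lo hi (fun s => F1 s = F2 s)) => s slh.
have Es : `[lo, hi]%classic s by rewrite /= in_itv.
have := is_lift_eq_near l1 l2 Es; apply: filterS => q Hq qlh; apply: Hq.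
by rewrite /= in_itv.
Qed.

Lemma is_lift_comp (X Y : topologicalType) (E : set X) (E' : set Y) (c : Y -> X) (f : X -> G) F :
  (forall y, E' y -> E (c y)) -> (forall y, E' y -> c @ within E' (nbhs y) --> c y) ->
  is_lift E f F -> is_lift E' (f \o c) (F \o c).
Proof.
move=> cE cc lF y E'y; have [fibF cF] := lF _ (cE _ E'y); split=> // i j.
have : c @ within E' (nbhs y) --> within E (nbhs (c y)).
  move=> P; rewrite /within /= => EP.
  have := cc y E'y _ EP; rewrite /nbhs /= /within /= => Hn.
  apply: filterS Hn => z Hz E'z; exact: Hz (cE _ E'z).
by move=> cW; apply: cvg_comp cW (cF i j).
Qed.

Lemma is_lift_glue (X : topologicalType) (E1 E2 : set X) f F1 F2 : closed E1 -> closed E2 ->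
  is_lift E1 f F1 -> is_lift E2 f F2 -> (forall p, E1 p -> E2 p -> F1 p = F2 p) ->
  is_lift (E1 `|` E2) f (fun p => if pselect (E1 p) then F1 p else F2 p).
Proof.
move=> cl1 cl2 l1 l2 F12 p E12p.
have near_out (E : set X) : closed E -> ~ E p -> \forall q \near p, ~ E q.
  by move=> clE nEp; apply: open_nbhs_nbhs; split=> //; exact: closed_openC.
split.
  case: pselect => [E1p|nE1p]; first exact: (l1 p E1p).1.
  by case: E12p => // E2p; exact: (l2 p E2p).1.
have [E1p|nE1p] := pselect (E1 p); last first.
  have E2p : E2 p by case: E12p.
  apply: (mx_cts_near E2p _ _ (l2 p E2p).2); last by case: pselect.
  have := near_out _ cl1 nE1p; apply: filterS => q nE1q [//|E2q]; split=> //.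
  by case: pselect.
have [E2p|nE2p] := pselect (E2 p); last first.
  apply: (mx_cts_near E1p _ _ (l1 p E1p).2); last by case: pselect.
  have := near_out _ cl2 nE2p; apply: filterS => q nE2q [E1q|//]; split=> //.
  by case: pselect.
move=> i j P; case: pselect => [E1p0 /= Pnb|//].
have P1 : \forall q \near p, E1 q -> P (F1 q i j) := (l1 p E1p).2 i j P Pnb.
have P2nb : nbhs (F2 p i j) P by rewrite -F12.
have P2 : \forall q \near p, E2 q -> P (F2 q i j) := (l2 p E2p).2 i j P P2nb.
change (\forall q \near p, (E1 `|` E2) q ->
  P ((if pselect (E1 q) then F1 q else F2 q) i j)).
apply: filterS2 P1 P2 => q P1q P2q E12q.
case: pselect => [E1q|nE1q]; first exact: P1q.
by apply: P2q; case: E12q.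
Qed.

Hypothesis G_simply_connected : simply_connected R G.
Hypothesis W_paths : \forall g \near (1%g : G), exists gamma : R -> G,
  [/\ {within `[0, 1], continuous gamma}, gamma 0 = 1%g, gamma 1 = g &
      forall t, 0 <= t <= 1 -> W (gamma t)].

Lemma mulg_cvg (X : Type) (F : set_system X) (FF : Filter F) (f g : X -> G) (a b : G) :
  f @ F --> a -> g @ F --> b -> (fun x => f x * g x)%g @ F --> (a * b)%g.
Proof.
move=> fa gb; have := cvg_pair fa gb.
move=> fg P Pab; have := @mulg_continuous R n G (a, b) P Pab.
exact: fg.
Qed.

Lemma invg_cvg (X : Type) (F : set_system X) (FF : Filter F) (f : X -> G) (a : G) :
  f @ F --> a -> (fun x => (f x)^-1)%g @ F --> (a^-1)%g.
Proof. by move=> fa; exact: cvg_comp fa ((@invg_smooth R n G).1 a). Qed.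

Lemma within_cvg (X Y : topologicalType) (E : set X) (f : X -> Y) :
  {within E, continuous f} <-> (forall x, E x -> f @ within E (nbhs x) --> f x).
Proof. exact: subspace_continuousP. Qed.

Lemma path_generated (P : G -> Prop) : (forall g h, P g -> P h -> P (g * h)%g) ->
  (\forall g \near (1%g : G), P g) -> forall g, P g.
Proof.
move=> PM Pnear g; have [gamma [/within_cvg cg g0 g1]] := G_simply_connected.1 1%g g.
suff : P ((gamma 0%R)^-1 * gamma 1%R)%g by rewrite g0 g1 invg1 mul1g.
apply: (@interval_ind R 0 1 (fun a b => P ((gamma a)^-1 * gamma b)%g)) => //.
  move=> a b c _ _ _ _ Pab Pbc; have := PM _ _ Pab Pbc.
  by rewrite -mulgA mulVKg.
move=> t t01; have Et : `[0, 1]%classic t by rewrite /= in_itv.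
have c2 : (fun p : R * R => (gamma p.1)^-1 * gamma p.2)%g @
    filter_prod (within `[0, 1] (nbhs t)) (within `[0, 1] (nbhs t)) --> (1%g : G).
  rewrite -(mulVg (gamma t)); apply: mulg_cvg.
    apply: invg_cvg; apply: (cvg_comp _ _ (@cvg_fst _ _ _ _ _) (cg t Et)).
  exact: (cvg_comp _ _ (@cvg_snd _ _ _ _ _) (cg t Et)).
have [[A B] /= [At Bt] AB] := c2 _ Pnear.
have [e1 e10 H1] := near_interval At; have [e2 e20 H2] := near_interval Bt.
exists (Num.min e1 e2); first by rewrite lt_min e10.
move=> a b a0 ta at_ tb bt b1; apply: (AB (a, b)).
have m1 : Num.min e1 e2 <= e1 by rewrite ge_min lexx.
have m2 : Num.min e1 e2 <= e2 by rewrite ge_min lexx orbT.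
by split=> /=; [apply: H1 | apply: H2]; rewrite /= ?in_itv /=; lra.
Qed.

Lemma Fib_ex g : exists T, Fib g T.
Proof.
apply: (@path_generated (fun g => exists T, Fib g T)) => [{}g h [T gT] [U hU]|].
  by exists (T * U); exact: FibM.
have : \forall g \near (1%g : G), W g by apply: open_nbhs_nbhs.
by apply: filterS => h Wh; exists (sigma h); exact: sigmaP.
Qed.

Lemma local_lift (X : topologicalType) (E : set X) (f : X -> G) p :
  (forall q, E q -> f @ within E (nbhs q) --> f q) -> E p ->
  exists2 U, nbhs p U & exists F, is_lift (E `&` U) f F.
Proof.
move=> cf Ep; have [T0 fT0] := Fib_ex (f p).
pose h q := ((f p)^-1 * f q)%g.
have ch q : E q -> h @ within E (nbhs q) --> h q.
  by move=> Eq; apply: mulg_cvg; [exact: cvg_cst | exact: cf].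
have Wnear : \forall q \near p, E q -> W (h q).
  have : nbhs (h p) W by rewrite /h mulVg; apply: open_nbhs_nbhs.
  exact: ch p Ep W.
exists [set q | E q -> W (h q)] => //; exists (fun q => T0 * sigma (h q)) => q [Eq /(_ Eq) Whq].
split; first by have := FibM fT0 (sigmaP Whq); rewrite /h mulVKg.
apply: (@mx_cts_sub _ _ _ _ E); first by move=> x [].
apply: mx_cts_mul; first exact: mx_cts_cst.
move=> i j P Pn; exact: (ch q Eq _ (@sigma_cts _ Whq i j P Pn)).
Qed.

Lemma is_lift_glue_edge (X : topologicalType) (E1 E2 : set X) f F1 F2 (c : R -> X) lo hi :
  closed E1 -> closed E2 -> is_lift E1 f F1 -> is_lift E2 f F2 ->
  continuous c -> lo <= hi -> (forall t, lo <= t <= hi -> E1 (c t) /\ E2 (c t)) ->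
  (forall p, E1 p -> E2 p -> exists2 t, lo <= t <= hi & p = c t) ->
  exists F, is_lift (E1 `|` E2) f F.
Proof.
move=> cl1 cl2 l1 l2 cc lohi cE Ec.
have lolo : lo <= lo <= hi by rewrite lexx.
have glue F2' : is_lift E2 f F2' -> F1 (c lo) = F2' (c lo) ->
    exists F, is_lift (E1 `|` E2) f F.
  move=> l2' Flo; eexists; apply: (is_lift_glue cl1 cl2 l1 l2').
  move=> p E1p E2p; have [t tlh ->] := Ec p E1p E2p.
  have cw y : `[lo, hi]%classic y -> c @ within `[lo, hi] (nbhs y) --> c y.
    by move=> _; apply: cvg_within_filter; exact: cc.
  have m1 : is_lift `[lo, hi] (f \o c) (F1 \o c).
    by apply: (is_lift_comp _ cw l1) => y; rewrite /= in_itv => /cE[].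
  have m2 : is_lift `[lo, hi] (f \o c) (F2' \o c).
    by apply: (is_lift_comp _ cw l2') => y; rewrite /= in_itv => /cE[].
  exact: (is_lift_segment_eq m1 m2 tlh).2 Flo.
have [E1lo E2lo] := cE lo lolo.
have [e|e] := Fib_uniq (l1 _ E1lo).1 (l2 _ E2lo).1; first exact: glue l2 e.
exact: glue (is_liftN l2) e.
Qed.

Lemma pairl_continuous (a : R) : continuous (fun t : R => (a, t)).
Proof.
move=> t P [[A B] /= [At Bt] AB]; apply: filterS Bt => x Bx; apply: (AB (a, x)).
by split=> //=; exact: nbhs_singleton At.
Qed.

Lemma pairr_continuous (b : R) : continuous (fun t : R => (t, b)).
Proof.
move=> t P [[A B] /= [At Bt] AB]; apply: filterS At => x Ax; apply: (AB (x, b)).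
by split=> //=; exact: nbhs_singleton Bt.
Qed.

Definition box (a b c d : R) : set (R * R) := `[a, b]%classic `*` `[c, d]%classic.

Lemma box_closed a b c d : closed (box a b c d).
Proof.
rewrite /box (_ : _ `*` _ = fst @^-1` `[a, b]%classic `&` snd @^-1` `[c, d]%classic) //.
apply: closedI; apply: closed_comp.
- by move=> x _; exact: cvg_fst.
- exact: itv_closed.
- by move=> x _; exact: cvg_snd.
- exact: itv_closed.
Qed.

Lemma glue_h f a b b' c d F1 F2 : a <= b -> b <= b' -> c <= d ->
  is_lift (box a b c d) f F1 -> is_lift (box b b' c d) f F2 ->
  exists F, is_lift (box a b' c d) f F.
Proof.
move=> ab bb' cd l1 l2.
have [|t tcd|[x y]|F lF] := @is_lift_glue_edge _ _ _ f F1 F2 (fun t => (b, t)) c d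
  (@box_closed _ _ _ _) (@box_closed _ _ _ _) l1 l2 _ cd.
- exact: pairl_continuous.
- by rewrite /box /= !in_itv /= tcd !lexx ab bb'.
- rewrite /box /= !in_itv /= => -[/andP[ax xb] ycd] [/andP[bx xb'] _].
  by exists y => //; rewrite (@le_anti _ _ x b) ?xb.
exists F; apply: is_lift_sub lF => -[x y]; rewrite /box /= !in_itv /=.
move=> [/andP[ax xb'] ycd]; have [xb|bx] := leP x b.
  by left; rewrite ax.
by right; rewrite (ltW bx) xb'.
Qed.

Lemma glue_v f a b c d d' F1 F2 : a <= b -> c <= d -> d <= d' ->
  is_lift (box a b c d) f F1 -> is_lift (box a b d d') f F2 ->
  exists F, is_lift (box a b c d') f F.
Proof.
move=> ab cd dd' l1 l2.
have [|t tab|[x y]|F lF] := @is_lift_glue_edge _ _ _ f F1 F2 (fun t => (t, d)) a b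
  (@box_closed _ _ _ _) (@box_closed _ _ _ _) l1 l2 _ ab.
- exact: pairr_continuous.
- by rewrite /box /= !in_itv /= tab !lexx cd dd'.
- rewrite /box /= !in_itv /= => -[xab /andP[cy yd]] [_ /andP[dy yd']].
  by exists x => //; rewrite (@le_anti _ _ y d) ?yd.
exists F; apply: is_lift_sub lF => -[x y]; rewrite /box /= !in_itv /=.
move=> [xab /andP[cy yd']]; have [yd|dy] := leP y d.
  by left; rewrite cy.
by right; rewrite (ltW dy) yd'.
Qed.

Lemma square_lift (f : R * R -> G) :
  {within `[0, 1] `*` `[0, 1], continuous f} ->
  exists F, is_lift (box 0 1 0 1) f F.
Proof.
move=> /within_cvg cf.
apply: (@interval_ind R 0 1 (fun a b => exists F, is_lift (box a b 0 1) f F)) => //.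
  by move=> a b c _ ab bc _ [F1 l1] [F2 l2]; exact: glue_h l1 l2.
move=> t t01.
apply: (@interval_ind R 0 1 (fun c d => exists2 e, 0 < e & forall a b : R,
   0 <= a -> t - e < a -> a <= t -> t <= b -> b < t + e -> b <= 1 ->
   exists F, is_lift (box a b c d) f F)) => //.
  move=> c d d' _ cd dd' _ [e1 e10 H1] [e2 e20 H2].
  exists (Num.min e1 e2); first by rewrite lt_min e10.
  have m1 : Num.min e1 e2 <= e1 by rewrite ge_min lexx.
  have m2 : Num.min e1 e2 <= e2 by rewrite ge_min lexx orbT.
  move=> a b a0 ta at_ tb bt b1.
  have [||||||F1 l1] := H1 a b; try lra.
  have [||||||F2 l2] := H2 a b; try lra.
  by apply: glue_v l1 l2 => //; lra.
move=> s s01.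
have Ets : (`[0, 1]%classic `*` `[0, 1]%classic) (t, s) by rewrite /= !in_itv.
have [U Uts [F lF]] := local_lift cf Ets.
have /nbhs_ballP[e /= e0 eU] := Uts.
exists e => // c d c0 sc cs sd ds d1; exists e => // a b a0 ta at_ tb bt b1.
exists F; apply: is_lift_sub lF => -[x y]; rewrite /box /= !in_itv /=.
move=> [/andP[ax xb] /andP[cy yd]]; split; first by split; lra.
by apply: eU; split; rewrite /ball /= ltr_norml; lra.
Qed.

Notation I01 := (`[0 : R, 1 : R]%classic).

Lemma path_lift (gamma : R -> G) : {within I01, continuous gamma} ->
  gamma 0 = 1%g -> exists2 F, is_lift I01 gamma F & F 0 = 1.
Proof.
move=> /within_cvg cg g0.
have [|F lF] := @square_lift (gamma \o snd).
  apply/within_cvg => -[x y] [/= Ex Ey] P Pn.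
  have Py : \forall z \near y, I01 z -> P (gamma z) := cg y Ey P Pn.
  have : \forall q \near (x, y), I01 q.2 -> P (gamma q.2).
    exact: (@cvg_snd _ _ (nbhs x) (nbhs y) _ _ Py).
  by apply: filterS => -[a b] /= Hb [_ /Hb].
have lF0 : is_lift I01 gamma (fun t => F (0, t)).
  apply: (@is_lift_comp _ _ _ _ (fun t => (0, t)) _ _ _ _ lF).
    by move=> y; rewrite /box /= !in_itv /= lexx ler01.
  by move=> y _; apply: cvg_within_filter; exact: pairl_continuous.
have E0 : I01 0 by rewrite /= in_itv /= lexx ler01.
have := (lF0 0 E0).1; rewrite g0 => F01.
have [e|e] := Fib_uniq F01 Fib1; first by exists (fun t => F (0, t)).
by exists (fun t => - F (0, t)); [exact: is_liftN | rewrite e opprK].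
Qed.

Lemma lift_cst (E : set R) : is_lift E (fun=> 1%g) (fun=> 1).
Proof. by move=> p _; split=> //; exact: mx_cts_cst. Qed.

Lemma lift_const_eq (f : R -> G) F (s t : R) : (forall x, 0 <= x <= 1 -> f x = 1%g) ->
  is_lift I01 f F -> 0 <= s <= 1 -> 0 <= t <= 1 -> F s = 1 -> F t = 1.
Proof.
move=> f1 lF s01 t01 Fs.
have lF1 : is_lift I01 (fun=> 1%g) F.
  move=> p; rewrite /= in_itv /= => p01.
  by have := lF p; rewrite f1 //; apply; rewrite /= in_itv.
have H := is_lift_segment_eq lF1 (@lift_cst I01).
by apply/(H t t01)/(H s s01).
Qed.

Lemma is_lift_ext (X : topologicalType) (E : set X) (f f' : X -> G) F :
  (forall x, E x -> f x = f' x) -> is_lift E f F -> is_lift E f' F.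
Proof. by move=> ff' lF p Ep; rewrite -ff' //; exact: lF. Qed.

Lemma loop_lift (gamma : R -> G) F : {within I01, continuous gamma} ->
  gamma 0 = 1%g -> gamma 1 = 1%g -> is_lift I01 gamma F -> F 0 = 1 -> F 1 = 1.
Proof.
move=> cg g0 g1 lF F0; have [H [cH H0 H1 Hs]] := G_simply_connected.2 1%g gamma cg g0 g1.
have in01 (x : R) : 0 <= x <= 1 -> x \in `[0, 1] by rewrite in_itv.
have E0 : 0 <= (0 : R) <= 1 by rewrite lexx ler01.
have E1 : 0 <= (1 : R) <= 1 by rewrite lexx ler01.
have [K lK K0] : exists2 K, is_lift (box 0 1 0 1) H K & K (0, 0) = 1.
  have [K lK] := square_lift cH.
  have B0 : box 0 1 0 1 (0, 0) by rewrite /box /= !in_itv /= E0.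
  have := (lK _ B0).1; rewrite H0 ?in01 // g0 => K01.
  have [e|e] := Fib_uniq K01 Fib1; first by exists K.
  by exists (fun t => - K t); [exact: is_liftN | rewrite e opprK].
have lKl a : 0 <= a <= 1 -> is_lift I01 (fun t => H (a, t)) (fun t => K (a, t)).
  move=> a01; apply: (@is_lift_comp _ _ _ _ (fun t => (a, t)) _ _ _ _ lK).
    by move=> y; rewrite /box /= !in_itv /= => ->; rewrite a01.
  by move=> y _; apply: cvg_within_filter; exact: pairl_continuous.
have lKr b : 0 <= b <= 1 -> is_lift I01 (fun t => H (t, b)) (fun t => K (t, b)).
  move=> b01; apply: (@is_lift_comp _ _ _ _ (fun t => (t, b)) _ _ _ _ lK).
    by move=> y; rewrite /box /= !in_itv /= => ->; rewrite b01.
  by move=> y _; apply: cvg_within_filter; exact: pairr_continuous.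
have lKg : is_lift I01 gamma (fun t => K (0, t)).
  apply: is_lift_ext (lKl 0 E0) => x; rewrite /= in_itv => x01.
  by rewrite H0 ?in01.
have -> : F 1 = K (0, 1).
  by apply/(is_lift_segment_eq lF lKg E1); rewrite F0 K0.
have K10 : K (1, 0) = 1.
  by apply: (lift_const_eq _ (lKr 0 E0) E0 E1 K0) => x x01; rewrite (Hs x (in01 _ x01)).1.
have K11 : K (1, 1) = 1.
  by apply: (lift_const_eq _ (lKl 1 E1) E0 E1 K10) => x x01; rewrite H1 // in01.
by apply: (lift_const_eq _ (lKr 1 E1) E1 E0 K11) => x x01; rewrite (Hs x (in01 _ x01)).2.
Qed.

Lemma is_liftM (X : topologicalType) (E : set X) (f1 f2 : X -> G) F1 F2 :
  is_lift E f1 F1 -> is_lift E f2 F2 ->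
  is_lift E (fun x => f1 x * f2 x)%g (fun x => F1 x * F2 x).
Proof.
move=> l1 l2 p Ep; have [[fib1 c1] [fib2 c2]] := (l1 p Ep, l2 p Ep).
by split; [exact: FibM | exact: mx_cts_mul].
Qed.

Lemma within_mulg (X : topologicalType) (E : set X) (f1 f2 : X -> G) :
  {within E, continuous f1} -> {within E, continuous f2} ->
  {within E, continuous (fun x => f1 x * f2 x)%g}.
Proof.
move=> /within_cvg c1 /within_cvg c2; apply/within_cvg => x Ex.
by apply: mulg_cvg; [exact: c1 | exact: c2].
Qed.

Lemma within_invg (X : topologicalType) (E : set X) (f : X -> G) :
  {within E, continuous f} -> {within E, continuous (fun x => (f x)^-1)%g}.
Proof. by move=> /within_cvg c; apply/within_cvg => x Ex; apply: invg_cvg; exact: c. Qed.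

Definition lifted_path (g : G) (T : mx) := exists (gamma : R -> G) F,
  [/\ {within I01, continuous gamma}, gamma 0 = 1%g, gamma 1 = g,
      is_lift I01 gamma F & F 0 = 1 /\ F 1 = T].

Lemma lifted_path_ex g : exists T, lifted_path g T.
Proof.
have [gamma [cg g0 g1]] := G_simply_connected.1 1%g g.
by have [F lF F0] := path_lift cg g0; exists (F 1), gamma, F.
Qed.

Lemma in01_1 : I01 (1 : R). Proof. by rewrite /= in_itv /= lexx ler01. Qed.

(* The pointwise product of a path with the inverse of another one is a loop,
   so no concatenation of paths is needed. *)
Lemma lifted_path_uniq g T T' : lifted_path g T -> lifted_path g T' -> T = T'.
Proof.
move=> [c [F [cc c0 c1 lF [F0 <-]]]] [c' [F' [cc' c0' c1' lF' [F0' <-]]]].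
pose ci t := ((c' t)^-1)%g; have cci : {within I01, continuous ci} by exact: within_invg.
have ci0 : ci 0 = 1%g by rewrite /ci c0' invg1.
have [K lK K0] := path_lift cci ci0.
have e : F 1 * K 1 = 1.
  apply: (loop_lift (within_mulg cc cci) _ _ (is_liftM lF lK)).
  - by rewrite c0 ci0 mulg1.
  - by rewrite c1 /ci c1' mulgV.
  - by rewrite F0 K0 mulr1.
have e' : F' 1 * K 1 = 1.
  apply: (lift_const_eq _ (is_liftM lF' lK) (_ : 0 <= 0 <= 1)); rewrite ?lexx ?ler01 //.
    by move=> x _; rewrite /ci mulgV.
  by rewrite F0' K0 mulr1.
have Ku : K 1 \is a GRing.unit := Fib_unit (lK 1 in01_1).1.
by apply: (mulIr Ku); rewrite e e'.
Qed.

Lemma double_cover_section : exists S : G -> mx,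
  [/\ forall g, Fib g (S g), forall g h, S (g * h)%g = S g * S h &
      \forall g \near (1%g : G), S g = sigma g].
Proof.
pose S g := projT1 (cid (lifted_path_ex g)).
have SP g : lifted_path g (S g) by rewrite /S; case: cid.
exists S; split.
- by move=> g; have [c [F [_ _ <- lF [_ <-]]]] := SP g; exact: (lF 1 in01_1).1.
- move=> g h; apply: (lifted_path_uniq (SP _)).
  have [c [F [cc c0 c1 lF [F0 F1]]]] := SP g.
  have [c' [F' [cc' c0' c1' lF' [F0' F1']]]] := SP h.
  exists (fun t => c t * c' t)%g, (fun t => F t * F' t); split.
  + exact: within_mulg.
  + by rewrite c0 c0' mulg1.
  + by rewrite c1 c1'.
  + exact: is_liftM.
  + by rewrite F0 F0' mulr1 F1 F1'.
apply: filterS W_paths => g [c [/within_cvg cc c0 c1 cW]].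
apply: (lifted_path_uniq (SP _)); exists c, (sigma \o c); split=> //.
- exact/within_cvg.
- move=> t Et; have Wt : W (c t) by apply: cW; move: Et; rewrite /= in_itv.
  split; first exact: sigmaP.
  by move=> i j P Pn; exact: (cc t Et _ (@sigma_cts _ Wt i j P Pn)).
by rewrite /= c0 c1 sigma1.
Qed.

End DoubleCover.

(** * Algebras of smooth functions *)

Section NearDifferential.
Context (R : realType) (V W : normedModType R).

Lemma near_eq_diff (f g : V -> W) (x : V) : (\forall y \near x, f y = g y) ->
  differentiable f x -> differentiable g x /\ 'd g x = 'd f x :> (V -> W).
Proof.
move=> fg /diff_locallyP[cdf fE].
have gE : g \o shift x = cst (g x) + 'd f x +o_ 0 id.
  apply/eqaddoP => e e0; have /eqaddoP/(_ e e0) fE' := fE.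
  have fg0 : \forall y \near (0 : V), f (y + x) = g (y + x).
    by move: fg; rewrite (near_shift 0 x) /=; apply: filterS => y /=; rewrite subr0.
  apply: filterS2 fE' fg0 => y /=.
  by rewrite !fctE /= -(nbhs_singleton fg) => + <-.
have dE := diff_unique cdf gE; split; last exact: dE.
by apply/diff_locallyP; rewrite dE.
Qed.

End NearDifferential.

Section SmoothFunctions.
Context (R : realType).

Lemma Ck_le (V W : normedModType R) k (U : set V) (f : V -> W) :
  Ck_on k.+1 U f -> Ck_on k U f.
Proof.
elim: k f => [|k IHk] f [df Df]; last by split=> // v; exact: IHk.
by move=> x Ux; apply: differentiable_continuous; exact: df.
Qed.

Lemma Ck_sub (V W : normedModType R) k (U U' : set V) (f : V -> W) :
  U' `<=` U -> Ck_on k U f -> Ck_on k U' f.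
Proof.
move=> U'U; elim: k f => [|k IHk] f /=; first by move=> cf x /U'U; exact: cf.
by move=> [df Df]; split=> [x /U'U|v]; [exact: df | exact: IHk].
Qed.

Lemma Ck_eq (V W : normedModType R) k (U : set V) (f g : V -> W) :
  open U -> (forall x, U x -> f x = g x) -> Ck_on k U f -> Ck_on k U g.
Proof.
move=> oU; elim: k f g => [|k IHk] f g fg /=.
  move=> cf x Ux; have fgx : {near x, f =1 g}.
    by apply: filterS (open_nbhs_nbhs (conj oU Ux)); exact: fg.
  have cfx : f @ x --> g x by rewrite -fg //; exact: cf.
  by apply: cvg_trans cfx; exact: near_eq_cvg.
move=> [df Df]; split=> [x Ux|v].
  have fgx : {near x, f =1 g}.
    by apply: filterS (open_nbhs_nbhs (conj oU Ux)); exact: fg.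
  by have [] := near_eq_diff fgx (df x Ux).
apply: IHk (Df v) => x Ux; apply: near_eq_derive.
by apply: filterS (open_nbhs_nbhs (conj oU Ux)); exact: fg.
Qed.

Lemma Ck_local (V W : normedModType R) k (U : set V) (f : V -> W) :
  (forall x, U x -> exists2 U', U' x & Ck_on k U' f) -> Ck_on k U f.
Proof.
elim: k f => [|k IHk] f Uf /=; first by move=> x /Uf[U' U'x]; apply.
split=> [x /Uf[U' U'x [df _]]|v]; first exact: df.
by apply: IHk => x /Uf[U' U'x [_ Df]]; exists U' => //; exact: Df.
Qed.

Lemma Ck_cst (V W : normedModType R) k (U : set V) (a : W) :
  Ck_on k U (fun=> a : W).
Proof.
elim: k a => [|k IHk] a /=; first by move=> x _; exact: cvg_cst.
split=> [x _|v]; first exact: differentiable_cst.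
by rewrite (_ : 'D_v _ = fun=> 0) //; apply/funext => x; exact: derive_cst.
Qed.

Lemma Ck_add (V W : normedModType R) k (U : set V) (f g : V -> W) :
  open U -> Ck_on k U f -> Ck_on k U g -> Ck_on k U (fun x => f x + g x).
Proof.
move=> oU; elim: k f g => [|k IHk] f g /=.
  by move=> cf cg x Ux; apply: cvgD; [exact: cf | exact: cg].
move=> [df Df] [dg Dg]; split=> [x Ux|v].
  by apply: differentiableD; [exact: df | exact: dg].
apply: (Ck_eq oU _ (IHk _ _ (Df v) (Dg v))) => x Ux.
by rewrite deriveD //; apply: diff_derivable; [exact: df | exact: dg].
Qed.

Lemma Ck_mul (V : normedModType R) k (U : set V) (f g : V -> R) :
  open U -> Ck_on k U f -> Ck_on k U g -> Ck_on k U (fun x => f x * g x).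
Proof.
move=> oU; elim: k f g => [|k IHk] f g.
  by move=> cf cg x Ux; apply: cvgM; [exact: cf | exact: cg].
move=> Cf Cg; have [Cf' Cg'] := (Ck_le Cf, Ck_le Cg).
move: Cf Cg => [df Df] [dg Dg]; split=> [x Ux|v].
  by apply: differentiableM; [exact: df | exact: dg].
have H := Ck_add oU (IHk _ _ Cf' (Dg v)) (IHk _ _ Cg' (Df v)).
apply: (Ck_eq oU _ H) => x Ux.
by rewrite deriveM //; apply: diff_derivable; [exact: df | exact: dg].
Qed.

Lemma Ck_opp (V : normedModType R) k (U : set V) (f : V -> R) :
  open U -> Ck_on k U f -> Ck_on k U (fun x => - f x).
Proof.
move=> oU Cf; have C1 : Ck_on k U ((fun=> -1) : V -> R) by exact: Ck_cst.
have := Ck_mul oU C1 Cf; by under [X in Ck_on k U X]eq_fun do rewrite mulN1r.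
Qed.

Lemma Ck_inv (V : normedModType R) k (U : set V) (f : V -> R) :
  open U -> (forall x, U x -> f x != 0) -> Ck_on k U f -> Ck_on k U (fun x => (f x)^-1).
Proof.
move=> oU f0; elim: k => [|k IHk].
  by move=> cf x Ux; apply: cvgV; [exact: f0 | exact: cf].
move=> Cf; have Ci := IHk (Ck_le Cf).
move: Cf => [df Df]; split=> [x Ux|v].
  by apply: differentiableV; [exact: df | exact: f0].
have H := Ck_opp oU (Ck_mul oU (Ck_mul oU Ci Ci) (Df v)).
apply: (Ck_eq oU _ H) => x Ux.
rewrite deriveV ?f0 //; last by apply: diff_derivable; exact: df.
by rewrite scaleNr -[RHS]/(- (f x ^- 2 * _)) expr2 invfM.
Qed.

Lemma Ck_sqrt (V : normedModType R) k (U : set V) (f : V -> R) :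
  open U -> (forall x, U x -> 0 < f x) -> Ck_on k U f ->
  Ck_on k U (fun x => Num.sqrt (f x)).
Proof.
move=> oU f0; elim: k => [|k IHk].
  by move=> cf x Ux; apply: continuous_comp; [exact: cf | exact: sqrt_continuous].
move=> Cf; have Cs := IHk (Ck_le Cf).
have ds (y : R) : 0 < y -> differentiable (@Num.sqrt R) y.
  by move=> y0; apply/derivable1_diffP; have [] := is_derive1_sqrt y0.
move: Cf => [df Df]; split=> [x Ux|v].
  by apply: differentiable_comp; [exact: df | apply: ds; exact: f0].
have C2 : Ck_on k U (fun x => (2 * Num.sqrt (f x))^-1).
  apply: Ck_inv => // [x Ux|]; last by apply: Ck_mul => //; exact: Ck_cst.
  by rewrite mulf_neq0 // ?pnatr_eq0 // sqrtr_eq0 -ltNge f0.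
apply: (Ck_eq oU _ (Ck_mul oU C2 (Df v))) => x Ux.
have dfx := df x Ux; have dsx := ds _ (f0 x Ux).
have [_ sE] := is_derive1_sqrt (f0 x Ux).
have dcx : differentiable (Num.sqrt \o f) x by exact: differentiable_comp.
rewrite -[RHS]/('D_v (Num.sqrt \o f) x) (deriveE v dcx) (diff_comp dfx dsx).
rewrite (deriveE v dfx) -sE (deriveE (1 : R) dsx) /=; set w := 'd f x v.
have -> : 'd Num.sqrt (f x) w = w *: 'd Num.sqrt (f x) (1 : R).
  by rewrite -linearZ; congr ('d _ _ _); rewrite -[RHS]/(w * 1) mulr1.
by rewrite mulrC.
Qed.

Lemma Ck_coord (V : normedModType R) n k (U : set V) (f : V -> 'rV[R]_n) j :
  open U -> Ck_on k U f -> Ck_on k U (fun x => f x 0 j).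
Proof.
move=> oU; elim: k f => [|k IHk] f.
  move=> cf x Ux; have cfx : f @ x --> f x := cf x Ux.
  exact: (cvg_comp _ _ cfx (@coord_continuous R 1 n 0 j (f x))).
move=> [df Df]; split=> [x Ux|v].
  exact: (differentiable_comp (df x Ux) (@differentiable_coord R 1 n (f x) 0 j)).
apply: (Ck_eq oU _ (IHk _ (Df v))) => x Ux.
by rewrite derive_mx ?mxE //; apply: diff_derivable; exact: df.
Qed.

Lemma diff_slice (V V' W : normedModType R) (f : V * V' -> W) (x : V) (y : V') :
  differentiable f (x, y) ->
  [/\ differentiable (fun z => f (z, y)) x,
      forall v, 'D_v (fun z => f (z, y)) x = 'D_(v, 0) f (x, y),
      differentiable (fun z => f (x, z)) y &
      forall v, 'D_v (fun z => f (x, z)) y = 'D_(0, v) f (x, y)].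
Proof.
move=> df.
have d1 : differentiable (fun z : V => (z, y)) x.
  by apply: differentiable_pair; [exact: ex_diff | exact: differentiable_cst].
have d2 : differentiable (fun z : V' => (x, z)) y.
  by apply: differentiable_pair; [exact: differentiable_cst | exact: ex_diff].
have df1 : differentiable (f \o (fun z : V => (z, y))) x by exact: differentiable_comp.
have df2 : differentiable (f \o (fun z : V' => (x, z))) y by exact: differentiable_comp.
split.
- exact: df1.
- move=> v; rewrite -[LHS]/('D_v (f \o (fun z : V => (z, y))) x) (deriveE v df1).
  rewrite (diff_comp d1 df) (deriveE (v, 0) df) /=; congr ('d _ _ _).
  have /(congr1 (@^~ v)) -> :=
    diff_pair (@ex_diff _ _ _ _ _ _ _ (is_diff_id x)) (differentiable_cst y x).
  by rewrite diff_cst (@diff_val _ _ _ _ _ _ _ (is_diff_id x)).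
- exact: df2.
move=> v; rewrite -[LHS]/('D_v (f \o (fun z : V' => (x, z))) y) (deriveE v df2).
rewrite (diff_comp d2 df) (deriveE (0, v) df) /=; congr ('d _ _ _).
have /(congr1 (@^~ v)) -> :=
  diff_pair (differentiable_cst x y) (@ex_diff _ _ _ _ _ _ _ (is_diff_id y)).
by rewrite diff_cst (@diff_val _ _ _ _ _ _ _ (is_diff_id y)).
Qed.

Lemma Ck_slice (V V' W : normedModType R) k (Om : set (V * V')) (f : V * V' -> W) (y : V') :
  open [set x | Om (x, y)] -> Ck_on k Om f -> Ck_on k [set x | Om (x, y)] (fun x => f (x, y)).
Proof.
move=> oU; elim: k f => [|k IHk] f.
  move=> cf x Ux; have cfx : f @ (x, y) --> f (x, y) := cf _ Ux.
  apply: (cvg_comp _ _ _ cfx) => P [[A B] /= [Ax By] AB].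
  apply: filterS Ax => z Az; apply: (AB (z, y)).
  by split=> //=; exact: nbhs_singleton By.
move=> [df Df]; split=> [x Ux|v]; first by have [] := diff_slice (df _ Ux).
apply: (Ck_eq oU _ (IHk _ (Df (v, 0)))) => x Ux.
by have [_ -> _ _] := diff_slice (df _ Ux).
Qed.

Lemma Ck_slicer (V V' W : normedModType R) k (Om : set (V * V')) (f : V * V' -> W) (x : V) :
  open [set y | Om (x, y)] -> Ck_on k Om f -> Ck_on k [set y | Om (x, y)] (fun y => f (x, y)).
Proof.
move=> oU; elim: k f => [|k IHk] f.
  move=> cf y Uy; have cfx : f @ (x, y) --> f (x, y) := cf _ Uy.
  apply: (cvg_comp _ _ _ cfx) => P [[A B] /= [Ax By] AB].
  apply: filterS By => z Bz; apply: (AB (x, z)).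
  by split=> //=; exact: nbhs_singleton Ax.
move=> [df Df]; split=> [y Uy|v]; first by have [] := diff_slice (df _ Uy).
apply: (Ck_eq oU _ (IHk _ (Df (0, v)))) => y Uy.
by have [_ _ _ ->] := diff_slice (df _ Uy).
Qed.

End SmoothFunctions.

(* Common closure properties of the continuous and of the smooth functions on an
   open set U. *)
Record function_algebra (R : realType) (X : Type) (U : set X) (C : (X -> R) -> Prop) : Prop := {
  fun_alg_eq : forall f g, (forall x, U x -> f x = g x) -> C f -> C g;
  fun_alg_cst : forall a, C (fun=> a);
  fun_alg_add : forall f g, C f -> C g -> C (fun x => f x + g x);
  fun_alg_mul : forall f g, C f -> C g -> C (fun x => f x * g x);
  fun_alg_inv : forall f, (forall x, U x -> f x != 0) -> C f -> C (fun x => (f x)^-1);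
  fun_alg_sqrt : forall f, (forall x, U x -> 0 < f x) -> C f -> C (fun x => Num.sqrt (f x)) }.

Lemma smooth_function_algebra (R : realType) (V : normedModType R) (U : set V) :
  open U -> function_algebra U (fun f : V -> R => smooth_on U f).
Proof.
move=> oU; split.
- by move=> f g fg Cf k; exact: Ck_eq (Cf k).
- by move=> a k; exact: Ck_cst.
- by move=> f g Cf Cg k; exact: Ck_add.
- by move=> f g Cf Cg k; exact: Ck_mul.
- by move=> f f0 Cf k; exact: Ck_inv.
- by move=> f f0 Cf k; exact: Ck_sqrt.
Qed.

Lemma continuous_function_algebra (R : realType) (X : topologicalType) (U : set X) :
  open U -> function_algebra U (fun f : X -> R => forall x, U x -> f @ x --> f x).
Proof.
move=> oU; split.
- move=> f g fg Cf x Ux; rewrite -fg //; apply: cvg_trans (Cf x Ux).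
  by apply: near_eq_cvg; apply: filterS (open_nbhs_nbhs (conj oU Ux)); exact: fg.
- by move=> a x _; exact: cvg_cst.
- by move=> f g Cf Cg x Ux; apply: cvgD; [exact: Cf | exact: Cg].
- by move=> f g Cf Cg x Ux; apply: cvgM; [exact: Cf | exact: Cg].
- by move=> f f0 Cf x Ux; apply: cvgV; [exact: f0 | exact: Cf].
- move=> f f0 Cf x Ux; exact: (cvg_comp _ _ (Cf x Ux) (@sqrt_continuous R (f x))).
Qed.

Section MatrixFunctions.
Context (R : realType) (X : Type) (U : set X) (C : (X -> R) -> Prop).
Hypothesis CA : function_algebra U C.

Definition mx_fun m n (F : X -> 'M[R]_(m, n)) := forall i j, C (fun x => F x i j).

Lemma mx_fun_eq m n (F F' : X -> 'M[R]_(m, n)) :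
  (forall x, U x -> F x = F' x) -> mx_fun F -> mx_fun F'.
Proof. by move=> FF' CF i j; apply: (fun_alg_eq CA _ (CF i j)) => x /FF'->. Qed.

Lemma fun_alg_sum (I : Type) (r : seq I) (f : I -> X -> R) :
  (forall i, C (f i)) -> C (fun x => \sum_(i <- r) f i x).
Proof.
move=> Cf; elim: r => [|i r IHr].
  by under eq_fun do rewrite big_nil; exact: (fun_alg_cst CA).
by under eq_fun do rewrite big_cons; exact: (fun_alg_add CA).
Qed.

Lemma fun_alg_prod (I : Type) (r : seq I) (f : I -> X -> R) :
  (forall i, C (f i)) -> C (fun x => \prod_(i <- r) f i x).
Proof.
move=> Cf; elim: r => [|i r IHr].
  by under eq_fun do rewrite big_nil; exact: (fun_alg_cst CA).
by under eq_fun do rewrite big_cons; exact: (fun_alg_mul CA).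
Qed.

Lemma mx_fun_cst m n (A : 'M[R]_(m, n)) : mx_fun (fun=> A).
Proof. by move=> i j; exact: (fun_alg_cst CA). Qed.

Lemma mx_fun_add m n (F H : X -> 'M[R]_(m, n)) :
  mx_fun F -> mx_fun H -> mx_fun (fun x => F x + H x).
Proof.
move=> CF CH i j; under eq_fun do rewrite mxE.
by apply: (fun_alg_add CA); [exact: CF | exact: CH].
Qed.

Lemma mx_fun_scale m n (f : X -> R) (F : X -> 'M[R]_(m, n)) :
  C f -> mx_fun F -> mx_fun (fun x => f x *: F x).
Proof.
move=> Cf CF i j; under eq_fun do rewrite mxE.
by apply: (fun_alg_mul CA); [exact: Cf | exact: CF].
Qed.

Lemma mx_fun_scale_cst m n a (F : X -> 'M[R]_(m, n)) :
  mx_fun F -> mx_fun (fun x => a *: F x).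
Proof. by apply: mx_fun_scale; exact: (fun_alg_cst CA). Qed.

Lemma mx_fun_sub m n (F H : X -> 'M[R]_(m, n)) :
  mx_fun F -> mx_fun H -> mx_fun (fun x => F x - H x).
Proof.
move=> CF CH; apply: mx_fun_add => //.
by under eq_fun do rewrite -scaleN1r; exact: mx_fun_scale_cst.
Qed.

Lemma mx_fun_tr m n (F : X -> 'M[R]_(m, n)) : mx_fun F -> mx_fun (fun x => (F x)^T).
Proof. by move=> CF i j; under eq_fun do rewrite mxE. Qed.

Lemma mx_fun_mul m n p (F : X -> 'M[R]_(m, n)) (H : X -> 'M[R]_(n, p)) :
  mx_fun F -> mx_fun H -> mx_fun (fun x => F x *m H x).
Proof.
move=> CF CH i j; under eq_fun do rewrite mxE.
by apply: fun_alg_sum => h; apply: (fun_alg_mul CA); [exact: CF | exact: CH].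
Qed.

Lemma mx_fun_sum m n (I : Type) (r : seq I) (F : I -> X -> 'M[R]_(m, n)) :
  (forall i, mx_fun (F i)) -> mx_fun (fun x => \sum_(i <- r) F i x).
Proof.
move=> CF i j; under eq_fun do rewrite summxE.
by apply: fun_alg_sum => h; exact: CF.
Qed.

Lemma mx_fun_exp n (F : X -> 'M[R]_(n.+1)) k : mx_fun F -> mx_fun (fun x => F x ^+ k).
Proof.
move=> CF; elim: k => [|k IHk]; first exact: mx_fun_cst.
by under eq_fun do rewrite exprS; exact: mx_fun_mul.
Qed.

Lemma mx_fun_det n (F : X -> 'M[R]_n) : mx_fun F -> C (fun x => \det (F x)).
Proof.
move=> CF; apply: fun_alg_sum => s; apply: (fun_alg_mul CA); first exact: (fun_alg_cst CA).
by apply: fun_alg_prod => i; exact: CF.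
Qed.

Lemma mx_fun_inv n (F : X -> 'M[R]_n) :
  (forall x, U x -> F x \in unitmx) -> mx_fun F -> mx_fun (fun x => invmx (F x)).
Proof.
move=> Fu CF; apply: (@mx_fun_eq _ _ (fun x => (\det (F x))^-1 *: \adj (F x))).
  by move=> x Ux; rewrite /invmx Fu.
apply: mx_fun_scale.
  apply: (fun_alg_inv CA); last exact: mx_fun_det.
  by move=> x /Fu; rewrite unitmxE unitfE.
move=> i j; under eq_fun do rewrite mxE.
apply: (fun_alg_mul CA); first exact: (fun_alg_cst CA).
apply: mx_fun_det => a b; under eq_fun do rewrite !mxE.
exact: CF.
Qed.

End MatrixFunctions.

(** * Translations and the adjoint action in charts *)

Section Jacobians.
Context (R : realType).

Lemma jacobianE m n (f : 'rV[R]_m -> 'rV[R]_n) x u :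
  u *m 'J f x = 'd f x u.
Proof. by rewrite /jacobian mul_rV_lin1. Qed.

Lemma jacobian_entry m n (f : 'rV[R]_m -> 'rV[R]_n) x i j :
  'J f x i j = ('d f x (delta_mx 0 i)) 0 j.
Proof. exact: mxE. Qed.

Lemma jacobian_near m n (f g : 'rV[R]_m -> 'rV[R]_n) x :
  (\forall y \near x, f y = g y) -> differentiable f x -> 'J f x = 'J g x.
Proof.
move=> fg df; have [_ dE] := near_eq_diff fg df.
apply/matrixP => i j; rewrite [LHS]jacobian_entry [RHS]jacobian_entry.
exact: esym (congr1 (fun h : _ -> 'rV[R]_n => h (delta_mx 0 i) 0 j) dE).
Qed.

Lemma jacobian_comp m n p (f : 'rV[R]_m -> 'rV[R]_n) (g : 'rV[R]_n -> 'rV[R]_p) x :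
  differentiable f x -> differentiable g (f x) ->
  'J (g \o f) x = 'J f x *m 'J g (f x).
Proof.
move=> df dg; apply/matrixP => i j; rewrite [LHS]jacobian_entry.
transitivity (('d f x (delta_mx 0 i) *m 'J g (f x)) 0 j).
  rewrite [_ *m _]jacobianE.
  exact: (congr1 (fun h : _ -> 'rV[R]_p => h (delta_mx 0 i) 0 j) (diff_comp df dg)).
by rewrite -jacobianE -mulmxA -rowE mxE.
Qed.

Lemma jacobian_id m (x : 'rV[R]_m) : 'J (id : 'rV[R]_m -> 'rV[R]_m) x = 1%:M.
Proof.
apply/matrixP => i j; rewrite [LHS]jacobian_entry.
transitivity ((delta_mx 0 i : 'rV[R]_m) 0 j); last by rewrite !mxE eqxx eq_sym.
exact: (congr1 (fun h : _ -> 'rV[R]_m => h (delta_mx 0 i) 0 j)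
  (@diff_val _ _ _ _ _ _ _ (is_diff_id x))).
Qed.

Lemma jacobian_derive m n (f : 'rV[R]_m -> 'rV[R]_n) x i j : differentiable f x ->
  'J f x i j = ('D_(delta_mx 0 i) f x) 0 j.
Proof. by move=> df; rewrite (deriveE _ df) [LHS]jacobian_entry. Qed.

End Jacobians.

Section Tangent.
Context (R : realType) (n : nat) (G : lieGroupType R n).
Implicit Types (p q g h : G) (f : G -> G).

Lemma chart_codP p x : chart_cod (chart_at p) x ->
  chart_dom (chart_at p) (chart_inv (chart_at p) x) /\
  chart_at p (chart_inv (chart_at p) x) = x.
Proof.
by have [_ _ cK _ _] := chart_atP p; case=> q dq <-; rewrite cK.
Qed.

Lemma chart_invK p q : chart_dom (chart_at p) q ->
  chart_inv (chart_at p) (chart_at p q) = q.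
Proof. by have [_ _ cK _ _] := chart_atP p; exact: cK. Qed.

Lemma chart_center p : chart_inv (chart_at p) (chart_at p p) = p.
Proof. by apply: chart_invK; exact: mem_chart_at. Qed.

Lemma chart_cod_center p : chart_cod (chart_at p) (chart_at p p).
Proof. by exists p => //; exact: mem_chart_at. Qed.

Lemma chart_cod_open p : open (chart_cod (chart_at p)).
Proof. by have [] := chart_atP p. Qed.

Lemma chart_dom_open p : open (chart_dom (chart_at p)).
Proof. by have [] := chart_atP p. Qed.

Lemma chart_cvg p q : chart_dom (chart_at p) q -> chart_at p @ q --> chart_at p q.
Proof. by have [_ _ _ cc _] := chart_atP p => /cc. Qed.

Lemma chart_inv_cvg p x : chart_cod (chart_at p) x ->
  chart_inv (chart_at p) @ x --> chart_inv (chart_at p) x.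
Proof. by have [_ _ _ _ ci] := chart_atP p => /ci. Qed.

Definition dmap f p := f @ p --> f p /\
  differentiable (chart_at (f p) \o f \o chart_inv (chart_at p)) (chart_at p p).

Lemma dmap_comp (f g : G -> G) p : dmap f p -> dmap g (f p) ->
  dmap (g \o f) p /\ tangent_mx (g \o f) p = tangent_mx f p *m tangent_mx g (f p).
Proof.
move=> [cf df] [cg dg]; pose F := chart_at (f p) \o f \o chart_inv (chart_at p).
pose H := chart_at (g (f p)) \o g \o chart_inv (chart_at (f p)).
have Fp : F (chart_at p p) = chart_at (f p) (f p) by rewrite /F /= chart_center.
have HF : \forall y \near chart_at p p,
    (H \o F) y = (chart_at (g (f p)) \o (g \o f) \o chart_inv (chart_at p)) y.
  have ci := chart_inv_cvg (chart_cod_center p); rewrite chart_center in ci.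
  have : \forall y \near chart_at p p, chart_dom (chart_at (f p)) (f (chart_inv (chart_at p) y)).
    apply: (cvg_comp _ _ ci cf); apply: open_nbhs_nbhs.
    by split; [exact: chart_dom_open | exact: mem_chart_at].
  by apply: filterS => y dy; rewrite /H /F /= chart_invK.
have dH : differentiable H (F (chart_at p p)) by rewrite Fp.
have dHF : differentiable (H \o F) (chart_at p p) := differentiable_comp df dH.
split; first split; first exact: (cvg_comp _ _ cf cg).
  by have [] := near_eq_diff HF dHF.
have E : 'J (H \o F) (chart_at p p) = 'J F (chart_at p p) *m 'J H (F (chart_at p p)).
  exact: jacobian_comp df dH.
rewrite Fp in E.
exact: etrans (esym (jacobian_near HF dHF)) E.
Qed.

Lemma dmap_id p : dmap id p /\ tangent_mx (fun a : G => a) p = 1%:M.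
Proof.
have E : \forall y \near chart_at p p,
    y = (chart_at p \o id \o chart_inv (chart_at p)) y.
  have := open_nbhs_nbhs (conj (@chart_cod_open p) (chart_cod_center p)).
  by apply: filterS => y /chart_codP[_ /= ->].
have did : differentiable (id : 'rV[R]_n -> 'rV[R]_n) (chart_at p p) by exact: ex_diff.
split; first by split; [exact: cvg_id | have [] := near_eq_diff E did].
exact: etrans (esym (jacobian_near E did)) (jacobian_id _).
Qed.

Definition mul_chart (a b c : G) (x : 'rV[R]_n * 'rV[R]_n) : 'rV[R]_n :=
  chart_at c (chart_inv (chart_at a) x.1 * chart_inv (chart_at b) x.2)%g.

Definition mul_chart_dom (a b c : G) : set ('rV[R]_n * 'rV[R]_n) :=
  [set x | [/\ chart_cod (chart_at a) x.1, chart_cod (chart_at b) x.2 &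
             chart_dom (chart_at c)
               (chart_inv (chart_at a) x.1 * chart_inv (chart_at b) x.2)%g]].

Lemma mul_chart_smooth (a b c : G) : smooth_on (mul_chart_dom a b c) (mul_chart a b c).
Proof. exact: mulg_smooth. Qed.

Lemma mul_chart_diff (a b c : G) x : mul_chart_dom a b c x ->
  differentiable (mul_chart a b c) x.
Proof. by move=> Ox; have [+ _] := @mul_chart_smooth a b c 1%N; apply. Qed.

Definition lmul h : G -> G := fun a => (h * a)%g.
Definition rmul h : G -> G := fun a => (a * h)%g.

Lemma dmap_lmul h g : dmap (lmul h) g.
Proof.
split; first by apply: mulg_cvg; [exact: cvg_cst | exact: cvg_id].
have Om : mul_chart_dom h g (h * g)%g (chart_at h h, chart_at g g).
  split=> /=; try exact: chart_cod_center.
  by rewrite !chart_center; exact: mem_chart_at.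
have [_ _ d _] := diff_slice (mul_chart_diff Om).
rewrite (_ : _ \o chart_inv _ = fun y => mul_chart h g (h * g)%g (chart_at h h, y)) //.
by apply/funext => y; rewrite /mul_chart /= chart_center.
Qed.

Lemma dmap_rmul h g : dmap (rmul h) g.
Proof.
split; first by apply: mulg_cvg; [exact: cvg_id | exact: cvg_cst].
have Om : mul_chart_dom g h (g * h)%g (chart_at g g, chart_at h h).
  split=> /=; try exact: chart_cod_center.
  by rewrite !chart_center; exact: mem_chart_at.
have [d _ _ _] := diff_slice (mul_chart_diff Om).
rewrite (_ : _ \o chart_inv _ = fun y => mul_chart g h (g * h)%g (y, chart_at h h)) //.
by apply/funext => y; rewrite /mul_chart /= chart_center.
Qed.

Lemma dmap_conj h g : dmap (conj_by h) g /\
  tangent_mx (conj_by h) g = tangent_mx (lmul h) g *m tangent_mx (rmul h^-1)%g (h * g)%g.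
Proof. exact: dmap_comp (dmap_lmul h g) (dmap_rmul h^-1 (h * g))%g. Qed.

Lemma tangent_lmulV g : tangent_mx (lmul g) 1%g *m thetaL g = 1%:M.
Proof.
have [_ E] := dmap_comp (dmap_lmul g 1%g) (dmap_lmul g^-1 (g * 1))%g.
have [_ <-] := dmap_id (1%g : G).
have -> : thetaL g = tangent_mx (lmul g^-1)%g (g * 1)%g by rewrite mulg1.
by rewrite -E; congr tangent_mx; apply/funext => a; rewrite /lmul /= mulKg.
Qed.

Lemma tangent_rmulV g : tangent_mx (rmul g) 1%g *m tangent_mx (rmul g^-1)%g g = 1%:M.
Proof.
have [_ E] := dmap_comp (dmap_rmul g 1%g) (dmap_rmul g^-1 (1 * g))%g.
have [_ <-] := dmap_id (1%g : G).
have -> : tangent_mx (rmul g^-1)%g g = tangent_mx (rmul g^-1)%g (1 * g)%g by rewrite mul1g.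
by rewrite -E; congr tangent_mx; apply/funext => a; rewrite /rmul /= mulgK.
Qed.

Lemma AdE g : Ad g = tangent_mx (lmul g) 1%g *m tangent_mx (rmul g^-1)%g g.
Proof. by rewrite /Ad (dmap_conj g 1%g).2 mulg1. Qed.

Lemma conj_by1 h : conj_by h (1%g : G) = 1%g.
Proof. by rewrite /conj_by mulg1 mulgV. Qed.

Lemma AdM g h : Ad (g * h)%g = Ad h *m Ad g.
Proof.
have [] := dmap_comp (dmap_conj h 1%g).1 (dmap_conj g (conj_by h 1%g)).1.
rewrite conj_by1 => _ <-; congr tangent_mx; apply/funext => a.
by rewrite /conj_by /= invgM !mulgA.
Qed.

Lemma Ad1 : Ad (1%g : G) = 1%:M.
Proof.
have [_ <-] := dmap_id (1%g : G); congr tangent_mx; apply/funext => a.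
by rewrite /conj_by mul1g invg1 mulg1.
Qed.

Lemma AdV g : Ad (g^-1)%g *m Ad g = 1%:M.
Proof. by rewrite -AdM mulgV Ad1. Qed.

Lemma Ad_unit g : Ad g \in unitmx.
Proof. exact: (mulmx1_unit (AdV g)).2. Qed.

Lemma thetaL_conj h g :
  tangent_mx (conj_by h) g *m thetaL (conj_by h g) = thetaL g *m Ad h.
Proof.
have [_ E] := dmap_comp (dmap_conj h g).1 (dmap_lmul (conj_by h g)^-1%g (conj_by h g)).
have [_ E'] := dmap_comp (dmap_lmul g^-1%g g) (dmap_conj h (lmul g^-1%g g)).1.
have e : lmul g^-1%g g = 1%g := mulVg g.
rewrite e in E'.
have fE : lmul (conj_by h g)^-1%g \o conj_by h = conj_by h \o lmul g^-1%g.
  by apply/funext => a; rewrite /conj_by /lmul /= !invgM invgK !mulgA mulgVK.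
exact: etrans (esym E) (etrans (congr1 (fun f => tangent_mx f g) fE) E').
Qed.

(* The differentials at the identity of left and right translation by the point
   of coordinates x, with values in the chart at p. *)
Definition left_frame p (x : 'rV[R]_n) : 'M[R]_n :=
  'J (fun y => mul_chart p 1%g p (x, y)) (chart_at 1%g (1%g : G)).

Definition right_frame p (x : 'rV[R]_n) : 'M[R]_n :=
  'J (fun y => mul_chart 1%g p p (y, x)) (chart_at 1%g (1%g : G)).

Lemma mul_chart_dom_left p x : chart_cod (chart_at p) x ->
  mul_chart_dom p 1%g p (x, chart_at 1%g (1%g : G)).
Proof.
move=> cx; split=> //=; first exact: chart_cod_center.
by rewrite chart_center mulg1; exact: (chart_codP cx).1.
Qed.

Lemma mul_chart_dom_right p x : chart_cod (chart_at p) x ->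
  mul_chart_dom 1%g p p (chart_at 1%g (1%g : G), x).
Proof.
move=> cx; split=> //=; first exact: chart_cod_center.
by rewrite chart_center mul1g; exact: (chart_codP cx).1.
Qed.

Lemma chart_change_diff p q x : chart_cod (chart_at p) x ->
  chart_dom (chart_at q) (chart_inv (chart_at p) x) ->
  differentiable (chart_at q \o chart_inv (chart_at p)) x.
Proof. by move=> cx dq; have [+ _] := chart_at_compat p q 1%N; apply. Qed.

Lemma left_frameE p x : chart_cod (chart_at p) x ->
  left_frame p x *m chart_frame (chart_at p) x =
  tangent_mx (lmul (chart_inv (chart_at p) x)) 1%g.
Proof.
move=> cx; set g := chart_inv (chart_at p) x; set y1 := chart_at 1%g (1%g : G).
have Om := mul_chart_dom_left cx.
have [_ _ dm _] := diff_slice (mul_chart_diff Om).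
have mE : mul_chart p 1%g p (x, y1) = x.
  by rewrite /mul_chart /= chart_center mulg1 (chart_codP cx).2.
have dc : differentiable (chart_at g \o chart_inv (chart_at p)) (mul_chart p 1%g p (x, y1)).
  by rewrite mE; apply: chart_change_diff => //; exact: mem_chart_at.
have J := jacobian_comp dm dc; rewrite mE in J.
transitivity ('J ((chart_at g \o chart_inv (chart_at p)) \o
    (fun y => mul_chart p 1%g p (x, y))) y1); first exact: esym J.
have E : \forall y \near y1, ((chart_at g \o chart_inv (chart_at p)) \o
      (fun y => mul_chart p 1%g p (x, y))) y =
    (chart_at (lmul g 1%g) \o lmul g \o chart_inv (chart_at 1%g)) y.
  have cg : (fun y => g * chart_inv (chart_at 1%g) y)%g @ y1 --> (g * 1)%g.
    have := chart_inv_cvg (chart_cod_center (1%g : G)); rewrite chart_center => ci.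
    have cst : (fun _ : 'rV[R]_n => g) @ y1 --> g.
      by apply: cvg_cst; exact: (nbhs_filter y1).
    exact: mulg_cvg cst ci.
  have : \forall y \near y1, chart_dom (chart_at p) (g * chart_inv (chart_at 1%g) y)%g.
    apply: cg; apply: open_nbhs_nbhs; split; first exact: chart_dom_open.
    by rewrite mulg1; exact: (chart_codP cx).1.
  by apply: filterS => y dy; rewrite /mul_chart /= chart_invK // /lmul mulg1.
exact: jacobian_near E (differentiable_comp dm dc).
Qed.

Lemma right_frameE p x : chart_cod (chart_at p) x ->
  right_frame p x *m chart_frame (chart_at p) x =
  tangent_mx (rmul (chart_inv (chart_at p) x)) 1%g.
Proof.
move=> cx; set g := chart_inv (chart_at p) x; set y1 := chart_at 1%g (1%g : G).
have Om := mul_chart_dom_right cx.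
have [dm _ _ _] := diff_slice (mul_chart_diff Om).
have mE : mul_chart 1%g p p (y1, x) = x.
  by rewrite /mul_chart /= chart_center mul1g (chart_codP cx).2.
have dc : differentiable (chart_at g \o chart_inv (chart_at p)) (mul_chart 1%g p p (y1, x)).
  by rewrite mE; apply: chart_change_diff => //; exact: mem_chart_at.
have J := jacobian_comp dm dc; rewrite mE in J.
transitivity ('J ((chart_at g \o chart_inv (chart_at p)) \o
    (fun y => mul_chart 1%g p p (y, x))) y1); first exact: esym J.
have E : \forall y \near y1, ((chart_at g \o chart_inv (chart_at p)) \o
      (fun y => mul_chart 1%g p p (y, x))) y =
    (chart_at (rmul g 1%g) \o rmul g \o chart_inv (chart_at 1%g)) y.
  have cg : (fun y => chart_inv (chart_at 1%g) y * g)%g @ y1 --> (1 * g)%g.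
    have := chart_inv_cvg (chart_cod_center (1%g : G)); rewrite chart_center => ci.
    have cst : (fun _ : 'rV[R]_n => g) @ y1 --> g.
      by apply: cvg_cst; exact: (nbhs_filter y1).
    exact: mulg_cvg ci cst.
  have : \forall y \near y1, chart_dom (chart_at p) (chart_inv (chart_at 1%g) y * g)%g.
    apply: cg; apply: open_nbhs_nbhs; split; first exact: chart_dom_open.
    by rewrite mul1g; exact: (chart_codP cx).1.
  by apply: filterS => y dy; rewrite /mul_chart /= chart_invK // /rmul mul1g.
exact: jacobian_near E (differentiable_comp dm dc).
Qed.

Lemma left_frame_unit p x : chart_cod (chart_at p) x -> left_frame p x \in unitmx /\
  chart_frame (chart_at p) x *m thetaL (chart_inv (chart_at p) x) = invmx (left_frame p x).
Proof.
move=> cx; have := tangent_lmulV (chart_inv (chart_at p) x).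
rewrite -left_frameE // -mulmxA => /[dup] /mulmx1_unit[Lu _] E; split=> //.
by rewrite -[LHS](mulKmx Lu) E mulmx1.
Qed.

Lemma right_frame_unit p x : chart_cod (chart_at p) x -> right_frame p x \in unitmx /\
  Ad (chart_inv (chart_at p) x) = left_frame p x *m invmx (right_frame p x).
Proof.
move=> cx; have := tangent_rmulV (chart_inv (chart_at p) x).
rewrite -right_frameE // -mulmxA => /[dup] /mulmx1_unit[Ru _] E; split=> //.
by rewrite AdE -left_frameE // -mulmxA; congr (_ *m _); rewrite -[LHS](mulKmx Ru) E mulmx1.
Qed.

Lemma left_frame_smooth p i j :
  smooth_on (chart_cod (chart_at p)) (fun x => left_frame p x i j).
Proof.
have oU := @chart_cod_open p; pose y1 := chart_at 1%g (1%g : G).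
have UE : [set x | mul_chart_dom p 1%g p (x, y1)] = chart_cod (chart_at p).
  by apply/seteqP; split=> x /=; [case | exact: mul_chart_dom_left].
move=> k; have [_ /(_ (0, delta_mx 0 i)) Dm] := @mul_chart_smooth p 1%g p k.+1.
have oU' : open [set x | mul_chart_dom p 1%g p (x, y1)] by rewrite UE.
have S := @Ck_slice R _ _ _ k _ _ y1 oU' Dm; rewrite UE in S.
apply: (Ck_eq oU _ (Ck_coord j oU S)) => x cx.
have [_ _ dm dmE] := diff_slice (mul_chart_diff (mul_chart_dom_left cx)).
by rewrite (jacobian_derive _ _ dm) dmE.
Qed.

Lemma right_frame_smooth p i j :
  smooth_on (chart_cod (chart_at p)) (fun x => right_frame p x i j).
Proof.
have oU := @chart_cod_open p; pose y1 := chart_at 1%g (1%g : G).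
have UE : [set x | mul_chart_dom 1%g p p (y1, x)] = chart_cod (chart_at p).
  by apply/seteqP; split=> x /=; [case | exact: mul_chart_dom_right].
move=> k; have [_ /(_ (delta_mx 0 i, 0)) Dm] := @mul_chart_smooth 1%g p p k.+1.
have oU' : open [set x | mul_chart_dom 1%g p p (y1, x)] by rewrite UE.
have S := @Ck_slicer R _ _ _ k _ _ y1 oU' Dm; rewrite UE in S.
apply: (Ck_eq oU _ (Ck_coord j oU S)) => x cx.
have [dm dmE _ _] := diff_slice (mul_chart_diff (mul_chart_dom_right cx)).
by rewrite (jacobian_derive _ _ dm) dmE.
Qed.

End Tangent.

(** * Smooth families of spin lifts *)

Section FockFunctions.
Context (R : realType) (X : Type) (U : set X) (C : (X -> R) -> Prop).
Hypothesis CA : function_algebra U C.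
Variable n : nat.

Lemma mx_fun_iota (F : X -> 'rV[R]_n) : mx_fun C F -> mx_fun C (fun x => iota (F x)).
Proof.
move=> CF; under eq_fun do rewrite iotaE.
by apply: (mx_fun_sum CA) => i; apply: (mx_fun_scale CA); [exact: CF | exact: (mx_fun_cst CA)].
Qed.

Lemma mx_fun_fock_form (F : X -> 'cV[R]_((fock_dim n).+1)) k (A : X -> 'M[R]_(k, n)) :
  mx_fun C F -> mx_fun C A -> C (fun x => fock_form (F x) (A x)).
Proof.
elim: k F A => [|k IHk] F A CF CFA.
  under eq_fun do rewrite fock_form0.
  by apply: (mx_fun_mul CA) => //; exact: (mx_fun_cst CA).
under eq_fun do rewrite fock_formS; apply: IHk.
  apply: (mx_fun_mul CA) => //; apply: mx_fun_iota => i j.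
  by under eq_fun do rewrite mxE.
by move=> i j; under eq_fun do rewrite mxE.
Qed.

Lemma mx_fun_qann (P : X -> 'M[R]_n) : mx_fun C P -> mx_fun C (fun x => qann (P x)).
Proof.
move=> CP; apply: (mx_fun_sum CA) => i; apply: (mx_fun_sum CA) => j.
by apply: (mx_fun_scale CA); [exact: CP | exact: (mx_fun_cst CA)].
Qed.

Lemma mx_fun_eann (P : X -> 'M[R]_n) : mx_fun C P -> mx_fun C (fun x => eann (P x)).
Proof.
move=> CP; apply: (mx_fun_sum CA) => k; apply: (mx_fun_scale_cst CA).
by apply: (mx_fun_exp CA); exact: mx_fun_qann.
Qed.

Lemma mx_fun_ecre (P : X -> 'M[R]_n) : mx_fun C P -> mx_fun C (fun x => ecre (P x)).
Proof. by move=> CP; apply: mx_fun_tr; apply: mx_fun_eann; exact: mx_fun_tr. Qed.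

Lemma mx_fun_pull (M : X -> 'M[R]_n) : mx_fun C M -> mx_fun C (fun x => pull (M x)).
Proof.
move=> CM; apply: (mx_fun_sum CA) => k; apply: (mx_fun_scale_cst CA).
have CW : mx_fun C (fun x => M x - 1%:M).
  by apply: (mx_fun_sub CA) => //; exact: (mx_fun_cst CA).
elim: (nat_of_ord k) => [|m IHm] /=; first exact: (mx_fun_cst CA).
apply: (mx_fun_sum CA) => i; apply: (mx_fun_sum CA) => j.
apply: (mx_fun_scale CA); first exact: CW.
apply: (mx_fun_mul CA); last exact: (mx_fun_cst CA).
by apply: (mx_fun_mul CA) => //; exact: (mx_fun_cst CA).
Qed.

Lemma mx_fun_gauss (b : 'M[R]_n) (A : X -> 'M[R]_n) :
  (forall x, U x -> 1%:M + A x \in unitmx) -> mx_fun C A ->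
  mx_fun C (fun x => gauss b (A x)).
Proof.
move=> Au CFA.
have CV : mx_fun C (fun x => invmx (1%:M + A x)).
  apply: (mx_fun_inv CA) => //; apply: (mx_fun_add CA) => //; exact: (mx_fun_cst CA).
have CD : mx_fun C (fun x => (1%:M - A x) *m invmx (1%:M + A x)).
  apply: (mx_fun_mul CA) => //; apply: (mx_fun_sub CA) => //; exact: (mx_fun_cst CA).
apply: (mx_fun_mul CA); first apply: (mx_fun_mul CA).
- apply: mx_fun_ecre; apply: (mx_fun_scale_cst CA).
  by apply: (mx_fun_mul CA) => //; exact: (mx_fun_cst CA).
- by apply: mx_fun_pull; exact: (mx_fun_scale_cst CA).
by apply: mx_fun_eann; apply: (mx_fun_mul CA) => //; exact: (mx_fun_cst CA).
Qed.

Definition spin_section (b : 'M[R]_n) (A : 'M[R]_n) :=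
  Num.sqrt (\det (2^-1 *: (A + 1%:M))) *: gauss b A.

Lemma mx_fun_spin_section (b : 'M[R]_n) (A : X -> 'M[R]_n) :
  (forall x, U x -> 0 < \det (2^-1 *: (A x + 1%:M))) -> mx_fun C A ->
  mx_fun C (fun x => spin_section b (A x)).
Proof.
move=> Ad0 CFA; apply: (mx_fun_scale CA).
  apply: (fun_alg_sqrt CA) => //; apply: (mx_fun_det CA); apply: (mx_fun_scale_cst CA).
  by apply: (mx_fun_add CA) => //; exact: (mx_fun_cst CA).
apply: mx_fun_gauss => // x /Ad0; rewrite detZ addrC unitmxE unitfE => d0.
by apply: contraTneq d0 => ->; rewrite mulr0 ltxx.
Qed.

End FockFunctions.

Section SpinSection.
Context (R : realType) (n : nat) (b : 'M[R]_n).

Lemma spin_section_unitmx (A : 'M[R]_n) :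
  0 < \det (2^-1 *: (A + 1%:M)) -> 1%:M + A \in unitmx.
Proof.
rewrite detZ addrC unitmxE unitfE => d0.
by apply: contraTneq d0 => ->; rewrite mulr0 ltxx.
Qed.

Lemma texp0 (A : algType R) K : texp K (0 : A) = 1.
Proof.
rewrite /texp big_ord_recl expr0 fact0 invr1 scale1r big1 ?addr0 // => i _.
by rewrite expr0n scaler0.
Qed.

Lemma eann0 : eann (0 : 'M[R]_n) = 1.
Proof.
rewrite /eann (_ : qann 0 = 0) ?texp0 //.
by rewrite /qann big1 // => i _; rewrite big1 // => j _; rewrite mxE scale0r.
Qed.

Lemma pull1 : pull (1%:M : 'M[R]_n) = 1.
Proof.
rewrite /pull big_ord_recl fact0 invr1 scale1r big1 ?addr0 // => k _ /=.
by rewrite big1 ?scaler0 // => i _; rewrite big1 // => j _; rewrite subrr mxE scale0r.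
Qed.

Lemma half_double1 : 2^-1 *: (1%:M + 1%:M) = 1%:M :> 'M[R]_n.
Proof. by rewrite scalerDr -scalerDl (_ : 2^-1 + 2^-1 = 1) ?scale1r //; lra. Qed.

Lemma spin_section1 : spin_section b 1%:M = 1.
Proof.
rewrite /spin_section half_double1 det1 sqrtr1 scale1r /gauss subrr mul0mx mulmx0 mul0mx.
rewrite scaler0 /ecre trmx0 eann0 trmx1 mul1r mulr1.
have -> : 2 *: invmx (1%:M + 1%:M) = 1%:M :> 'M[R]_n.
  have U : (1%:M + 1%:M : 'M[R]_n) \in unitmx.
    suff /mulmx1_unit[] : (2^-1 *: 1%:M : 'M[R]_n) *m (1%:M + 1%:M) = 1%:M by [].
    by rewrite -scalemxAl mul1mx half_double1.
  apply: (can_inj (mulmxK U)); rewrite -scalemxAl mulVmx // mul1mx.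
  by rewrite scaler_nat mulr2n.
exact: pull1.
Qed.

Lemma vac_coef_spin_section (A : 'M[R]_n) : 0 < \det (2^-1 *: (A + 1%:M)) ->
  0 < vac_coef (spin_section b A).
Proof.
move=> d0; rewrite /vac_coef /spin_section -!mulmxA -scalemxAl -scalemxAr mxE.
by rewrite gauss_vac vac_coef_gauss mulr1 sqrtr_gt0.
Qed.

End SpinSection.

Section BilinearForms.
Context (R : realType) (n : nat) (B : 'rV[R]_n -> 'rV[R]_n -> R).
Hypothesis B_linr : forall u, scalar (B u).
Hypothesis B_linl : forall v, scalar (B ^~ v).
Hypothesis B_sym : forall u v, B u v = B v u.
Hypothesis B_nondeg : forall u, (forall v, B u v = 0) -> u = 0.

Definition gram : 'M[R]_n := \matrix_(i, j) B (delta_mx 0 i) (delta_mx 0 j).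

Lemma scalar_row_sum (f : 'rV[R]_n -> R) u :
  scalar f -> f u = \sum_i u 0 i * f (delta_mx 0 i).
Proof.
move=> flin; have f0 : f 0 = 0.
  by have := flin (-1) 0 0; rewrite scaler0 addr0 mulN1r addNr.
have fD x y : f (x + y) = f x + f y by have := flin 1 x y; rewrite scale1r mul1r.
rewrite {1}[u]row_sum_delta (big_morph f fD f0); apply: eq_bigr => i _.
by have := flin (u 0 i) (delta_mx 0 i) 0; rewrite !addr0 f0 addr0.
Qed.

Lemma gramE u v : B u v = (u *m gram *m v^T) 0 0.
Proof.
rewrite (scalar_row_sum u (B_linl v)) mxE.
under eq_bigr do rewrite (scalar_row_sum v (B_linr _)) mulr_sumr.
rewrite exchange_big; apply: eq_bigr => j _; rewrite !mxE mulr_suml.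
by apply: eq_bigr => i _; rewrite mxE mulrA mulrAC.
Qed.

Lemma gram_sym : gram^T = gram.
Proof. by apply/matrixP => i j; rewrite !mxE B_sym. Qed.

Lemma gram_unit : gram \in unitmx.
Proof.
rewrite -row_free_unit -kermx_eq0; apply/eqP/row_matrixP => i; rewrite row0.
by apply: B_nondeg => v; rewrite gramE -row_mul mulmx_ker row0 mul0mx mxE.
Qed.

Lemma gram_orth A : (forall u v, B (u *m A) (v *m A) = B u v) ->
  A *m gram *m A^T = gram.
Proof.
move=> BA; apply/matrixP => i j.
have := BA (delta_mx 0 i) (delta_mx 0 j); rewrite gramE trmx_mul.
rewrite !mulmxA -(mulmxA _ A) -(mulmxA _ (A *m gram)) -rowE trmx_delta -colE !mxE.
by move=> ->.
Qed.

End BilinearForms.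

Section AdjointContinuity.
Context (R : realType) (n : nat) (G : lieGroupType R n).
Implicit Types (p g h : G).

Lemma Ad_smooth p : mx_fun (fun f : 'rV[R]_n -> R => smooth_on (chart_cod (chart_at p)) f)
  (fun x => Ad (chart_inv (chart_at p) x)).
Proof.
have CA := smooth_function_algebra (@chart_cod_open R n G p).
apply: (mx_fun_eq CA (F := fun x => left_frame p x *m invmx (right_frame p x))).
  by move=> x cx; rewrite (right_frame_unit cx).2.
apply: (mx_fun_mul CA); first exact: left_frame_smooth.
apply: (mx_fun_inv CA); last exact: right_frame_smooth.
by move=> x /right_frame_unit[].
Qed.

Lemma chart_continuity (T : topologicalType) (f : G -> T) p :
  (f \o chart_inv (chart_at p)) @ chart_at p p --> f p -> f @ p --> f p.
Proof.
move=> cf; have := cvg_comp _ _ (chart_cvg (mem_chart_at p)) cf.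
apply: cvg_trans; apply: near_eq_cvg.
have := open_nbhs_nbhs (conj (@chart_dom_open _ _ _ p) (mem_chart_at p)).
by apply: filterS => q dq /=; rewrite chart_invK.
Qed.

Lemma Ad_cts : mx_fun (fun f : G -> R => forall g, [set: G] g -> f @ g --> f g)
  (fun g => Ad g).
Proof.
move=> i j g _; apply: chart_continuity.
have := @Ad_smooth g i j 0%N _ (@chart_cod_center _ _ _ g).
by rewrite /prop_for /continuous_at /= chart_center.
Qed.

Lemma local_paths p (W : set G) : open W -> W p ->
  \forall g \near p, exists gamma : R -> G,
    [/\ {within `[0, 1], continuous gamma}, gamma 0 = p, gamma 1 = g &
        forall t, 0 <= t <= 1 -> W (gamma t)].
Proof.
move=> oW Wp; pose y := chart_at p p.
have : \forall z \near y, chart_cod (chart_at p) z /\ W (chart_inv (chart_at p) z).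
  apply: filterI.
    by apply: open_nbhs_nbhs; split; [exact: chart_cod_open | exact: chart_cod_center].
  apply: (chart_inv_cvg (@chart_cod_center _ _ _ p)).
  by rewrite chart_center; exact: open_nbhs_nbhs.
move=> /nbhs_ballP[e /= e0 eW].
have cb : \forall g \near p, ball y e (chart_at p g).
  by apply: (chart_cvg (mem_chart_at p)); exact: nbhsx_ballx.
have db := open_nbhs_nbhs (conj (@chart_dom_open _ _ _ p) (mem_chart_at p)).
apply: filterS2 cb db => g; rewrite -ball_normE /= => yg dg.
pose l (t : R) := y + t *: (chart_at p g - y).
have lW t : 0 <= t <= 1 -> chart_cod (chart_at p) (l t) /\ W (chart_inv (chart_at p) (l t)).
  move=> /andP[t0 t1]; apply: eW; rewrite -ball_normE /= /l opprD addNKr normrN normrZ.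
  rewrite distrC in yg; apply: le_lt_trans yg; rewrite (ger0_norm t0).
  by rewrite ler_piMl.
have cl (t : R) : l @ t --> l t.
  by apply: cvgD; [exact: cvg_cst | apply: cvgZr_tmp; exact: cvg_id].
exists (chart_inv (chart_at p) \o l); split.
- apply/within_cvg => t; rewrite /= in_itv => t01; apply: cvg_within_filter.
  exact: (cvg_comp _ _ (cl t) (chart_inv_cvg (lW t t01).1)).
- by rewrite /l /= scale0r addr0 chart_center.
- by rewrite /l /= scale1r subrKC chart_invK.
by move=> t t01; exact: (lW t t01).2.
Qed.

End AdjointContinuity.

Section InvariantForm.
Context (R : realType) (n : nat) (G : lieGroupType R n).
Variable metric : G -> 'rV[R]_n -> 'rV[R]_n -> R.
Hypothesis metric_inv : bi_invariant metric.

Lemma metric_Ad (g : G) u v :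
  metric 1%g (u *m Ad g) (v *m Ad g) = metric 1%g u v.
Proof.
rewrite AdE !mulmxA.
have [<- _] := metric_inv g 1%g u v.
have := (metric_inv g^-1%g (g * 1)%g (u *m tangent_mx (lmul g) 1%g)
  (v *m tangent_mx (lmul g) 1%g)).2.
by move=> <-; rewrite mulg1 mulgV.
Qed.

End InvariantForm.

Section SpinCover.
Context (R : realType) (n : nat) (G : lieGroupType R n) (b : 'M[R]_n).
Hypothesis G_simply_connected : simply_connected R G.
Hypothesis b_unit : b \in unitmx.
Hypothesis b_sym : b^T = b.
Hypothesis Ad_orth : forall g : G, Ad g *m b *m (Ad g)^T = b.

Let W : set G := [set g | 0 < \det (2^-1 *: (Ad g + 1%:M))].

Lemma det_Ad_cts (g : G) :
  (fun g => \det (2^-1 *: (Ad g + 1%:M))) @ g --> \det (2^-1 *: (Ad g + 1%:M)).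
Proof.
have CA := @continuous_function_algebra R G setT openT.
apply: (mx_fun_det CA) => //; apply: (mx_fun_scale_cst CA).
by apply: (mx_fun_add CA); [exact: Ad_cts | exact: (mx_fun_cst CA)].
Qed.

Lemma det_Ad_pos_open : open W.
Proof.
rewrite openE => g Wg; rewrite /interior /=.
exact: (cvgr_gt _ (@det_Ad_cts g)).
Qed.

Lemma spin_cover : exists S : G -> 'M[R]_((fock_dim n).+1),
  [/\ forall g, spin_lift b (Ad g) (S g),
      forall g h, S (g * h)%g = S g * S h &
      \forall g \near (1%g : G), 0 < \det (2^-1 *: (Ad g + 1%:M)) /\
        S g = spin_section b (Ad g)].
Proof.
have W1 : W 1%g by rewrite /W /= Ad1 half_double1 det1.
have [||||||||||S [Sl SM Snear]] := @double_cover_section R n G (fock_dim n)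
    (fun g => spin_lift b (Ad g)) _ _ _ _ _ W (fun g => spin_section b (Ad g)) det_Ad_pos_open W1.
- by move=> g T T'; exact: spin_lift_uniq.
- by move=> g T; exact: spin_lift_unit.
- by move=> g T; exact: spin_liftN.
- by rewrite Ad1; exact: spin_lift1.
- by move=> g h T U gT hU; rewrite AdM; exact: spin_liftM.
- by rewrite Ad1 spin_section1.
- by move=> w Ww; apply: gauss_spin_lift => //; exact: spin_section_unitmx.
- move=> w Ww i j.
  have CA := @continuous_function_algebra R G W det_Ad_pos_open.
  apply: (mx_fun_spin_section CA) => // {}i {}j g _; exact: Ad_cts.
- exact: G_simply_connected.
- exact: local_paths det_Ad_pos_open W1.
exists S; split=> //; apply: filterI => //.
exact: open_nbhs_nbhs (conj det_Ad_pos_open W1).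
Qed.

End SpinCover.

(** * The pure spinor form *)

Section RepresentationCoefficients.
Context (R : realType) (n : nat) (G : lieGroupType R n) (N : nat).
Hypothesis G_simply_connected : simply_connected R G.
Variable S : G -> 'M[R]_N.
Hypothesis SM : forall g h, S (g * h)%g = S g *m S h.
Hypothesis S1 : S 1%g = 1%:M.
Variable v : 'cV[R]_N.

(* A matrix whose row space is maximal among those annihilating S w *m v for all w
   near 1 has a row space that is stable under S. *)
Lemma coefficient_annihilator : exists Y : 'M[R]_N,
  [/\ forall g, (Y *m S g <= Y)%MS, Y *m v = 0 &
      forall y : 'rV[R]_N, (\forall w \near (1%g : G), y *m S w *m v = 0) -> (y <= Y)%MS].
Proof.
pose ann (Y : 'M[R]_N) := \forall w \near (1%g : G), (Y <= kermx (S w *m v))%MS.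
pose P r := `[< exists2 Y, ann Y & \rank Y = r >].
have exP : exists r, P r.
  by exists 0%N; apply/asboolP; exists 0; rewrite ?mxrank0 //; apply: nearW => w; rewrite sub0mx.
have bP r : P r -> (r <= N)%N by move=> /asboolP[Y _ <-]; exact: rank_leq_row.
case: (ex_maxnP exP bP) => r /asboolP[Y annY rY] maxr.
have absorb m (Z : 'M[R]_(m, N)) :
    (\forall w \near (1%g : G), (Z <= kermx (S w *m v))%MS) -> (Z <= Y)%MS.
  move=> annZ; have annYZ : ann (Y + Z)%MS.
    by apply: filterS2 annY annZ => w Yw Zw; rewrite addsmx_sub Yw.
  have rYZ : (\rank (Y + Z)%MS <= \rank Y)%N.
    by rewrite rY; apply: maxr; apply/asboolP; exists (Y + Z)%MS.
  apply: submx_trans (addsmxSr Y Z) _.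
  by rewrite -(mxrank_leqif_sup (addsmxSl Y Z)).2 eqn_leq rYZ mxrankS ?addsmxSl.
exists Y; split.
- apply: (path_generated G_simply_connected) => [g h Yg Yh|].
    by rewrite SM mulmxA; apply: submx_trans Yh; exact: submxMr.
  have [[A B] /= [A1 B1] AB] : filter_prod (nbhs (1%g : G)) (nbhs (1%g : G))
      [set p | (Y <= kermx (S (p.1 * p.2)%g *m v))%MS].
    have c2 : (fun p : G * G => p.1 * p.2)%g @ filter_prod (nbhs 1%g) (nbhs 1%g) --> (1%g : G).
      rewrite -{3}(mulg1 (1%g : G)); apply: mulg_cvg; [exact: cvg_fst | exact: cvg_snd].
    exact: c2 _ annY.
  apply: filterS A1 => g Ag; apply: absorb; apply: filterS B1 => w Bw.
  have := AB (g, w) (conj Ag Bw); rewrite /= !sub_kermx SM.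
  by rewrite !mulmxA.
- by have := nbhs_singleton annY; rewrite S1 mul1mx sub_kermx => /eqP.
by move=> y annY'; apply: absorb; apply: filterS annY' => w; rewrite sub_kermx mulmxA => ->.
Qed.

Lemma coefficient_dense (l : 'rV[R]_N) (g : G) : l *m v != 0 ->
  ~ (\forall h \near g, l *m S h *m v = 0).
Proof.
move=> lv0 near0; have [Y [YS Yv Ymax]] := coefficient_annihilator.
have : (l *m S g <= Y)%MS.
  apply: Ymax; have cg : (fun w => g * w)%g @ (1%g : G) --> g.
    by rewrite -{2}(mulg1 g); apply: mulg_cvg; [exact: cvg_cst | exact: cvg_id].
  have : \forall w \near (1%g : G), l *m S (g * w)%g *m v = 0 := cg _ near0.
  by apply: filterS => w; rewrite SM mulmxA.
move=> /(submxMr (S g^-1)%g) /submx_trans/(_ (YS _)).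
rewrite -mulmxA -SM mulgV S1 mulmx1 => /submxP[D lE].
by move: lv0; rewrite lE -mulmxA Yv mulmx0 eqxx.
Qed.

End RepresentationCoefficients.

Section SpinForm.
Context (R : realType) (n : nat) (G : lieGroupType R n) (b : 'M[R]_n).
Hypothesis G_simply_connected : simply_connected R G.
Hypothesis b_unit : b \in unitmx.
Hypothesis b_sym : b^T = b.
Hypothesis Ad_orth : forall g : G, Ad g *m b *m (Ad g)^T = b.
Variable S : G -> 'M[R]_((fock_dim n).+1).
Hypothesis S_lift : forall g, spin_lift b (Ad g) (S g).
Hypothesis SM : forall g h, S (g * h)%g = S g * S h.
Hypothesis S_near1 : \forall g \near (1%g : G),
  0 < \det (2^-1 *: (Ad g + 1%:M)) /\ S g = spin_section b (Ad g).
Notation vac := (vac R n).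

Lemma spin_cover1 : S 1%g = 1.
Proof.
have Su := spin_lift_unit (S_lift 1%g).
by apply: (mulrI Su); rewrite mulr1 -SM mulg1.
Qed.

(* The form psi of the theorem: a pure spinor transported by left translations. *)
Definition spin_form (g : G) : mixed_form R n :=
  fun k X => fock_form (S g *m vac) (X *m thetaL g).

Lemma spin_form_smooth : smooth_form spin_form.
Proof.
split=> [g|p k A j].
  have -> : spin_form g = @fock_form R n (pull (thetaL g) *m (S g *m vac)).
    by apply: functional_extensionality_dep => k; apply/funext => X; rewrite fock_form_pull.
  exact: fock_form_alternating.
apply: Ck_local => x0 cx0; pose g0 := chart_inv (chart_at p) x0.
pose Q := [set g : G | 0 < \det (2^-1 *: (Ad g + 1%:M)) /\ S g = spin_section b (Ad g)].
pose t x := (g0^-1 * chart_inv (chart_at p) x)%g.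
pose U := chart_cod (chart_at p) `&` t @^-1` Q^°.
have ct x : chart_cod (chart_at p) x -> t @ x --> t x.
  move=> cx; have cst : (fun _ : 'rV[R]_n => g0^-1)%g @ x --> (g0^-1)%g.
    by apply: cvg_cst; exact: (nbhs_filter x).
  exact: mulg_cvg cst (chart_inv_cvg cx).
have oU : open U.
  rewrite openE => x [cx tx]; apply: filterI.
    exact: open_nbhs_nbhs (conj (@chart_cod_open _ _ _ p) cx).
  by apply: (ct x cx); exact: open_nbhs_nbhs (conj (@open_interior _ _) tx).
exists U; first by split=> //; rewrite /t /= mulVg; exact: S_near1.
have CA := smooth_function_algebra oU; move: j.
have sub (f : 'rV[R]_n -> R) : smooth_on (chart_cod (chart_at p)) f -> smooth_on U f.
  by move=> sf j; apply: Ck_sub (sf j) => x [].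
apply: (fun_alg_eq CA (f := fun x => fock_form
  (S g0 *m spin_section b (Ad (chart_inv (chart_at p) x) *m Ad g0^-1%g) *m vac)
  (A *m invmx (left_frame p x)))).
  move=> x [cx /interior_subset[_ Sx]].
  have -> : Ad (chart_inv (chart_at p) x) *m Ad g0^-1%g = Ad (t x) by rewrite /t AdM.
  have SE : S (chart_inv (chart_at p) x) = S g0 *m S (t x) by rewrite mulmxE -SM /t mulVKg.
  by rewrite -Sx -(left_frame_unit cx).2 /spin_form SE !mulmxA.
apply: (mx_fun_fock_form CA).
  apply: (mx_fun_mul CA); last exact: (mx_fun_cst CA).
  apply: (mx_fun_mul CA); first exact: (mx_fun_cst CA).
  apply: (mx_fun_spin_section CA) => [x [_ /interior_subset[]]|]; first by rewrite -AdM.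
  apply: (mx_fun_mul CA); last exact: (mx_fun_cst CA).
  by move=> i j; apply: sub; exact: Ad_smooth.
apply: (mx_fun_mul CA); first exact: (mx_fun_cst CA).
apply: (mx_fun_inv CA) => [x [/left_frame_unit[]]//|i j].
by apply: sub; exact: left_frame_smooth.
Qed.

Lemma vac_coef_S_near1 : \forall g \near (1%g : G), 0 < vac_coef (S g).
Proof. by apply: filterS S_near1 => g [d0 ->]; exact: vac_coef_spin_section. Qed.

Lemma vac_coef_conj_pull (M : 'M[R]_n) (T : 'M[R]_((fock_dim n).+1)) : M \in unitmx ->
  vac_coef (pull M * T * (pull M)^-1) = vac_coef T.
Proof.
move=> Mu; have pu := pull_unit Mu; rewrite /vac_coef -!mulmxE.
have -> : vac^T *m (pull M *m T *m (pull M)^-1) *m vac =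
    (vac^T *m pull M) *m T *m ((pull M)^-1 *m vac) by rewrite !mulmxA.
have -> : (pull M)^-1 *m vac = vac by rewrite -{1}(pull_vac M) mulmxA mulmxE mulVr // mul1mx.
by have -> : vac^T *m pull M = vac^T by rewrite -[pull M]trmxK -trmx_mul tr_pull pull_vac.
Qed.

Lemma conj_pull_S h g : pull (Ad h) * S (conj_by h g) * (pull (Ad h))^-1 = S g.
Proof.
have pu := pull_unit (Ad_unit h).
apply: (path_generated G_simply_connected
  (P := fun g => pull (Ad h) * S (conj_by h g) * (pull (Ad h))^-1 = S g)) => {g} [g g' Eg Eg'|].
  rewrite SM -Eg -Eg'; have -> : conj_by h (g * g')%g = (conj_by h g * conj_by h g')%g.
    by rewrite /conj_by !mulgA mulgVK.
  by rewrite SM !mulrA mulrVK.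
have cc : conj_by h @ (1%g : G) --> (1%g : G).
  by have [[]] := dmap_conj h (1%g : G); rewrite conj_by1.
have pos : \forall g \near (1%g : G), 0 < vac_coef (S (conj_by h g)) := cc _ vac_coef_S_near1.
apply: filterS2 pos vac_coef_S_near1 => g pos1 pos2.
have AdE : Ad h *m Ad (conj_by h g) *m invmx (Ad h) = Ad g.
  rewrite /conj_by AdM AdM !mulmxA -AdM mulVg Ad1 mul1mx mulmxK //; exact: Ad_unit.
have := spin_lift_pull (Ad_unit h) (Ad_orth h) (S_lift (conj_by h g)).
rewrite AdE => lK; have [//|E] := spin_lift_uniq b_unit lK (S_lift g).
have := vac_coef_conj_pull (S (conj_by h g)) (Ad_unit h); rewrite E => vE.
move: pos1; rewrite -vE /vac_coef mulmxN mulNmx mxE oppr_gt0 => /lt_trans/(_ pos2).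
by rewrite ltxx.
Qed.

Lemma spin_form_Ad_invariant : Ad_invariant spin_form.
Proof.
move=> h g k A; rewrite /spin_form -mulmxA thetaL_conj mulmxA -fock_form_pull.
have pV : (pull (Ad h))^-1 *m vac = vac.
  by rewrite -{1}(pull_vac (Ad h)) mulmxA mulmxE mulVr ?mul1mx // pull_unit // Ad_unit.
by rewrite -(conj_pull_S h g) -!mulmxE -!mulmxA pV.
Qed.

Lemma spin_formE (B : 'rV[R]_n -> 'rV[R]_n -> R) g :
  (forall u v, B u v = (u *m b *m v^T) 0 0) -> 1%:M + Ad g \in unitmx ->
  vac_coef (S g) ^+ 2 = \det (2^-1 *: (Ad g + 1%:M)) /\
  spin_form g = form_scale (vac_coef (S g))
    (form_exp (form_scale 4^-1 (cayley_form B g))).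
Proof.
move=> BE gu; have [Sv Sdet] := spin_lift_gauss b_unit b_sym (Ad_orth g) gu (S_lift g).
split=> //; apply: functional_extensionality_dep => k; apply/funext => X.
rewrite /spin_form Sv fock_formZ /form_scale; congr (_ * _).
rewrite /gauss_vec -form_exp_ecre -/(Ad_cayley g); set W := 4^-1 *: _.
apply/esym/form_exp_mulmx => {X}k; case: k => [|[|[|k]]] X; rewrite /= ?mulr0 //.
rewrite !BE !row_mul /bilin.
rewrite {}/W; move: (Ad_cayley g) (row 0 X *m _) (row 1 X *m _) => D x y.
pose W := 4^-1 *: (D *m b).
have -> : x *m (W - W^T) *m y^T = 4^-1 *: (x *m D *m b *m y^T - (y *m D *m b *m x^T)^T).
  rewrite mulmxBr mulmxBl scalerBr /W -scalemxAr -scalemxAl !mulmxA; congr (_ - _).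
  by rewrite !trmx_mul trmxK linearZ /= trmx_mul -scalemxAr -scalemxAl !mulmxA.
by rewrite !mxE.
Qed.

Lemma spin_form_neqN (g : G) : ~ (forall k (A : 'M[R]_(k, n)), spin_form g A = - spin_form g A).
Proof.
move=> psiN; apply: (spin_lift_neqN (S_lift g)); apply/eqP; rewrite -addr_eq0; apply/eqP.
have tu : thetaL g \in unitmx by have /mulmx1_unit[] := tangent_lmulV g.
apply: fock_form_inj => k A; have := psiN k (A *m invmx (thetaL g)).
rewrite /spin_form mulmxKV // => E.
have := fock_form_lin 1 1 (S g *m vac) (S g *m vac) A; rewrite !scale1r !mul1r => ->.
by rewrite {1}E addNr.
Qed.

Lemma Ad_unit_dense (g : G) : ~ (\forall h \near g, 1%:M + Ad h \notin unitmx).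
Proof.
move=> near0; apply: (@coefficient_dense R n G _ G_simply_connected S _ spin_cover1 vac vac^T g).
- by move=> h h'; rewrite SM.
- by rewrite vacK; exact: oner_neq0.
apply: filterS near0 => h hu; apply/matrixP => i j; rewrite !ord1 [RHS]mxE; apply/eqP.
by apply: contraNT hu => /(spin_lift_unitmx b_unit (S_lift h)).
Qed.

End SpinForm.

Section SmoothForms.
Context (R : realType) (n : nat) (G : lieGroupType R n).
Implicit Types (w : G -> mixed_form R n) (p g : G).

Lemma chart_frame_center p : chart_frame (chart_at p) (chart_at p p) = 1%:M.
Proof.
by rewrite -(dmap_id p).2 /chart_frame /tangent_mx chart_center.
Qed.

Lemma smooth_form_neq w w' (c : R) p k (A : 'M[R]_(k, n)) :
  smooth_form w -> smooth_form w' -> w p k A != c * w' p k A ->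
  \forall q \near p, exists A' : 'M[R]_(k, n), w q k A' != c * w' q k A'.
Proof.
move=> sw sw' neq.
pose F (v : G -> mixed_form R n) x :=
  v (chart_inv (chart_at p) x) k (A *m chart_frame (chart_at p) x).
have cx := @chart_cod_center R n G p.
have cF v : smooth_form v -> (F v \o chart_at p) @ p --> v p k A.
  move=> [_ sv]; have := sv p k A 0%N _ cx.
  rewrite /prop_for /continuous_at /= chart_frame_center mulmx1 chart_center => cv.
  exact: (cvg_comp _ _ (chart_cvg (mem_chart_at p)) cv).
have cd : (fun q => F w (chart_at p q) - c * F w' (chart_at p q)) @ p -->
    w p k A - c * w' p k A.
  by apply: cvgB; [exact: cF | apply: cvgM; [exact: cvg_cst | exact: cF]].
have neq0 : w p k A - c * w' p k A != 0 by rewrite subr_eq0.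
have near0 : \forall q \near p, F w (chart_at p q) - c * F w' (chart_at p q) != 0.
  exact: (cvgr_neq0 _ cd).
have := open_nbhs_nbhs (conj (@chart_dom_open _ _ _ p) (mem_chart_at p)).
apply: filterS2 near0 => q neq_q dq; exists (A *m chart_frame (chart_at p) (chart_at p q)).
by move: neq_q; rewrite /F chart_invK // subr_eq0.
Qed.

End SmoothForms.

Section Uniqueness.
Context (R : realType) (n : nat) (G : lieGroupType R n).
Hypothesis G_simply_connected : simply_connected R G.
Variables psi psi' : G -> mixed_form R n.
Hypothesis psi_smooth : smooth_form psi.
Hypothesis psi'_smooth : smooth_form psi'.
Hypothesis psi_neqN : forall g, ~ (forall k (A : 'M[R]_(k, n)), psi g A = - psi g A).
Hypothesis dense : forall g : G, ~ (\forall h \near g, 1%:M + Ad h \notin unitmx).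
Hypothesis psi_sign : forall g, 1%:M + Ad g \in unitmx ->
  exists c : R, (c = 1 \/ c = -1) /\ forall k (A : 'M[R]_(k, n)), psi' g A = c * psi g A.
Hypothesis psi1 : psi' 1%g = psi 1%g.

Let same (c : R) g := forall k (A : 'M[R]_(k, n)), psi' g A = c * psi g A.

Lemma near_not_same c g : ~ same c g -> \forall h \near g, ~ same c h.
Proof.
move=> nsame; have [k [A neq]] : exists k, exists A : 'M[R]_(k, n), psi' g A != c * psi g A.
  apply: contrapT => nex; apply: nsame => k A; apply/eqP; apply: contrapT => /negP neq.
  by apply: nex; exists k, A.
have := smooth_form_neq psi'_smooth psi_smooth neq.
by apply: filterS => h [A' neq'] sh; move: neq'; rewrite sh eqxx.
Qed.

Lemma same_or_opposite g : same 1 g \/ same (-1) g.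
Proof.
have [s1|ns1] := pselect (same 1 g); first by left.
have [sN1|nsN1] := pselect (same (-1) g); first by right.
exfalso; apply: (@dense g).
apply: filterS2 (near_not_same ns1) (near_not_same nsN1) => h n1 nN1.
by apply/negP => /psi_sign[c [[->|->] ?]].
Qed.

Lemma smooth_form_uniq : psi' = psi.
Proof.
suff same1 g : same 1 g.
  apply/funext => g; apply: functional_extensionality_dep => k; apply/funext => A.
  by rewrite same1 mul1r.
have excl h : same 1 h -> ~ same (-1) h.
  by move=> s1 sN1; apply: (@psi_neqN h) => k A; rewrite -[LHS]mul1r -s1 sN1 mulN1r.
have loc h : \forall q \near h, same 1 q <-> same 1 h.
  have [s1|ns1] := pselect (same 1 h).
    apply: filterS (near_not_same (excl _ s1)) => q nq.
    by split=> // _; have [] := same_or_opposite q.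
  by apply: filterS (near_not_same ns1) => q nq.
have [gamma [/within_cvg cg g0 g1]] := G_simply_connected.1 1%g g.
have Ploc (t : R) : 0 <= t <= 1 ->
    \forall s \near t, 0 <= s <= 1 -> (same 1 (gamma s) <-> same 1 (gamma t)).
  move=> t01; have Et : `[0, 1]%classic t by rewrite /= in_itv.
  have : \forall s \near t, `[0, 1]%classic s -> (same 1 (gamma s) <-> same 1 (gamma t)).
    exact: cg t Et _ (loc (gamma t)).
  by apply: filterS => s + s01; apply; rewrite /= in_itv.
have l1 : 0 <= (1 : R) <= 1 by rewrite lexx ler01.
have := (locally_constant_segment Ploc l1).2.
rewrite g0 g1; apply => k A.
by rewrite psi1 mul1r.
Qed.

End Uniqueness.

Theorem theorem2p4 (R : realType) (n : nat) (G : lieGroupType R n)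
    (metric : G -> 'rV[R]_n -> 'rV[R]_n -> R)
    (G_simply_connected : simply_connected R G)
    (metricP : pseudo_riemannian_metric metric)
    (metric_inv : bi_invariant metric) :
  let B := metric (1%g : G) in
  exists! psi : G -> mixed_form R n,
    [/\ smooth_form psi,
        Ad_invariant psi &
        exists sqrt_det : G -> R,
          sqrt_det (1%g : G) = 1 /\
          forall g : G, 1%:M + Ad g \in unitmx ->
            sqrt_det g ^+ 2 = \det (2^-1 *: (Ad g + 1%:M)) /\
            psi g = form_scale (sqrt_det g)
                      (form_exp (form_scale 4^-1 (cayley_form B g)))].
Proof.
move=> B; have [B_lin B_sym B_nondeg _] := metricP.
have [Blr Bll] := B_lin 1%g; have Bs := B_sym 1%g.
pose b := gram B.
have BE u v : B u v = (u *m b *m v^T) 0 0 by exact: gramE Blr Bll u v.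
have b_sym : b^T = b by exact: gram_sym.
have b_unit : b \in unitmx by exact: (gram_unit Blr Bll (B_nondeg 1%g)).
have Ad_orth (g : G) : Ad g *m b *m (Ad g)^T = b.
  by apply: (gram_orth Blr Bll) => u v; exact: metric_Ad metric_inv g u v.
have [S [S_lift SM S_near1]] := spin_cover G_simply_connected b_unit b_sym Ad_orth.
have S1 := spin_cover1 S_lift SM.
have unit1 : 1%:M + Ad (1%g : G) \in unitmx.
  by apply: spin_section_unitmx; rewrite Ad1 half_double1 det1.
have coef1 : vac_coef (S 1%g) = 1 by rewrite S1 /vac_coef mulmx1 vacK mxE.
have formula := spin_formE b_unit b_sym Ad_orth S_lift BE.
exists (spin_form S); split=> [|psi' [psi'_smooth psi'_Ad [s' [s'1 s'E]]]].
  split.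
  - exact: (spin_form_smooth SM S_near1).
  - exact: (spin_form_Ad_invariant G_simply_connected b_unit Ad_orth S_lift SM S_near1).
  - by exists (fun g => vac_coef (S g)); split; [exact: coef1 | exact: formula].
apply: esym; apply: (smooth_form_uniq G_simply_connected (psi := spin_form S)).
- exact: (spin_form_smooth SM S_near1).
- exact: psi'_smooth.
- exact: (spin_form_neqN S_lift).
- exact: (Ad_unit_dense G_simply_connected b_unit S_lift SM).
- move=> g gu; have [s'2 ->] := s'E g gu; have [s2 ->] := formula g gu.
  have : s' g ^+ 2 == vac_coef (S g) ^+ 2 by rewrite s'2 s2.
  rewrite eqf_sqr => /orP[/eqP->|/eqP->].
    by exists 1; split=> [|k A]; [left | rewrite mul1r].
  by exists (-1); split=> [|k A]; [right | rewrite /form_scale mulN1r mulNr].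
by rewrite (s'E 1%g unit1).2 (formula 1%g unit1).2 s'1 coef1.
Qed.
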